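(* Let $X=\tilde X/\Gamma$ be a compact (resp. convex cocompact) locally $\mathrm{CAT}(-1)$ space with $\Gamma$ non-elementary. Then the geodesic flow on $Y=GX$ (resp. $Y=\hat GX$) is a metric Anosov flow.
   Context: A $\mathrm{CAT}(-1)$ space is a geodesic metric space whose geodesic triangles are no thicker than comparison triangles in $\mathbb H^2$. $\tilde X$ is a $\mathrm{CAT}(-1)$ space, $\Gamma$ a discrete group of isometries acting freely and properly discontinuously, $X=\tilde X/\Gamma$; non-elementary means $\Gamma$ is infinite and does not contain $\mathbb Z$ as a finite index subgroup. $\Lambda\subset\partial^\infty\tilde X$ is the limit set of $\Gamma$, $C(\Lambda)$ its convex hull; $X$ is convex cocompact if $C(\Lambda)/\Gamma$ is compact. A geodesic is a local isometry from $\mathbb R$; $GY$ is the set of geodesics of $Y$, and the geodesic flow is $g_tc(s)=c(s+t)$. $\hat G\tilde X$ is the set of geodesics in $\tilde X$ with image in $C(\Lambda)$, $\hat GX=\hat G\tilde X/\Gamma$. Metrics: $d_{G\tilde X}(\tilde c,\tilde c')=\int_{-\infty}^\infty d_{\tilde X}(\tilde c(s),\tilde c'(s))e^{-2|s|}ds$, and $d_{GX}(c,c')$ is the infimum of $d_{G\tilde X}$ over lifts of $c,c'$. Metric Anosov flow. Let $(\phi_t)$ be a continuous flow on a compact metric space $(Y,d)$. For $\epsilon>0$ let $(Y\times Y)_\epsilon=\{(x,y): d(x,y)<\epsilon\}$. Assume there are $\epsilon>0$ and a continuous map $\langle\cdot,\cdot\rangle:(Y\times Y)_\epsilon\to Y$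 with (whenever defined) (a) $\langle x,x\rangle=x$; (b) $\langle\langle x,y\rangle,z\rangle=\langle x,z\rangle$; (c) $\langle x,\langle y,z\rangle\rangle=\langle x,z\rangle$; (d) if $(\phi_s x,\phi_s y)\in(Y\times Y)_\epsilon$ for all $s\in[0,t]$ then $\phi_t\langle x,y\rangle=\langle\phi_t x,\phi_t y\rangle$. Put $V^{ss}_\delta(x)=\{u: u=\langle u,x\rangle,\ d(x,u)<\delta\}$, $V^u_\delta(x)=\{v: v=\langle x,v\rangle,\ d(x,v)<\delta\}$, and, for $C,\lambda>0$, $W^{ss}_\delta(x;C,\lambda)=\{v\in V^{ss}_\delta(x): d(\phi_t x,\phi_t v)\le Ce^{-\lambda t}d(x,v)\ \forall t\ge0\}$, $W^{uu}_\delta(x;C,\lambda)=\{v\in V^u_\delta(x): d(\phi_{-t}x,\phi_{-t}v)\le Ce^{-\lambda t}d(x,v)\ \forall t\ge0\}$. The flow is metric Anosov if such $\epsilon$ and $\langle\cdot,\cdot\rangle$ exist together with constants $C,\lambda,\delta_0>0$ and a continuous $v:(Y\times Y)_\epsilon\to\mathbb R$ such that, writing $W^{*}_{\delta_0}(x)=W^{*}_{\delta_0}(x;C,\lambda)$, for all $(x,y)\in(Y\times Y)_\epsilon$: $W^{uu}_{\delta_0}(\phi_{v(x,y)}x)\cap W^{ss}_{\delta_0}(y)=\{\langle x,y\rangle\}$, and $v(x,y)$ is the unique small value of $t$ for which $W^{uu}_{\delta_0}(\phi_t x)\cap W^{ss}_{\delta_0}(y)\ne\emptyset$.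
   Formalization: The bracket, with all its axioms, is defined for pairs closer than some ρ ≥ max(ε, δ₀), while the product structure is required only for d(x,y)<ε; with one ε for both, ⟨u,x⟩ in V_δ₀ is undefined when δ₀>ε, and pairs with d(⟨x,y⟩,y)≥ε break the clause. *)

(* Defs.v *)
From HB Require Import structures.
From mathcomp Require Import all_boot all_order all_algebra.
From mathcomp Require Import all_classical all_reals all_analysis.

Set Implicit Arguments.
Unset Strict Implicit.
Unset Printing Implicit Defensive.

Import Order.TTheory GRing.Theory Num.Theory.
Import numFieldNormedType.Exports.

Local Open Scope classical_set_scope.
Local Open Scope ring_scope.
Local Open Scope quotient_scope.

Record is_distance (R : realType) (T : Type) (d : T -> T -> R) : Prop := {
  distxx : forall x, d x x = 0;
  dist_positivity : forall x y, d x y = 0 -> x = y;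
  dist_sym : forall x y, d x y = d y x;
  dist_triangle : forall y x z, d x z <= d x y + d y z }.

Definition metric_space (R : realType) (T : choiceType) (d : T -> T -> R)
  (dP : is_distance d) : Type := T.

Section MetricSpace.
Context (R : realType) (T : choiceType) (d : T -> T -> R) (dP : is_distance d).
HB.instance Definition _ := Choice.copy (metric_space dP) T.
HB.instance Definition _ := @isMetric.Build R (metric_space dP) d
  (distxx dP) (dist_positivity dP) (dist_sym dP) (dist_triangle dP).
End MetricSpace.

Section Geodesics.
Context (R : realType) (T : Type) (d : T -> T -> R).

Definition geodesic_segment (p q : T) (c : R -> T) : Prop :=
  [/\ c 0 = p, c (d p q) = q &
      forall s t, 0 <= s <= d p q -> 0 <= t <= d p q ->
        d (c s) (c t) = `|s - t|].

Definition geodesic_ray (c : R -> T) : Prop :=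
  forall s t, 0 <= s -> 0 <= t -> d (c s) (c t) = `|s - t|.

Definition geodesic (c : R -> T) : Prop :=
  forall t, exists2 e, 0 < e & forall s s',
    `|s - t| < e -> `|s' - t| < e -> d (c s) (c s') = `|s - s'|.

Definition shift (t : R) (c : R -> T) : R -> T := fun s => c (s + t).

Lemma geodesic_shift t c : geodesic c -> geodesic (shift t c).
Proof.
move=> cP u; have [e e0 ce] := cP (u + t); exists e => // s s' su su'.
have E x y : x + t - (y + t) = x - y by rewrite opprD addrACA subrr addr0.
by rewrite /shift ce E.
Qed.

End Geodesics.

Section Hyperbolic.
Context (R : realType).

Definition arcosh (u : R) : R := ln (u + Num.sqrt (u ^+ 2 - 1)).

(* Upper half-plane model *)
Definition H2 : Type := {z : R * R | 0 < z.2}.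

Definition hdist (z w : H2) : R :=
  let: (x, y) := val z in let: (x', y') := val w in
  arcosh (1 + ((x - x') ^+ 2 + (y - y') ^+ 2) / (2 * y * y')).

End Hyperbolic.

(* The vertices of a triangle are indexed cyclically: side [i] is
   parametrized by arc length from vertex [i] to vertex [i + 1]. *)
Definition geodesic_triangle (R : realType) (T : Type) (d : T -> T -> R)
    (p : 'I_3 -> T) (c : 'I_3 -> R -> T) : Prop :=
  forall i, geodesic_segment d (p i) (p (ordS i)) (c i).

Definition CAT_m1 (R : realType) (X : metricType R) : Prop :=
  (forall p q : X, exists c, geodesic_segment mdist p q c) /\
  (forall (p : 'I_3 -> X) c (p' : 'I_3 -> H2 R) c',
     geodesic_triangle mdist p c -> geodesic_triangle (@hdist R) p' c' ->
     (forall i, hdist (p' i) (p' (ordS i)) = mdist (p i) (p (ordS i))) ->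
     forall i j s t,
       0 <= s <= mdist (p i) (p (ordS i)) ->
       0 <= t <= mdist (p j) (p (ordS j)) ->
       mdist (c i s) (c j t) <= hdist (c' i s) (c' j t)).

Record isometric_action (R : realType) (G : groupType) (X : metricType R) := {
  act :> G -> X -> X;
  act1 : forall x, act 1%g x = x;
  actM : forall g h x, act (g * h)%g x = act g (act h x);
  act_isometry : forall g x y, mdist (act g x) (act g y) = mdist x y }.

(* [G] is infinite and has no finite-index subgroup isomorphic to Z. *)
Definition non_elementary (G : groupType) : Prop :=
  infinite_set [set: G] /\
  ~ exists f : int -> G,
      [/\ injective f, (forall m n, f (m + n) = (f m * f n)%g) &
          exists2 F : set G, finite_set F &
            forall g, exists2 h, F h & exists n, g = (h * f n)%g].

Section Actions.
Context (R : realType) (G : groupType) (X : metricType R).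
Variable a : isometric_action G X.

Definition free_action : Prop := forall g x, a g x = x -> g = 1%g.

Definition properly_discontinuous : Prop :=
  forall K : set X, compact K -> finite_set [set g | (a g @` K) `&` K !=set0].

Definition orbit_rel : rel X := fun x y => `[< exists g, a g x = y >].

Lemma orbit_rel_refl : reflexive orbit_rel.
Proof. by move=> x; apply/asboolP; exists 1%g; exact: act1. Qed.

Lemma orbit_rel_sym : symmetric orbit_rel.
Proof.
have H x y : orbit_rel x y -> orbit_rel y x.
  move=> /asboolP[g <-]; apply/asboolP; exists g^-1%g.
  by rewrite -actM mulVg act1.
by move=> x y; apply/idP/idP; exact: H.
Qed.

Lemma orbit_rel_trans : transitive orbit_rel.
Proof.
move=> y x z /asboolP[g <-] /asboolP[h <-]; apply/asboolP.
by exists (h * g)%g; rewrite actM.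
Qed.

Canonical orbit_equiv :=
  EquivRel orbit_rel orbit_rel_refl orbit_rel_sym orbit_rel_trans.

Definition orbit_space : topologicalType :=
  quotient_topology {eq_quot orbit_equiv}.

Definition proj : X -> orbit_space := \pi_({eq_quot orbit_equiv}).

Definition orbit_dist (x y : orbit_space) : R :=
  inf [set r | exists p q, [/\ proj p = x, proj q = y & r = mdist p q]].

(* A point at infinity is represented by its class of asymptotic rays; only
   the values of a ray on nonnegative reals are relevant. *)
Definition endpoint (c : R -> X) : set (R -> X) :=
  [set r | geodesic_ray mdist r /\
           exists M, forall t, 0 <= t -> mdist (r t) (c t) <= M].

(* For a ray [r], the sets
     {x | T < d (r 0) x, the segment from r 0 to x is e-close to r at time T}
   are the traces on [X] of a basis of neighbourhoods of [endpoint r] in the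
   cone topology, so that the limit set is the set of points at infinity that
   are accumulation points of an orbit of [G]. *)
Definition limit_set : set (set (R -> X)) :=
  [set xi | exists r, [/\ geodesic_ray mdist r, xi = endpoint r &
     forall T e, 0 < T -> 0 < e -> exists g c,
       [/\ T < mdist (r 0) (a g (r 0)),
           geodesic_segment mdist (r 0) (a g (r 0)) c &
           mdist (c T) (r T) < e]]].

Definition convex_subset (C : set X) : Prop :=
  forall p q c t, C p -> C q -> geodesic_segment mdist p q c ->
    0 <= t <= mdist p q -> C (c t).

(* The smallest closed convex set containing every geodesic with both
   endpoints in the limit set. *)
Definition convex_hull : set X :=
  \bigcap_(C in [set C | [/\ closed C, convex_subset C &
      forall c, geodesic mdist c -> limit_set (endpoint c) ->
        limit_set (endpoint (fun s => c (- s))) -> range c `<=` C]]) C.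

Definition convex_cocompact : Prop := compact (proj @` convex_hull).

Definition geodesic_dist (c c' : R -> X) : R :=
  \int[lebesgue_measure]_s (mdist (c s) (c' s) * expR (- (2 * `|s|))).

Definition GX : set (R -> orbit_space) := geodesic orbit_dist.

Definition GX_dist (c c' : GX) : R :=
  inf [set r | exists l l',
    [/\ geodesic mdist l /\ proj \o l = val c,
        geodesic mdist l' /\ proj \o l' = val c' &
        r = geodesic_dist l l']].

Lemma GX_shift_subproof t (c : GX) : shift t (val c) \in GX.
Proof. by apply/mem_set/geodesic_shift/set_mem/valP. Qed.

Definition GX_flow (t : R) (c : GX) : GX :=
  SigSub (GX_shift_subproof t c).

Definition hatGXt : set (R -> X) :=
  [set c | geodesic mdist c /\ range c `<=` convex_hull].

Definition hatGXt_rel : rel hatGXt :=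
  fun c c' => `[< exists g, a g \o val c = val c' >].

Lemma hatGXt_rel_refl : reflexive hatGXt_rel.
Proof.
by move=> c; apply/asboolP; exists 1%g; apply/funext => s; exact: act1.
Qed.

Lemma hatGXt_rel_sym : symmetric hatGXt_rel.
Proof.
have H x y : hatGXt_rel x y -> hatGXt_rel y x.
  move=> /asboolP[g gE]; apply/asboolP; exists g^-1%g.
  by rewrite -gE; apply/funext => s /=; rewrite -actM mulVg act1.
by move=> x y; apply/idP/idP; exact: H.
Qed.

Lemma hatGXt_rel_trans : transitive hatGXt_rel.
Proof.
move=> y x z /asboolP[g gE] /asboolP[h hE]; apply/asboolP.
by exists (h * g)%g; rewrite -hE -gE; apply/funext => s /=; rewrite actM.
Qed.

Canonical hatGXt_equiv :=
  EquivRel hatGXt_rel hatGXt_rel_refl hatGXt_rel_sym hatGXt_rel_trans.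

Definition hatGX : choiceType := {eq_quot hatGXt_equiv}.

Definition hatGX_proj : hatGXt -> hatGX := \pi_({eq_quot hatGXt_equiv}).

Definition hatGX_dist (c c' : hatGX) : R :=
  inf [set r | exists l l',
    [/\ hatGX_proj l = c, hatGX_proj l' = c' &
        r = geodesic_dist (val l) (val l')]].

Lemma hatGXt_shift_subproof t (c : hatGXt) : shift t (val c) \in hatGXt.
Proof.
have [cg cC] := set_mem (valP c).
apply/mem_set; split; first exact: geodesic_shift.
by move=> _ [s _ <-]; apply: cC; exists (s + t).
Qed.

Definition hatGXt_flow (t : R) (c : hatGXt) : hatGXt :=
  SigSub (hatGXt_shift_subproof t c).

Definition hatGX_flow (t : R) (c : hatGX) : hatGX :=
  hatGX_proj (hatGXt_flow t (repr (c : {eq_quot hatGXt_equiv}))).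

Lemma hatGX_flow_proj t (c : hatGXt) :
  hatGX_flow t (hatGX_proj c) = hatGX_proj (hatGXt_flow t c).
Proof.
apply/eqmodP; rewrite /=.
have /eqmodP/asboolP[g gE] : hatGX_proj (repr (hatGX_proj c :
  {eq_quot hatGXt_equiv})) = hatGX_proj c by exact: reprK.
by apply/asboolP; exists g; rewrite /= -gE.
Qed.

End Actions.

Section MetricAnosov.
Context (R : realType) (Y : metricType R) (phi : R -> Y -> Y).

Definition continuous_flow : Prop :=
  [/\ forall y, phi 0 y = y,
      forall s t y, phi (s + t) y = phi s (phi t y) &
      continuous (fun ty : R * Y => phi ty.1 ty.2)].

Definition near_pairs (e : R) : set (Y * Y) := [set p | mdist p.1 p.2 < e].

(* Brackets are only meaningful on [near_pairs e]; elsewhere [br] is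
   arbitrary, and the axioms are restricted to the pairs where both sides are
   defined. *)
Definition is_bracket (e : R) (br : Y -> Y -> Y) : Prop :=
  [/\ {within near_pairs e, continuous (fun p : Y * Y => br p.1 p.2)},
      (forall x, br x x = x),
      (forall x y z, mdist x y < e -> mdist (br x y) z < e -> mdist x z < e ->
         br (br x y) z = br x z),
      (forall x y z, mdist y z < e -> mdist x (br y z) < e -> mdist x z < e ->
         br x (br y z) = br x z) &
      (forall x y t, 0 <= t ->
         (forall s, 0 <= s <= t -> mdist (phi s x) (phi s y) < e) ->
         phi t (br x y) = br (phi t x) (phi t y))].

Definition Vss (br : Y -> Y -> Y) (delta : R) (x : Y) : set Y :=
  [set u | u = br u x /\ mdist x u < delta].

Definition Vu (br : Y -> Y -> Y) (delta : R) (x : Y) : set Y :=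
  [set v | v = br x v /\ mdist x v < delta].

Definition Wss br (delta C lambda : R) (x : Y) : set Y :=
  [set v | Vss br delta x v /\ forall t, 0 <= t ->
     mdist (phi t x) (phi t v) <= C * expR (- (lambda * t)) * mdist x v].

Definition Wuu br (delta C lambda : R) (x : Y) : set Y :=
  [set v | Vu br delta x v /\ forall t, 0 <= t ->
     mdist (phi (- t) x) (phi (- t) v) <=
       C * expR (- (lambda * t)) * mdist x v].

(* [e] is the radius for which the local product structure is required. The
   sets [Vss] and [Vu] evaluate the bracket on pairs at distance less than
   [delta], and [delta] may have to exceed [e] since [br x y] can be further
   from [y] than [x] is. Hence the bracket is a bracket, with the same axioms,
   up to a radius [rho] that is at least [e] and [delta]; it is in particular
   a bracket on [near_pairs e]. "The unique small value" means the unique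
   value in an interval ]-tau, tau[ that does not depend on [x] and [y]. *)
Definition metric_anosov : Prop :=
  [/\ compact [set: Y], continuous_flow &
    exists (e rho : R) (br : Y -> Y -> Y) (C lambda delta : R)
           (v : Y -> Y -> R) (tau : R),
      [/\ [/\ 0 < e, 0 < C, 0 < lambda, 0 < delta & 0 < tau],
          [/\ e <= rho, delta <= rho & is_bracket rho br],
          {within near_pairs e, continuous (fun p : Y * Y => v p.1 p.2)} &
          forall x y, mdist x y < e ->
            [/\ Wuu br delta C lambda (phi (v x y) x)
                  `&` Wss br delta C lambda y = [set br x y],
                `|v x y| < tau &
                forall t, `|t| < tau ->
                  Wuu br delta C lambda (phi t x)
                    `&` Wss br delta C lambda y !=set0 ->
                  t = v x y]]].

End MetricAnosov.

Definition metric_anosov_flow (R : realType) (Y : choiceType)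
    (d : Y -> Y -> R) (phi : R -> Y -> Y) : Prop :=
  exists dP : is_distance d, @metric_anosov R (metric_space dP) phi.

(* Main.v *)
(* Curvature enters only through the hyperbolic Stewart formula: along a
   geodesic [c], the function [ch d(p, c s)] is a subsolution of [y'' = y]. It
   implies that local geodesics are geodesics, that the distance of two lines is
   convex, and that [sinh (d / 2)] is multiplied by at most [e^-t] along two
   lines whose distance tends to 0. By convexity the distance at time 0 is at
   most the integral metric, so this contraction passes to that metric.
   If [c] and [c'] are close, the segments from [c (-n)] to [c' n] stay near
   [c' 0]; their limit along an ultrafilter is the line joining the backward end
   of [c] to the forward end of [c'], which is the bracket. Two lines with the
   same ends differ by a time shift, again by convexity, so brackets are unique;
   this gives the bracket identities, and quantitatively the continuity.
   When [C / G] is compact, the displacement of nontrivial elements is bounded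
   below on [C] and closed balls of [C] are compact, so that nearby orbits of
   lines have unique nearby lifts and all of the above descends to the quotient.
   Only invariance, convexity and cocompactness of [C] matter: it is the convex
   hull of the limit set in one case, and the whole space in the other. *)

Require Import Defs.
From mathcomp Require Import all_boot all_order all_algebra.
From mathcomp Require Import all_classical all_reals all_analysis.
From mathcomp Require Import measurable_realfun ring lra.

Set Implicit Arguments.
Unset Strict Implicit.
Unset Printing Implicit Defensive.

Import Order.TTheory GRing.Theory Num.Theory.
Import numFieldNormedType.Exports.

Local Open Scope classical_set_scope.
Local Open Scope ring_scope.
Local Open Scope quotient_scope.

(* MathComp-Analysis has unrelated [shift] and [proj]. *)
Local Notation shift := Defs.shift.
Local Notation proj := Defs.proj.

(** * Comparison with the hyperbolic plane *)

(** Working with [ch] of distances turns every comparison into algebra in [ch] and [sh]: on the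
    hyperboloid a geodesic is linear in its endpoints, so Stewart's formula applied twice bounds the
    distance between points of two sides of a quadrilateral by its four corner distances. Neither
    completeness nor local compactness of the space is assumed. Both are obtained on [C] alone, from
    the cocompact action. The two kinds of local sets are not symmetric. The equation in [Vss]
    already synchronizes forward ends, whereas the one in [Vu] fixes a backward end only up to a
    time shift; it is the exponential decay required in [Wuu] that removes this shift. Three scales
    are at work: the displacement bound [i]; the radius [rho <= i / 16] of the bracket and of the
    local sets; and the radius [e <= rho] of the product structure, below which brackets stay within
    [rho / 2] of both lines. The margin 16 lets the chains of triangle inequalities between lifts
    stay below [i / 2], so that lifts cannot be confused. *)

Section HyperbolicFunctions.
Context {R : realType}.
Implicit Types x y s t L : R.

Definition ch x : R := (expR x + expR (- x)) / 2.
Definition sh x : R := (expR x - expR (- x)) / 2.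

Lemma expRxN x : expR x * expR (- x) = 1.
Proof. by rewrite -expRD subrr expR0. Qed.

Lemma ch0 : ch 0 = 1. Proof. by rewrite /ch oppr0 expR0; field. Qed.
Lemma sh0 : sh 0 = 0. Proof. by rewrite /sh oppr0 expR0; field. Qed.
Lemma chN x : ch (- x) = ch x. Proof. by rewrite /ch opprK addrC. Qed.
Lemma shN x : sh (- x) = - sh x. Proof. by rewrite /sh opprK; field. Qed.

Lemma ch_norm x : ch `|x| = ch x.
Proof. by case: (ger0P x) => // _; rewrite chN. Qed.

Lemma chD x y : ch (x + y) = ch x * ch y + sh x * sh y.
Proof. by rewrite /ch /sh opprD !expRD; field. Qed.

Lemma shD x y : sh (x + y) = sh x * ch y + ch x * sh y.
Proof. by rewrite /ch /sh opprD !expRD; field. Qed.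

Lemma chB x y : ch (x - y) = ch x * ch y - sh x * sh y.
Proof. by rewrite chD chN shN mulrN. Qed.

Lemma shB x y : sh (x - y) = sh x * ch y - ch x * sh y.
Proof. by rewrite shD chN shN mulrN. Qed.

Lemma ch_sh x : ch x ^+ 2 = 1 + sh x ^+ 2.
Proof.
have H := expRxN x; rewrite /ch /sh.
suff : ((expR x + expR (- x)) / 2) ^+ 2 - ((expR x - expR (- x)) / 2) ^+ 2 =
       expR x * expR (- x) by rewrite H; lra.
by field.
Qed.

Lemma sh_ge0 x : 0 <= x -> 0 <= sh x.
Proof.
by move=> x0; rewrite /sh divr_ge0 // subr_ge0 ler_expR; lra.
Qed.

Lemma sh_gt0 x : 0 < x -> 0 < sh x.
Proof. by move=> x0; rewrite /sh divr_gt0 // subr_gt0 ltr_expR; lra. Qed.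

Lemma ch_gt0 x : 0 < ch x.
Proof. by rewrite /ch divr_gt0 // addr_gt0 // expR_gt0. Qed.

Lemma sh_le_inv x y : sh x <= sh y -> x <= y.
Proof.
move=> H; rewrite leNgt; apply/negP => yx; move: H; rewrite leNgt => /negP; apply.
by rewrite /sh ltr_pM2r // ltrB // ltr_expR //; lra.
Qed.

(** Both factors have a visible sign when [0 <= x <= y], so monotonicity of [ch] follows without
    derivatives. *)
Lemma chB_expR x y :
  ch y - ch x = (expR y - expR x) * (1 - expR (- (x + y))) / 2.
Proof.
have H1 := expRxN x; have H2 := expRxN y.
rewrite /ch opprD expRD.
have -> : (expR y - expR x) * (1 - expR (- x) * expR (- y)) / 2 =
  (expR y - expR x - (expR y * expR (- y)) * expR (-x)
    + (expR x * expR (- x)) * expR (- y)) / 2 by field.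
by rewrite H1 H2; field.
Qed.

Lemma ler_ch x y : 0 <= x -> x <= y -> ch x <= ch y.
Proof.
move=> x0 xy; rewrite -subr_ge0 chB_expR divr_ge0 // mulr_ge0 // subr_ge0.
  by rewrite ler_expR.
by rewrite expR_le1; lra.
Qed.

Lemma ltr_ch x y : 0 <= x -> x < y -> ch x < ch y.
Proof.
move=> x0 xy; rewrite -subr_gt0 chB_expR divr_gt0 // mulr_gt0 // subr_gt0.
  by rewrite ltr_expR.
by rewrite expR_lt1; lra.
Qed.

Lemma ch_le_inv x y : 0 <= y -> ch x <= ch y -> x <= y.
Proof.
move=> y0 H; rewrite leNgt; apply/negP => yx.
by have := ltr_ch y0 yx; rewrite ltNge H.
Qed.

Lemma ch_ge1 x : 1 <= ch x.
Proof. by rewrite -ch_norm -ch0; apply: ler_ch. Qed.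

Lemma expR_le_ch x : expR x <= 2 * ch x.
Proof. by rewrite /ch mulrC divfK // lerDl expR_ge0. Qed.

Lemma ch_le_expR x : 0 <= x -> ch x <= expR x.
Proof.
move=> x0; rewrite /ch ler_pdivrMr // mulr_natr mulr2n lerD2l ler_expR; lra.
Qed.

Lemma arcosh_ch L : 0 <= L -> arcosh (ch L) = L.
Proof.
move=> L0; rewrite /arcosh ch_sh addrAC subrr add0r sqrtr_sqr.
rewrite ger0_norm ?sh_ge0 // (_ : ch L + sh L = expR L) ?expRK //.
by rewrite /ch /sh; field.
Qed.

End HyperbolicFunctions.

(** * Hyperboloid coordinates and comparison triangles *)

Section Hyperboloid.
Context {R : realType}.

(* Coordinates on the hyperboloid [A D - B^2 = 1], [D > 0]; the corresponding
   point of the half-plane is [(B / D, 1 / D)]. *)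
Record hvec := HVec { hA : R; hB : R; hD : R }.

(** Polarization of the determinant [A D - B^2] of the symmetric matrix with entries [A], [B], [D].
    On the hyperboloid it is the hyperbolic cosine of the distance. *)
Definition hform (u v : hvec) : R :=
  (hA u * hD v + hA v * hD u) / 2 - hB u * hB v.

Definition hyperboloid (u : hvec) : Prop := hform u u = 1 /\ 0 < hD u.

(** The default ordinate 1 makes [half_plane] total; it never occurs on the hyperboloid, where
    [D > 0]. *)
Lemma half_plane_pos (u : hvec) :
  0 < (hB u / hD u, if 0 < hD u then (hD u)^-1 else 1).2.
Proof. by rewrite /=; case: ifPn => // h; rewrite invr_gt0. Qed.

Definition half_plane (u : hvec) : H2 R := 
  exist (fun z : R * R => is_true (0 < z.2)) _ (half_plane_pos u).

(** The right-hand side is the argument of [arcosh] in [hdist], at the half-plane points of [u] and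
    [v]. *)
Lemma hformE (u v : hvec) : hyperboloid u -> hyperboloid v ->
  hform u v = 1 + ((hB u / hD u - hB v / hD v) ^+ 2 +
    ((hD u)^-1 - (hD v)^-1) ^+ 2) / (2 * (hD u)^-1 * (hD v)^-1).
Proof.
move=> [uu u0] [vv v0].
have un0 : hD u != 0 by rewrite gt_eqF.
have vn0 : hD v != 0 by rewrite gt_eqF.
have Eu : hA u = (1 + hB u ^+ 2) / hD u.
  by apply: (mulIf un0); rewrite divfK // -uu /hform; field.
have Ev : hA v = (1 + hB v ^+ 2) / hD v.
  by apply: (mulIf vn0); rewrite divfK // -vv /hform; field.
by rewrite /hform Eu Ev; field; exact/andP.
Qed.

Lemma hform_ge1 (u v : hvec) : hyperboloid u -> hyperboloid v -> 1 <= hform u v.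
Proof.
move=> hu hv; rewrite hformE // lerDl divr_ge0 ?addr_ge0 ?sqr_ge0 //.
by case: hu hv => _ u0 [_ v0]; rewrite !mulr_ge0 // invr_ge0 ltW.
Qed.

Lemma hdist_half_plane (u v : hvec) : hyperboloid u -> hyperboloid v ->
  hdist (half_plane u) (half_plane v) = arcosh (hform u v).
Proof.
move=> hu hv; rewrite hformE //; case: hu hv => _ u0 [_ v0].
by rewrite /hdist /= u0 v0.
Qed.

(** Hyperbolic counterpart of spherical linear interpolation: the unit-speed geodesic from [u] to
    [v] when [hform u v = ch L]. Its linearity in [u] and [v] is what makes Stewart's formula an
    equality in the plane. *)
Definition hseg (L : R) (u v : hvec) (s : R) : hvec :=
  let a := sh (L - s) / sh L in let b := sh s / sh L in
  HVec (a * hA u + b * hA v) (a * hB u + b * hB v) (a * hD u + b * hD v).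

Lemma hform_hsegr L u v w s :
  hform w (hseg L u v s) =
  sh (L - s) / sh L * hform w u + sh s / sh L * hform w v.
Proof.
by rewrite /hform /=; move: (sh (L - s) / _) (sh s / _) => x y; field.
Qed.

Lemma hformC u v : hform u v = hform v u.
Proof. by rewrite /hform; field. Qed.

Lemma hform_hseg L u v s t : 0 < L -> hform u u = 1 -> hform v v = 1 ->
  hform u v = ch L -> hform (hseg L u v s) (hseg L u v t) = ch (s - t).
Proof.
move=> L0 uu vv uv.
rewrite hform_hsegr [hform _ u]hformC [hform _ v]hformC !hform_hsegr.
rewrite [hform v u]hformC uu vv uv !shB chB.
have := sh_gt0 L0; have := ch_sh L.
move: (ch L) (sh L) (sh s) (ch s) (sh t) (ch t) => c S a b x y cS S0.
have E : S != 0 by rewrite gt_eqF.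
have -> : (S * y - c * x) / S * ((S * b - c * a) / S * 1 + a / S * c) +
          x / S * ((S * b - c * a) / S * c + a / S * 1) =
          b * y - a * x * ((c ^+ 2 - 1) / S ^+ 2) by field.
rewrite cS (_ : 1 + S ^+ 2 - 1 = S ^+ 2); last by ring.
by rewrite divff ?sqrf_eq0 // mulr1.
Qed.

Lemma hseg_hyperboloid L u v s : 0 <= s <= L -> 0 < L ->
  hyperboloid u -> hyperboloid v -> hform u v = ch L ->
  hyperboloid (hseg L u v s).
Proof.
move=> /andP[s0 sL] L0 [uu u0] [vv v0] uv; split.
  by rewrite hform_hseg // subrr ch0.
rewrite /=; move: s0; rewrite le_eqVlt => /predU1P[<-|s0].
  by rewrite sh0 subr0 mul0r mul0r addr0 mulr_gt0 // divr_gt0 // sh_gt0.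
rewrite ltr_wpDl //.
  by rewrite mulr_ge0 ?(ltW u0) // divr_ge0 ?sh_ge0 // ?subr_ge0 // ltW.
by rewrite mulr_gt0 // divr_gt0 // sh_gt0.
Qed.

Lemma geodesic_hseg L u v : 0 < L ->
  hyperboloid u -> hyperboloid v -> hform u v = ch L ->
  geodesic_segment (@hdist R) (half_plane u) (half_plane v)
    (fun s => half_plane (hseg L u v s)).
Proof.
move=> L0 hu hv uv.
have sL0 : sh L != 0 by rewrite gt_eqF // sh_gt0.
have E : hdist (half_plane u) (half_plane v) = L.
  by rewrite hdist_half_plane // uv arcosh_ch // ltW.
split.
- congr half_plane; case: u {hu uv E} => a b d; rewrite /hseg /= subr0 sh0.
  by congr HVec; field.
- rewrite E; congr half_plane; case: v {hv uv E} => a b d.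
  by rewrite /hseg /= subrr sh0; congr HVec; field.
- move=> s t; rewrite E => sL tL.
  rewrite hdist_half_plane; [|exact: hseg_hyperboloid..].
  case: hu hv => uu _ [vv _].
  by rewrite hform_hseg // -ch_norm arcosh_ch.
Qed.

(** The difference of the two sides is the Gram determinant of three hyperboloid vectors. It factors
    as [(ch (a + b) - ch L) (ch L - ch (a - b))], and the triangle inequalities make both factors
    nonnegative. *)
Lemma ch_triangle (a b L : R) : 0 <= a -> 0 <= b -> 0 <= L ->
  a <= b + L -> b <= a + L -> L <= a + b ->
  ch a ^+ 2 + ch b ^+ 2 + ch L ^+ 2 <= 1 + 2 * ch a * ch b * ch L.
Proof.
move=> a0 b0 L0 h1 h2 h3.
have : 0 <= (ch (a + b) - ch L) * (ch L - ch (a - b)).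
  apply: mulr_ge0; rewrite subr_ge0; first exact: ler_ch.
  by rewrite -ch_norm ler_ch // ler_norml; apply/andP; split; lra.
rewrite chD chB; have := ch_sh a; have := ch_sh b.
move: (ch a) (ch b) (ch L) (sh a) (sh b) => x y z s t E1 E2.
have -> : (x * y + s * t - z) * (z - (x * y - s * t)) =
  s ^+ 2 * t ^+ 2 - (z - x * y) ^+ 2 by ring.
have -> : s ^+ 2 = x ^+ 2 - 1 by rewrite E2; ring.
have -> : t ^+ 2 = y ^+ 2 - 1 by rewrite E1; ring.
by move=> H; rewrite -subr_ge0; move: H; congr (0 <= _); ring.
Qed.

(** The side of length [L] is put on the vertical axis, between [(1, 0, 1)] and [(E, 0, E')]. The
    two remaining distances are then linear equations for the coordinates [A] and [D] of the third
    vertex, and [B] is a square root of [A D - 1], nonnegative by [ch_triangle]. *)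
Lemma comparison_vectors (a b L : R) : 0 < a -> 0 < b -> 0 < L ->
  a <= b + L -> b <= a + L -> L <= a + b ->
  exists u v w, [/\ hyperboloid u, hyperboloid v & hyperboloid w] /\
    [/\ hform u v = ch L, hform v w = ch b & hform w u = ch a].
Proof.
move=> a0 b0 L0 h1 h2 h3.
pose E := expR L; pose E' := expR (- L).
have EE : E * E' = 1 by rewrite expRxN.
have E'0 : E' != 0 by rewrite gt_eqF // expR_gt0.
have EE'0 : 0 < E - E' by rewrite subr_gt0 ltr_expR; lra.
have EE'n : E - E' != 0 by rewrite gt_eqF.
have chL : ch L = (E + E') / 2 by [].
pose A := 2 * (ch a * E - ch b) / (E - E').
pose D := 2 * (ch b - ch a * E') / (E - E').
have AD : 1 <= A * D.
  rewrite /A /D -[leLHS]mulr1.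
  have -> : 2 * (ch a * E - ch b) / (E - E') * (2 * (ch b - ch a * E') / (E - E'))
   = 4 * (ch a * ch b * (E + E') - ch a ^+ 2 * (E * E') - ch b ^+ 2)
     / (E - E') ^+ 2 by field.
  rewrite mul1r ler_pdivlMr ?exprn_gt0 // EE.
  have := ch_triangle (ltW a0) (ltW b0) (ltW L0) h1 h2 h3; rewrite chL.
  have -> : (E - E') ^+ 2 = (E + E') ^+ 2 - 4 * (E * E') by ring.
  rewrite EE; move: (E + E') => z.
  by move=> H; move: H; nra.
have D0 : 0 < D.
  rewrite /D divr_gt0 // mulr_gt0 // subr_gt0.
  rewrite -(ltr_pM2r (expR_gt0 L)) -mulrA [expR (- L) * _]mulrC expRxN mulr1.
  apply: le_lt_trans (_ : ch (b + L) < _).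
    by apply: ler_ch => //; exact: ltW.
  rewrite /ch opprD !expRD mulrAC ltr_pM2r // mulrDl ltrD2l.
  by rewrite ltr_pM2l ?expR_gt0 // ltr_expR; lra.
exists (HVec 1 0 1), (HVec E 0 E'), (HVec A (Num.sqrt (A * D - 1)) D).
rewrite /hyperboloid /hform /=; split; [split|split].
- by split; [field|].
- split; last exact: expR_gt0.
  by rewrite EE; field.
- split => //; rewrite -expr2 sqr_sqrtr; last by lra.
  by field.
- by rewrite chL; field.
- have -> : (E * D + A * E') / 2 - 0 * Num.sqrt (A * D - 1) =
     (E * D + A * E') / 2 by ring.
  have -> : (E * D + A * E') / 2 =
    (ch b * (E - E') + ch a * (E * E' - E * E')) / (E - E').
    by rewrite /A /D; field.
  by field.
- by rewrite /A /D; field.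
Qed.

End Hyperboloid.

(** * Stewart's inequality from triangle comparison *)

Section Stewart.
Context (R : realType) (X : metricType R).
Hypothesis catX : CAT_m1 X.
Implicit Types p q r : X.

(* Comparison with the hyperbolic plane in the form of Stewart's formula: with
   respect to [s], the function [ch (mdist p (c s))] is a subsolution of
   [y'' = y]. *)
Lemma stewart p q r (c : R -> X) s : geodesic_segment mdist q r c ->
  0 <= s <= mdist q r ->
  ch (mdist p (c s)) * sh (mdist q r) <=
  ch (mdist p q) * sh (mdist q r - s) + ch (mdist p r) * sh s.
Proof.
move=> cP sL; have [c0 cL cs] := cP; set L := mdist q r in sL cP cL cs *.
have L_ge0 : 0 <= L by exact: mdist_ge0.
(* [comparison_vectors] needs three positive side lengths; in each degenerate case the two sides are
   equal. *)
have [L0|Ln0] := eqVneq L 0.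
  have -> : s = 0 by apply/eqP; rewrite eq_le; move: sL; rewrite L0 andbC.
  by rewrite L0 subr0 sh0 !mulr0 addr0.
have [pq|pq] := eqVneq p q.
  have -> : mdist p (c s) = s.
    rewrite pq -c0 cs // ?lexx //=.
    by rewrite sub0r normrN ger0_norm //; case/andP: sL.
  rewrite pq mdistxx ch0 mul1r shB -/L; move: (ch s) (sh s) (ch L) (sh L) => *.
  by rewrite le_eqVlt; apply/orP; left; apply/eqP; ring.
have [pr|pr] := eqVneq p r.
  have -> : mdist p (c s) = L - s.
    rewrite pr -cL cs // ?lexx ?andbT //.
    by rewrite ger0_norm // subr_ge0; case/andP: sL.
  rewrite pr mdistxx ch0 mul1r [mdist r q]metric_sym -/L shB chB.
  have := ch_sh L; have := ch_sh s.
  move: (ch s) (sh s) (ch L) (sh L) => x y z w E1 E2.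
  have -> : (z * x - w * y) * w = z * (w * x - z * y) + (z ^+ 2 - w ^+ 2) * y.
    by ring.
  by rewrite E2 le_eqVlt; apply/orP; left; apply/eqP; ring.
have L_gt0 : 0 < L by rewrite lt_neqAle eq_sym Ln0.
have a0 : 0 < mdist p q by rewrite mdist_gt0.
have b0 : 0 < mdist p r by rewrite mdist_gt0.
have h1 : mdist p q <= mdist p r + L.
  by rewrite [L]metric_sym; exact: metric_triangle.
have h2 : mdist p r <= mdist p q + L by exact: metric_triangle.
have h3 : L <= mdist p q + mdist p r.
  by rewrite [mdist p q]metric_sym; exact: metric_triangle.
have [u [v [w [[hu hv hw] [uv vw wu]]]]] := comparison_vectors a0 b0 L_gt0 h1 h2 h3.
have [geo cmp] := catX.
have [c1 c1P] := geo r p; have [c2 c2P] := geo p q.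
pose P (i : 'I_3) := nth q [:: q; r; p] i.
pose cc (i : 'I_3) := nth c [:: c; c1; c2] i.
pose P' (i : 'I_3) := nth (half_plane u) [:: half_plane u; half_plane v; half_plane w] i.
pose cc' (i : 'I_3) := nth (fun s => half_plane (hseg L u v s)) [::
   (fun s => half_plane (hseg L u v s));
   (fun s => half_plane (hseg (mdist p r) v w s));
   (fun s => half_plane (hseg (mdist p q) w u s))] i.
have T : geodesic_triangle mdist P cc by case; case=> [|[|[|//]]].
have T' : geodesic_triangle (@hdist R) P' cc'.
  by case; case=> [|[|[|//]]] ? /=; exact: geodesic_hseg.
have D i : hdist (P' i) (P' (ordS i)) = mdist (P i) (P (ordS i)).
  case: i; case=> [|[|[|//]]] ? /=; rewrite /P' /P /= hdist_half_plane // ?uv ?vw ?wu.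
  - by rewrite arcosh_ch.
  - by rewrite arcosh_ch ?(ltW b0) // metric_sym.
  - by rewrite arcosh_ch // ltW.
(* The side of index 2 at time 0 is the vertex [p]. *)
have := cmp P cc P' cc' T T' D ord_max ord0 0 s _ sL.
rewrite mdist_ge0 lexx => /(_ isT); rewrite /cc /cc' /=.
have [-> _ _] := c2P.
have [-> _ _] := geodesic_hseg a0 hw hu wu.
have hs := hseg_hyperboloid sL L_gt0 hu hv uv.
rewrite hdist_half_plane // hform_hsegr wu hformC vw => H.
have sL0 := sh_gt0 L_gt0.
have F0 : 1 <= sh (L - s) / sh L * ch (mdist p q) + sh s / sh L * ch (mdist p r).
  by rewrite -wu -vw [hform v w]hformC -hform_hsegr; exact: hform_ge1.
set F := _ + _ in H F0.
have FE : F * sh L = ch (mdist p q) * sh (L - s) + ch (mdist p r) * sh s.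
  by rewrite /F; field; rewrite gt_eqF.
rewrite -FE ler_pM2r //.
have chF : ch (arcosh F) = F.
  clear -F0.
  rewrite /arcosh; set S := Num.sqrt _.
  have SE : S ^+ 2 = F ^+ 2 - 1 by rewrite sqr_sqrtr // subr_ge0 exprn_ege1.
  have S0 : 0 <= S by exact: sqrtr_ge0.
  have FS : 0 < F + S by rewrite ltr_pwDl //; apply: lt_le_trans F0.
  rewrite /ch expRN lnK //.
  suff -> : (F + S)^-1 = F - S by field.
  apply: (mulfI (lt0r_neq0 FS)); rewrite divff ?gt_eqF //.
  have -> : (F + S) * (F - S) = F ^+ 2 - S ^+ 2 by ring.
  by rewrite SE; ring.
by rewrite -chF ler_ch // mdist_ge0.
Qed.

End Stewart.
(** * Lines in a CAT(-1) space *)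

Section RealLemmas.
Context {R : realType}.
Implicit Types x y s t e : R.

(** Connectedness of a half-line, through the supremum of the times up to which [S] holds. It passes
    from local to global statements, for geodesics as well as for lifts that stay close. *)
Lemma real_induction (S : R -> Prop) (a : R) : S a ->
  (forall t, a <= t -> S t -> exists2 e, 0 < e & forall s, t <= s < t + e -> S s) ->
  (forall t, a < t -> (forall s, a <= s < t -> S s) -> S t) ->
  forall t, a <= t -> S t.
Proof.
move=> Sa So Sc t at_.
pose P := [set u | a <= u <= t /\ forall s, a <= s <= u -> S s].
have Pa : P a.
  split; first by rewrite lexx.
  by move=> s /andP[as_ sa]; rewrite (le_anti (introT andP (conj sa as_))).
have supP : has_sup P by split; [exists a | exists t => u [/andP[]]].
have Pu : ubound P (sup P) by exact: sup_upper_bound.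
have ap : a <= sup P by exact: Pu.
have pt : sup P <= t by apply: sup_le_ub; [exists a|move=> u [/andP[]]].
have Sl s : a <= s < sup P -> S s.
  move=> /andP[as_ sp].
  have ps : 0 < sup P - s by rewrite subr_gt0.
  have [u [uP uS] su] := sup_adherent ps supP.
  by apply: uS; rewrite as_ /= ltW //; move: su; rewrite subKr.
have Sp : S (sup P).
  move: ap; rewrite le_eqVlt => /predU1P[<- //|ap]; exact: Sc.
have [e e0 Se] := So _ ap Sp.
have Sle s : a <= s < sup P + e -> S s.
  move=> /andP[as_ sp]; case: (ltP s (sup P)) => h; first by apply: Sl; rewrite as_.
  by apply: Se; rewrite h.
case: (ltP t (sup P + e)) => h; first by apply: Sle; rewrite at_.
have : P (sup P + e / 2).
  split; first by apply/andP; split; lra.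
  by move=> s /andP[as_ sp]; apply: Sle; rewrite as_ /=; lra.
by move/Pu; lra.
Qed.

(** The restriction [e <= 1] lets quadratic errors in [e] be absorbed into [K]. *)
Lemma le_eps_mul (K x y : R) :
  (forall e, 0 < e -> e <= 1 -> x <= y + e * K) -> x <= y.
Proof.
move=> H; apply/ler_addgt0Pl => e e0.
pose M := `|K| + 1.
have M0 : 0 < M by rewrite ltr_wpDl.
have KM : K <= M by rewrite (le_trans (ler_norm _)) // lerDl.
have [h|h] := leP (e / M) 1.
  apply: le_trans (H _ _ h) _; first exact: divr_gt0.
  rewrite addrC lerD2r (le_trans (ler_wpM2l _ KM)) ?divr_ge0 ?(ltW e0) ?(ltW M0) //.
  by rewrite divfK // gt_eqF.
apply: le_trans (H 1 ltr01 (lexx _)) _.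
rewrite addrC lerD2r mul1r (le_trans KM) // ltW //.
by rewrite -(mul1r M) -ltr_pdivlMr.
Qed.

Lemma expRN_small e : 0 < e -> exists2 T, 0 <= T & forall t, T <= t -> expR (- t) <= e.
Proof.
move=> e0; exists e^-1; first by rewrite invr_ge0 ltW.
move=> t et; rewrite expRN -[e]invrK lef_pV2 ?posrE ?expR_gt0 ?invr_gt0 //.
by apply: le_trans et _; apply: le_trans (expR_ge1Dx t); rewrite lerDr.
Qed.

Lemma sh_ge_expRN x : x * expR (- x) <= sh x.
Proof.
have := expR_ge1Dx (x + x); rewrite expRD => H.
have := ler_wpM2l (expR_ge0 (- x)) H; rewrite mulrCA.
by rewrite [expR (- x) * expR x]mulrC expRxN mulr1 /sh; lra.
Qed.

Lemma sh_le_mulexpR x : sh x <= x * expR x.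
Proof.
rewrite /sh ler_pdivrMr //.
have := expR_ge1Dx (- (x + x)); rewrite opprD expRD => H.
have : expR x * (1 - expR (- x) * expR (- x)) <= expR x * (2 * x).
  by rewrite ler_pM2l ?expR_gt0 //; lra.
have -> : expR x * (1 - expR (- x) * expR (- x)) =
  expR x - expR x * expR (- x) * expR (- x) by ring.
by rewrite expRxN mul1r; lra.
Qed.

Lemma ch_half x : ch x - 1 = 2 * sh (x / 2) ^+ 2.
Proof.
have -> : ch x = ch (x / 2 + x / 2) by congr ch; field.
by rewrite chD -!expr2 ch_sh; ring.
Qed.

(** By [ch_half] the hypothesis reads [sh (x / 2) <= k sh (y / 2)]. Replacing each [sh] by its
    argument costs the factors [expR (x / 2)] and [expR (y / 2)], whose product is at most [expR y]
    because [x <= y]. *)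
Lemma ch_decay (k x y : R) : 0 <= k <= 1 -> 0 <= x -> 0 <= y ->
  ch x - 1 <= k ^+ 2 * (ch y - 1) -> x <= k * y * expR y.
Proof.
move=> /andP[k0 k1] x0 y0; rewrite !ch_half.
have -> : k ^+ 2 * (2 * sh (y / 2) ^+ 2) = 2 * (k * sh (y / 2)) ^+ 2 by ring.
rewrite ler_pM2l //.
have sx : 0 <= sh (x / 2) by rewrite sh_ge0 // divr_ge0.
have sy : 0 <= sh (y / 2) by rewrite sh_ge0 // divr_ge0.
have ksy : 0 <= k * sh (y / 2) by exact: mulr_ge0.
rewrite ler_sqr // => h.
have xy : x <= y.
  rewrite -(@ler_pM2r _ 2^-1) // ; apply: sh_le_inv; apply: le_trans h _.
  exact: ler_piMl.
have := sh_ge_expRN (x / 2); have := sh_le_mulexpR (y / 2) => h1 h2.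
have h3 : x / 2 * expR (- (x / 2)) <= k * (y / 2 * expR (y / 2)).
  by apply: le_trans h2 _; apply: le_trans h _; exact: ler_wpM2l.
have h4 : x / 2 <= k * (y / 2 * expR (y / 2)) * expR (x / 2).
  apply: le_trans (ler_wpM2r (expR_ge0 (x / 2)) h3).
  have -> : x / 2 * expR (- (x / 2)) * expR (x / 2) =
    x / 2 * (expR (x / 2) * expR (- (x / 2))) by ring.
  by rewrite expRxN mulr1.
have h5 : expR (y / 2) * expR (x / 2) <= expR y by rewrite -expRD ler_expR; lra.
rewrite -(@ler_pM2r _ 2^-1) //; apply: le_trans h4 _.
rewrite (_ : _ * _ * expR (x / 2) = k * (y / 2) * (expR (y / 2) * expR (x / 2))); last by ring.
rewrite (_ : k * y * expR y / 2 = k * (y / 2) * expR y); last by ring.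
by apply: ler_wpM2l => //; rewrite mulr_ge0 // divr_ge0.
Qed.

End RealLemmas.

(** * Convexity, local-to-global principle and asymptotic lines *)

Section Lines.
Context (R : realType) (X : metricType R).
Hypothesis catX : CAT_m1 X.
Implicit Types (p q : X) (c l w : R -> X) (a b s t T : R).

Definition iso_on a b c :=
  forall s t, a <= s <= b -> a <= t <= b -> mdist (c s) (c t) = `|s - t|.

Definition line c := forall s t, mdist (c s) (c t) = `|s - t|.

Lemma line_iso_on a b c : line c -> iso_on a b c.
Proof. by move=> cl s t _ _. Qed.

Lemma iso_on_sub a b a' b' c : a <= a' -> b' <= b -> iso_on a b c -> iso_on a' b' c.
Proof.
move=> aa bb H s t /andP[s0 s1] /andP[t0 t1]; apply: H; apply/andP; split; lra.
Qed.

Lemma iso_on_rev a b c : iso_on a b c -> iso_on (- b) (- a) (fun s => c (- s)).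
Proof.
move=> H s t /andP[s0 s1] /andP[t0 t1]; rewrite H; last by apply/andP; split; lra.
  by rewrite -normrN; congr (`|_|); ring.
by apply/andP; split; lra.
Qed.

Lemma iso_on_shift u a b c : iso_on (a + u) (b + u) c -> iso_on a b (shift u c).
Proof.
move=> H s t /andP[s0 s1] /andP[t0 t1]; rewrite /shift H ?lerD2r ?s0 ?t0 //.
by congr (`|_|); ring.
Qed.

Lemma line_rev c : line c -> line (fun s => c (- s)).
Proof. by move=> H s t; rewrite H -normrN; congr (`|_|); ring. Qed.

Lemma line_shift u c : line c -> line (shift u c).
Proof. by move=> H s t; rewrite /shift H; congr (`|_|); ring. Qed.

Lemma stewart_on p a b s c : iso_on a b c -> a <= s <= b ->
  ch (mdist p (c s)) * sh (b - a) <=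
  ch (mdist p (c a)) * sh (b - s) + ch (mdist p (c b)) * sh (s - a).
Proof.
move=> ci /andP[as_ sb]; have ab := le_trans as_ sb.
have E : mdist (c a) (c b) = b - a.
  by rewrite ci ?lexx ?ab // distrC ger0_norm // subr_ge0.
have g : geodesic_segment mdist (c a) (c b) (fun u => c (a + u)).
  split; [by rewrite addr0|by rewrite E subrKC|].
  rewrite E => u v /andP[u0 u1] /andP[v0 v1].
  by rewrite ci; [congr (`|_|); ring|apply/andP; split; lra..].
have := @stewart _ _ catX p _ _ _ (s - a) g; rewrite E subrKC.
rewrite (_ : b - a - (s - a) = b - s); last by ring.
by apply; apply/andP; split; lra.
Qed.

(** Stewart's formula along [c'] seen from [c s], and then along [c] seen from each end of [c']. *)
Lemma bistewart a b a' b' s t c c' : iso_on a b c -> iso_on a' b' c' ->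
  a <= s <= b -> a' <= t <= b' ->
  ch (mdist (c s) (c' t)) * (sh (b - a) * sh (b' - a')) <=
  ch (mdist (c a) (c' a')) * (sh (b - s) * sh (b' - t)) +
  ch (mdist (c a) (c' b')) * (sh (b - s) * sh (t - a')) +
  ch (mdist (c b) (c' a')) * (sh (s - a) * sh (b' - t)) +
  ch (mdist (c b) (c' b')) * (sh (s - a) * sh (t - a')).
Proof.
move=> ci ci' sab tab; have [/andP[as_ sb] /andP[at_ tb]] := (sab, tab).
have H1 := stewart_on (c s) ci' tab.
have H2 := stewart_on (c' a') ci sab; have H3 := stewart_on (c' b') ci sab.
rewrite ![mdist (c' _) _]metric_sym in H2 H3.
have p1 : 0 <= sh (b - a) by rewrite sh_ge0 //; lra.
have p2 : 0 <= sh (b' - t) by rewrite sh_ge0 //; lra.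
have p3 : 0 <= sh (t - a') by rewrite sh_ge0 //; lra.
have := ler_wpM2l p1 H1; have := ler_wpM2r p2 H2; have := ler_wpM2r p3 H3.
rewrite !mulrDl !mulrDr; lra.
Qed.

Lemma sh_sqrD s t : sh (s + t) ^+ 2 =
  sh s ^+ 2 + 2 * ch (s + t) * (sh s * sh t) + sh t ^+ 2.
Proof.
rewrite shD chD; have := ch_sh s; have := ch_sh t.
move: (ch s) (sh s) (ch t) (sh t) => x y z w E1 E2.
have -> : (y * z + x * w) ^+ 2 = y ^+ 2 * z ^+ 2 + x ^+ 2 * w ^+ 2 + 2 * x * y * z * w.
  by ring.
by rewrite E1 E2; ring.
Qed.

(** In [bistewart] both cross distances are [T], and [sh_sqrD] cancels the mixed terms. What remains
    is the factor [(sh (T - t) / sh T)^2], at most [expR (- t) ^+ 2]. *)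
Lemma isosceles T t c c' : iso_on 0 T c -> iso_on 0 T c' -> c T = c' T ->
  0 < T -> 0 <= t <= T ->
  ch (mdist (c t) (c' t)) - 1 <= expR (- t) ^+ 2 * (ch (mdist (c 0) (c' 0)) - 1).
Proof.
move=> ci ci' E T0 tT; have [/andP[t0 tT'] Tge] := (tT, ltW T0).
have := bistewart ci ci' tT tT.
have e1 : mdist (c 0) (c' T) = T.
  by rewrite -E ci ?lexx ?Tge // sub0r normrN ger0_norm.
have e2 : mdist (c T) (c' 0) = T.
  by rewrite E ci' ?lexx ?Tge // subr0 ger0_norm.
rewrite e1 e2 E mdistxx ch0 !subr0 => H.
have := sh_sqrD (T - t) t; rewrite subrK => HT.
have H' : (ch (mdist (c t) (c' t)) - 1) * sh T ^+ 2 <=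
  (ch (mdist (c 0) (c' 0)) - 1) * sh (T - t) ^+ 2.
  by rewrite mulrBl {2}HT; move: H; rewrite -!expr2; lra.
have S0 : 0 < sh T ^+ 2 by rewrite exprn_gt0 // sh_gt0.
rewrite -(ler_pM2r S0); apply: le_trans H' _.
rewrite mulrAC mulrC ler_wpM2r ?subr_ge0 ?ch_ge1 // -exprMn ler_sqr ?nnegrE.
- rewrite /sh mulrA ler_pM2r // mulrBr -!expRD [- t + T]addrC lerD2l lerN2 ler_expR; lra.
- by rewrite sh_ge0 // subr_ge0.
- by rewrite mulr_ge0 ?expR_ge0 // sh_ge0.
Qed.

(** With [D] the distance of the midpoints and [2 C] the opposite side, [bistewart] gives [4 ch a ch
    b ch D <= 1 + ch (2 a) + ch (2 b) + ch (2 C)]. The right-hand side is at most [4 ch a ch b ch C]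
    by [ch_triangle] for [a], [b], [C]. *)
Lemma midpoint_triangle a b c c' : 0 <= a -> 0 <= b ->
  iso_on 0 (a + a) c -> iso_on 0 (b + b) c' -> c 0 = c' 0 ->
  mdist (c a) (c' b) <= mdist (c (a + a)) (c' (b + b)) / 2.
Proof.
move=> a0 b0 ci ci' E.
have ia u : 0 <= u <= a + a -> mdist (c' 0) (c u) = u.
  move=> h; rewrite -E ci //; first by rewrite sub0r normrN ger0_norm //; case/andP: h.
  by rewrite lexx addr_ge0.
have ib u : 0 <= u <= b + b -> mdist (c 0) (c' u) = u.
  move=> h; rewrite E ci' //; first by rewrite sub0r normrN ger0_norm //; case/andP: h.
  by rewrite lexx addr_ge0.
have [az|an] := eqVneq a 0.
  by rewrite az addr0 !ib ?lexx ?addr_ge0 //; first lra; apply/andP; split; lra.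
have [bz|bn] := eqVneq b 0.
  rewrite bz addr0 ![mdist _ (c' 0)]metric_sym !ia ?lexx ?addr_ge0 //; first lra.
  by apply/andP; split; lra.
have a1 : 0 < a by rewrite lt_neqAle eq_sym an.
have b1 : 0 < b by rewrite lt_neqAle eq_sym bn.
have [C C0 CE] : exists2 C, 0 <= C & mdist (c (a + a)) (c' (b + b)) = C + C.
  by exists (mdist (c (a + a)) (c' (b + b)) / 2); [rewrite divr_ge0 ?mdist_ge0|exact: splitr].
have -> : mdist (c (a + a)) (c' (b + b)) / 2 = C by rewrite CE; field.
have ha : 0 <= a <= a + a by apply/andP; split; lra.
have hb : 0 <= b <= b + b by apply/andP; split; lra.
have := bistewart ci ci' ha hb.
have e1 : mdist (c 0) (c' (b + b)) = b + b by rewrite ib // lexx addr_ge0.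
have e2 : mdist (c (a + a)) (c' 0) = a + a.
  by rewrite metric_sym ia // lexx addr_ge0.
have e3 : mdist (c 0) (c' 0) = 0 by rewrite E mdistxx.
rewrite e1 e2 e3 ch0 CE !subr0 !addrK.
rewrite !shD.
have -> : (sh a * ch a + ch a * sh a) * (sh b * ch b + ch b * sh b) =
  4 * ch a * ch b * (sh a * sh b) by ring.
have sab : 0 < sh a * sh b by rewrite mulr_gt0 // sh_gt0.
rewrite mulrA -!mulrDl ler_pM2r // => H.
have T1 := metric_triangle (c (a + a)) (c' (b + b)) (c' 0).
have T2 := metric_triangle (c 0) (c (a + a)) (c' (b + b)).
have T3 := metric_triangle (c (a + a)) (c 0) (c' (b + b)).
have e4 : mdist (c' (b + b)) (c' 0) = b + b by rewrite -E metric_sym.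
have e5 : mdist (c 0) (c (a + a)) = a + a by rewrite E metric_sym.
have e6 : mdist (c (a + a)) (c 0) = a + a by rewrite metric_sym.
rewrite e2 CE e4 in T1; rewrite e1 CE e5 in T2; rewrite e1 CE e6 in T3.
have := @ch_triangle _ a b C a0 b0 C0.
have -> : a <= b + C by lra.
have -> : b <= a + C by lra.
have -> : C <= a + b by lra.
move=> /(_ isT isT isT) K.
apply: ch_le_inv => //.
move: H; rewrite !chD -!expr2.
have := ch_sh a; have := ch_sh b; have := ch_sh C.
have := ch_gt0 a; have := ch_gt0 b.
move: (ch (mdist _ _)) (ch a) (ch b) (ch C) (sh a) (sh b) (sh C) K => D x y z u v w K.
move=> y0 x0 E1 E2 E3 H.
have xy : 0 < 4 * x * y by rewrite !mulr_gt0.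
rewrite -(ler_pM2r xy); nra.
Qed.

(** The diagonal from [c (- s)] to [c' s] cuts the quadrilateral into two triangles. Going through
    its midpoint, each triangle contributes half of one end distance. *)
Lemma dist_convex_iso s c c' : 0 <= s -> iso_on (- s) s c -> iso_on (- s) s c' ->
  mdist (c 0) (c' 0) <= (mdist (c s) (c' s) + mdist (c (- s)) (c' (- s))) / 2.
Proof.
move=> s0 ci ci'; have [geo _] := catX.
have [e] := geo (c (- s)) (c' s).
set L := mdist (c (- s)) (c' s) => -[e0 eL ei]; rewrite -/L in eL ei.
have L0 : 0 <= L by exact: mdist_ge0.
have eis : iso_on 0 (L / 2 + L / 2) e by rewrite -splitr => u v; exact: ei.
have H1 : mdist (c 0) (e (L / 2)) <= mdist (c s) (c' s) / 2.
  have := @midpoint_triangle s (L / 2) (fun u => c (u - s)) e s0.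
  rewrite subrr addrK sub0r e0 -splitr eL; apply=> //; first by rewrite divr_ge0.
  by apply: iso_on_shift; rewrite add0r addrK.
have H2 : mdist (e (L / 2)) (c' 0) <= mdist (c (- s)) (c' (- s)) / 2.
  have := @midpoint_triangle (L / 2) s (fun u => e (L - u)) (fun u => c' (s - u)).
  rewrite subrr !subr0 eL -splitr subrr e0 opprD addrA subrr sub0r.
  have -> : L - L / 2 = L / 2 by field.
  apply=> //; first by rewrite divr_ge0.
    move=> u v /andP[u0 u1] /andP[v0 v1]; rewrite ei; last by apply/andP; split; lra.
      by rewrite -normrN; congr (`|_|); ring.
    by apply/andP; split; lra.
  move=> u v /andP[u0 u1] /andP[v0 v1]; rewrite ci'; last by apply/andP; split; lra.
    by rewrite -normrN; congr (`|_|); ring.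
  by apply/andP; split; lra.
by have := metric_triangle (c 0) (e (L / 2)) (c' 0); lra.
Qed.

Lemma dist_convex s t c c' : line c -> line c' ->
  mdist (c t) (c' t) <= (mdist (c (t + s)) (c' (t + s)) + mdist (c (t - s)) (c' (t - s))) / 2.
Proof.
move=> cl cl'; wlog s0 : s / 0 <= s => [H|].
  have [h|h] := leP 0 s; first exact: H.
  by have := H (- s); rewrite opprK addrC oppr_ge0; apply; exact: ltW.
have := @dist_convex_iso s (shift t c) (shift t c') s0.
rewrite /shift add0r [s + t]addrC [- s + t]addrC; apply.
  by apply: line_iso_on; exact: line_shift.
by apply: line_iso_on; exact: line_shift.
Qed.

(** Stewart's formula on [[b - s, b + s]], seen from [c a], bounds [ch] of the distance from below
    by [2 ch s ch (b - a) - ch (b - a - s)], which is [ch (b - a + s)]. *)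
Lemma geodesic_extend a b s c : a < b -> 0 < s < b - a -> iso_on a b c ->
  iso_on (b - s) (b + s) c -> mdist (c a) (c (b + s)) = b + s - a.
Proof.
move=> ab /andP[s0 sb] ci cj.
have aa : a <= a <= b by rewrite lexx ltW.
have d1 : mdist (c a) (c (b - s)) = b - s - a.
  rewrite ci //; last by apply/andP; split; lra.
  by rewrite distrC ger0_norm //; lra.
have d2 : mdist (c a) (c b) = b - a.
  rewrite ci //; last by apply/andP; split; lra.
  by rewrite distrC ger0_norm //; lra.
have d3 : mdist (c b) (c (b + s)) = s.
  rewrite cj; [|apply/andP; split; lra..].
  by rewrite distrC addrAC subrr add0r ger0_norm // ltW.
apply/eqP; rewrite eq_le; apply/andP; split.
  have := metric_triangle (c a) (c b) (c (b + s)); rewrite d2 d3; lra.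
apply: ch_le_inv; first exact: mdist_ge0.
have := @stewart_on (c a) (b - s) (b + s) b c cj.
rewrite d1 d2 [b + s - b]addrAC subrr add0r subKr.
have -> : b + s - (b - s) = s + s by ring.
have -> : b - s <= b <= b + s by apply/andP; split; lra.
move=> /(_ isT); rewrite shD.
have ss0 := sh_gt0 s0.
have -> : sh s * ch s + ch s * sh s = 2 * ch s * sh s by ring.
rewrite mulrA -mulrDl ler_pM2r //.
have -> : b - s - a = b - a - s by ring.
have -> : b + s - a = b - a + s by ring.
by move: (b - a) (mdist _ _) => u d; rewrite chB chD; lra.
Qed.

Lemma geodesic_line c : geodesic mdist c -> line c.
Proof.
move=> cg.
suff H a t : a <= t -> iso_on a t c.
  move=> s t; have [st|st] := leP s t.
    by rewrite (H s t st) // ?lexx ?st.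
  by rewrite (H t s (ltW st)) // ?lexx ?ltW.
move: t; apply: real_induction.
- move=> s t /andP[s0 s1] /andP[t0 t1].
  by rewrite (_ : s = t) ?mdistxx ?subrr ?normr0 //; lra.
- move=> t at_ ci; have [e e0 ce] := cg t.
  have [at0|nat0] := eqVneq a t.
    exists e => // u /andP[tu ue] s s' /andP[s0 s1] /andP[s0' s1'].
    by rewrite ce // ltr_norml; apply/andP; split; lra.
  have at1 : a < t by rewrite lt_neqAle nat0.
  have key u b : a <= b -> b < t -> t < u < t + Num.min e (t - b) -> mdist (c b) (c u) = u - b.
    move=> ab bt /andP[tu]; rewrite addrC -ltrBlDr lt_min => /andP[ue ub].
    have -> : u = t + (u - t) by rewrite subrKC.
    apply: geodesic_extend => //; [by apply/andP; split; lra|exact: iso_on_sub ci|].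
    move=> s s' /andP[s0 s1] /andP[s0' s1'].
    by rewrite ce // ltr_norml; apply/andP; split; lra.
  exists (Num.min e (t - a) / 2); first by rewrite divr_gt0 // lt_min e0 subr_gt0.
  move=> u /andP[tu]; set m := Num.min _ _ => um.
  have me : m <= e by rewrite ge_min lexx.
  have ma : m <= t - a by rewrite ge_min lexx orbT.
  have m0 : 0 < m by rewrite lt_min e0 subr_gt0.
  suff W s s' : a <= s -> s <= s' -> s' <= u -> mdist (c s) (c s') = s' - s.
    move=> s s' /andP[s0 s1] /andP[s0' s1']; have [h|h] := leP s s'.
      by rewrite W // distrC ger0_norm // subr_ge0.
    rewrite metric_sym W // ?(ltW h) // ger0_norm // subr_ge0 ltW //.
  move=> as_ ss' su'; have [st'|st'] := leP s' t.
    rewrite ci ?as_ ?st' ?(le_trans ss') ?(le_trans as_) //.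
    by rewrite distrC ger0_norm // subr_ge0.
  (* A start within [m / 2] of [t] lies where [c] is already isometric around [t]; an earlier one
     leaves more room before [t] than [s'] takes after it, as [key] requires. *)
  have [st|st] := ltP s (t - m / 2); last first.
    rewrite ce ?ltr_norml; [|apply/andP; split; lra..].
    by rewrite distrC ger0_norm // subr_ge0.
  apply: key => //; first by lra.
  by rewrite st' /= addrC -ltrBlDr lt_min; apply/andP; split; lra.
- move=> t at_ H; have [e e0 ce] := cg t.
  have d s : a <= s <= t -> mdist (c s) (c t) = t - s.
    move=> /andP[as_ st]; apply/eqP; rewrite -subr_eq0 -normr_eq0.
    apply/eqP/le_anti; rewrite normr_ge0 andbT.
    apply/ler_addgt0Pl => /= r r0; rewrite addr0.
    have [sb|sb] := ltP (t - e) s.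
      rewrite ce ?subrr ?normr0 //; last by rewrite ltr_norml; apply/andP; split; lra.
      have -> : `|s - t| = t - s by rewrite distrC ger0_norm // subr_ge0.
      by rewrite subrr normr0 ltW.
    pose u := t - Num.min (e / 2) (r / 2).
    set m := Num.min _ _ in u.
    have m0 : 0 < m by rewrite lt_min !divr_gt0.
    have me : m <= e / 2 by rewrite ge_min lexx.
    have mr : m <= r / 2 by rewrite ge_min lexx orbT.
    have du : mdist (c u) (c t) = m.
      rewrite ce ?ltr_norml; [|rewrite /u; apply/andP; split; lra..].
      by rewrite /u distrC subKr gtr0_norm.
    have dsu : mdist (c s) (c u) = u - s.
      rewrite (H u); [|rewrite /u; apply/andP; split; lra..].
      by rewrite distrC ger0_norm // /u; lra.
    have := metric_triangle (c s) (c u) (c t).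
    have := metric_triangle (c s) (c t) (c u).
    rewrite [mdist (c t) (c u)]metric_sym du dsu /u => h1 h2.
    by rewrite ler_norml; apply/andP; split; lra.
  move=> s s' /andP[s0 s1] /andP[s0' s1'].
  have [st|st] := ltP s t; last first.
    have -> : s = t by lra.
    by rewrite metric_sym d ?s0' // ger0_norm // subr_ge0.
  have [st'|st'] := ltP s' t; last first.
    have -> : s' = t by lra.
    by rewrite d ?s0 // distrC ger0_norm // subr_ge0.
  have Hm : a <= Num.max s s' < t by rewrite le_max s0 gt_max st st'.
  by apply: (H _ Hm); rewrite ?s0 ?s0' /= le_max lexx ?orbT.
Qed.

Lemma line_geodesic c : line c -> geodesic mdist c.
Proof. by move=> cl t; exists 1. Qed.

(** Same forward end with matching time parameters. The exponential rate is a consequence,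
    [strongly_asymptotic_decay]. *)
Definition strongly_asymptotic c c' :=
  forall e, 0 < e -> exists T, forall t, T <= t -> mdist (c t) (c' t) <= e.

(** This is [isosceles] with its apex sent to infinity: on [[0, T]] the far ends nearly coincide,
    and the resulting errors vanish as [T] grows. *)
Lemma strongly_asymptotic_ch t c c' : line c -> line c' ->
  strongly_asymptotic c c' -> 0 <= t ->
  ch (mdist (c t) (c' t)) - 1 <= expR (- t) ^+ 2 * (ch (mdist (c 0) (c' 0)) - 1).
Proof.
move=> cl cl' ss t0.
set D := ch (mdist (c t) (c' t)); set D0 := ch (mdist (c 0) (c' 0)).
(* With [q = expR (- T)] and [q^2 <= e], the three terms absorb [2 D q^2], [e + q^2] and the
   contribution of the far ends. The threshold [ln (1 + e)] below serves to bound [expR f] by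
   [1 + e]. *)
apply: (@le_eps_mul _ (2 * D + 2 + 4 * (ch 1 * sh t ^+ 2))) => e e0 e1.
have le0 : 0 < ln (1 + e) by rewrite ln_gt0 // ltrDl.
have [T1 HT1] := ss _ le0.
have [T2 T20 HT2] := expRN_small e0.
pose T := Num.max (Num.max T1 T2) (t + 1).
have TT1 : T1 <= T by rewrite !le_max lexx.
have TT2 : T2 <= T by rewrite !le_max lexx orbT.
have Tt : t + 1 <= T by rewrite !le_max lexx orbT.
have T0 : 0 < T by lra.
have tT : 0 <= t <= T by apply/andP; split; lra.
have := bistewart (line_iso_on (a := 0) (b := T) cl) (line_iso_on (a := 0) (b := T) cl') tT tT.
rewrite !subr0 -/D -/D0.
set f := mdist (c T) (c' T).
have f0 : 0 <= f by exact: mdist_ge0.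
have fe : f <= ln (1 + e) by exact: HT1.
have ef : expR f <= 1 + e by rewrite -[leRHS]lnK ?ler_expR // posrE; lra.
have f1 : f <= 1.
  have e2 : 0 < 1 + e by lra.
  apply: le_trans fe _; rewrite -[leRHS]expRK ler_ln ?posrE ?expR_gt0 //.
  by have := expR_ge1Dx (1 : R); lra.
have cc : ch (mdist (c 0) (c' T)) <= ch (T + f).
  apply: ler_ch (mdist_ge0 _ _) _.
  apply: le_trans (metric_triangle _ (c T) _) _.
  by rewrite cl sub0r normrN ger0_norm // ltW.
have cc' : ch (mdist (c T) (c' 0)) <= ch (T + f).
  apply: ler_ch (mdist_ge0 _ _) _.
  apply: le_trans (metric_triangle _ (c' T) _) _.
  by rewrite cl' subr0 ger0_norm 1?addrC // ltW.
have cf : ch f <= ch 1 := ler_ch f0 f1.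
set q := expR (- T).
have q0 : 0 < q by exact: expR_gt0.
have qe : q <= e by exact: HT2.
pose E := expR T; have E0 : 0 < E by exact: expR_gt0.
have Eq1 : E * q = 1 by rewrite expRxN.
have D1 : 1 <= D by exact: ch_ge1.
have D01 : 1 <= D0 by exact: ch_ge1.
have st0 : 0 <= sh t by exact: sh_ge0.
have sTt : 0 <= sh (T - t) by rewrite sh_ge0 //; lra.
pose k := expR (- t); have k0 : 0 < k by exact: expR_gt0.
have sTtle : sh (T - t) <= E * k / 2.
  by rewrite /sh expRD ler_pM2r // lerBlDr lerDl expR_ge0.
have chTf : ch (T + f) <= E * (1 + e + q ^+ 2) / 2.
  rewrite /ch ler_pM2r // opprD !expRD mulrDr -/E -/q lerD //.
    by rewrite ler_pM2l.
  rewrite expr2 mulrA Eq1 mul1r ler_piMr ?(ltW q0) // expR_le1; lra.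
have q2 : q ^+ 2 <= e by rewrite expr2 (le_trans (ler_wpM2l (ltW q0) qe)) //; nra.
have shT : E ^+ 2 * (1 - 2 * q ^+ 2) / 4 <= sh T ^+ 2.
  rewrite /sh -/E -/q.
  have -> : ((E - q) / 2) ^+ 2 = (E ^+ 2 - 2 * (E * q) + q ^+ 2) / 4 by field.
  have -> : E ^+ 2 * (1 - 2 * q ^+ 2) = E ^+ 2 - 2 * (E * q) ^+ 2 by ring.
  by rewrite Eq1 expr1n ler_pM2r //; have := sqr_ge0 q; lra.
have kt : 2 * (sh t * k) = 1 - k ^+ 2.
  rewrite /sh -/k.
  have -> : 2 * ((expR t - k) / 2 * k) = expR t * k - k ^+ 2 by field.
  by rewrite expRxN.
move=> H.
have H1 : D * (E ^+ 2 * (1 - 2 * q ^+ 2) / 4) <=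
  D0 * (E * k / 2) ^+ 2 + 2 * (E * (1 + e + q ^+ 2) / 2 * (sh t * (E * k / 2)))
  + ch 1 * sh t ^+ 2.
  have A1 := ler_wpM2l (le_trans ler01 D1) shT; rewrite expr2 in A1.
  have sq : sh (T - t) * sh (T - t) <= (E * k / 2) ^+ 2.
    by rewrite expr2 ler_pM.
  have A2 := ler_wpM2l (le_trans ler01 D01) sq.
  have sx : sh t * sh (T - t) <= sh t * (E * k / 2) by exact: ler_wpM2l.
  have sx0 : 0 <= sh t * sh (T - t) by exact: mulr_ge0.
  have A3 : ch (T + f) * (sh t * sh (T - t)) <=
    E * (1 + e + q ^+ 2) / 2 * (sh t * (E * k / 2)).
    by apply: ler_pM => //; exact: ltW (ch_gt0 _).
  have A4 := ler_wpM2r sx0 cc; have A5 := ler_wpM2r sx0 cc'.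
  have A6 := ler_wpM2r (sqr_ge0 (sh t)) cf; rewrite expr2 in A6 *.
  rewrite [sh (T - t) * sh t]mulrC in H.
  lra.
(* Multiplying by [4 q^2] removes the growing factor since [E q = 1], and [kt] turns the two cross
   terms into [1 - k^2]. *)
have H2 : D * (1 - 2 * q ^+ 2) <=
  D0 * k ^+ 2 + (1 + e + q ^+ 2) * (1 - k ^+ 2) + 4 * (ch 1 * sh t ^+ 2) * q ^+ 2.
  have P : 0 < 4 * q ^+ 2 by rewrite mulr_gt0 // exprn_gt0.
  have := ler_wpM2r (ltW P) H1.
  have -> : D * (E ^+ 2 * (1 - 2 * q ^+ 2) / 4) * (4 * q ^+ 2) =
    (E * q) ^+ 2 * (D * (1 - 2 * q ^+ 2)) by field.
  have -> : (D0 * (E * k / 2) ^+ 2 +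
    2 * (E * (1 + e + q ^+ 2) / 2 * (sh t * (E * k / 2))) + ch 1 * sh t ^+ 2) *
    (4 * q ^+ 2) = (E * q) ^+ 2 * (D0 * k ^+ 2 + (1 + e + q ^+ 2) * (2 * (sh t * k)))
    + 4 * (ch 1 * sh t ^+ 2) * q ^+ 2 by field.
  by rewrite Eq1 expr1n !mul1r kt.
have C0 : 0 <= ch 1 * sh t ^+ 2 by rewrite mulr_ge0 ?sqr_ge0 // ltW // ch_gt0.
have k1 : 0 <= k ^+ 2 <= 1.
  by rewrite sqr_ge0 expr_le1 ?(ltW k0) // /k expR_le1; lra.
have B1 := ler_wpM2l C0 q2.
have B2 := ler_wpM2l (le_trans ler01 D1) q2.
case/andP: k1 => k1 k2.
have B3 : (e + q ^+ 2) * (1 - k ^+ 2) <= e + q ^+ 2.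
  by have := sqr_ge0 q => q20; apply: ler_piMr; lra.
by rewrite -/k; lra.
Qed.

Lemma strongly_asymptotic_decay t c c' : line c -> line c' ->
  strongly_asymptotic c c' -> 0 <= t ->
  mdist (c t) (c' t) <= expR (- t) * mdist (c 0) (c' 0) * expR (mdist (c 0) (c' 0)).
Proof.
move=> cl cl' ss t0; apply: ch_decay; [|exact: mdist_ge0..|exact: strongly_asymptotic_ch].
by rewrite expR_ge0 expR_le1 oppr_le0.
Qed.

End Lines.
(** * The integral metric on lines *)

Section WeightedIntegral.
Context {R : realType}.
Implicit Types (f g h : R -> R) (s t k K T : R).
Local Notation mu := (@lebesgue_measure R).

Lemma continuous_expR_abs k : continuous (fun s : R => expR (- (k * `|s|))).
Proof.
move=> s; apply: (@continuous_comp _ _ _ (fun s : R => - (k * `|s|)) expR).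
  by apply: continuousN; apply: cvgMr; exact: norm_continuous.
exact: continuous_expR.
Qed.

(** Twice the integral over the half-line, where the integrand is the exponential density of
    parameter [k] divided by [k]. *)
Lemma integral_expR_abs k : 0 < k ->
  (\int[mu]_s (expR (- (k * `|s|)))%:E = (2 / k)%:E)%E.
Proof.
move=> k0; rewrite ge0_symfun_integralT.
- have mE : measurable_fun setT (EFin \o exponential_pdf k).
    by apply/measurable_EFinP; exact: measurable_exponential_pdf.
  have := integral_exponential_pdf k0.
  rewrite -(setUv `[0, +oo[%classic) ge0_integral_setU //=; last 4 first.
  + exact: measurableC.
  + by rewrite setUv.
  + by move=> x _; rewrite lee_fin exponential_pdf_ge0 // ltW.
  + exact/disj_setPCl.
  rewrite [X in (_ + X)%E]integral0_eq ?adde0; last first.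
    by move=> x x0; rewrite /exponential_pdf patchE ifF // memNset.
  rewrite set_itvcy => E.
  have -> : (\int[mu]_(x in [set x | (0 <= x)%R]) (expR (- (k * `|x|)))%:E =
     \int[mu]_(x in [set x | (0 <= x)%R]) (k^-1%:E * (exponential_pdf k x)%:E))%E.
    apply: eq_integral => x /[!inE] /= x0.
    rewrite exponential_pdfE // -EFinM ger0_norm //; congr EFin.
    by rewrite mulNr mulKf // gt_eqF.
  rewrite ge0_integralZl //; last 4 first.
  + by rewrite -set_itvcy.
  + exact: measurable_funTS.
  + by move=> x _; rewrite lee_fin exponential_pdf_ge0 // ltW.
  + by rewrite lee_fin invr_ge0 ltW.
  by rewrite E mule1 -EFinM.
- by move=> s; exact: expR_ge0.
- exact: continuous_expR_abs.
- by move=> s; rewrite /= normrN.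
Qed.

Lemma integrable_expR_abs k : 0 < k ->
  mu.-integrable setT (EFin \o (fun s => expR (- (k * `|s|)))).
Proof.
move=> k0; apply/integrableP; split.
  apply/measurable_EFinP; apply: continuous_measurable_fun.
  exact: continuous_expR_abs.
under eq_integral do rewrite /= ger0_norm ?expR_ge0 //.
by rewrite integral_expR_abs // ltry.
Qed.

Definition wint f : R := \int[mu]_s (f s * expR (- (2 * `|s|))).

(* The bound makes [f] integrable against the weight, and unlike [A + 2 |s|]
   it is stable under translation up to the constant. *)
Definition tame f := [/\ continuous f, forall s, 0 <= f s &
  exists2 A, 0 <= A & forall s, f s <= A * expR `|s|].

Lemma tameD f g : tame f -> tame g -> tame (fun s => f s + g s).
Proof.
move=> [cf f0 [A A0 fA]] [cg g0 [B B0 gB]]; split.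
- by move=> s; apply: continuousD; [exact: cf|exact: cg].
- by move=> s; rewrite addr_ge0.
- by exists (A + B); [rewrite addr_ge0|move=> s; rewrite mulrDl lerD].
Qed.

Lemma tameZ k f : 0 <= k -> tame f -> tame (fun s => k * f s).
Proof.
move=> k0 [cf f0 [A A0 fA]]; split.
- by move=> s; apply: cvgMr; exact: cf.
- by move=> s; rewrite mulr_ge0.
- by exists (k * A); [rewrite mulr_ge0|move=> s; rewrite -mulrA ler_wpM2l].
Qed.

Lemma tame_cst k : 0 <= k -> tame (fun=> k).
Proof.
move=> k0; split => //; first by move=> s; exact: cvg_cst.
by exists k => // s; rewrite ler_peMr // -[leLHS]expR0 ler_expR.
Qed.

Lemma tame_expR : tame (fun s => expR `|s|).
Proof.
split; [|by move=> s; exact: expR_ge0|by exists 1 => // s; rewrite mul1r].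
have := @continuous_expR_abs (- 1).
by under eq_fun do rewrite mulN1r opprK.
Qed.

Lemma tame_shift t f : tame f -> tame (fun s => f (s + t)).
Proof.
move=> [cf f0 [A A0 fA]]; split => //.
- move=> s; apply: (@continuous_comp _ _ _ (fun s => s + t) f); last exact: cf.
  by apply: continuousD => //; exact: cvg_cst.
- exists (A * expR `|t|); first by rewrite mulr_ge0 // expR_ge0.
  move=> s; apply: le_trans (fA _) _; rewrite -mulrA ler_wpM2l // -expRD ler_expR.
  by rewrite addrC ler_normD.
Qed.

Lemma tame_rev f : tame f -> tame (fun s => f (- s)).
Proof.
move=> [cf f0 [A A0 fA]]; split => //.
- by move=> s; apply: (@continuous_comp _ _ _ -%R f); [exact: opp_continuous|exact: cf].
- by exists A => // s; rewrite -normrN.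
Qed.

Lemma continuous_weighted f : continuous f ->
  continuous (fun s => f s * expR (- (2 * `|s|))).
Proof. by move=> cf s; apply: cvgM; [exact: cf|exact: continuous_expR_abs]. Qed.

Lemma tame_integrable f : tame f ->
  mu.-integrable setT (EFin \o (fun s => f s * expR (- (2 * `|s|)))).
Proof.
move=> [cf f0 [A A0 fA]].
apply: le_integrable (integrableZl _ A (integrable_expR_abs ltr01)) => //.
- apply/measurable_EFinP; apply: continuous_measurable_fun.
  exact: continuous_weighted.
- move=> s _ /=; rewrite lee_fin; move: (s : R) => {}s.
  rewrite [leLHS]ger0_norm ?mulr_ge0 ?expR_ge0 //.
  rewrite [leRHS]ger0_norm ?mulr_ge0 ?expR_ge0 //.
  apply: le_trans (ler_wpM2r (expR_ge0 _) (fA s)) _.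
  rewrite -mulrA ler_wpM2l // -expRD ler_expR; lra.
Qed.

Lemma wint_le f g : tame f -> tame g -> (forall s, f s <= g s) -> wint f <= wint g.
Proof.
move=> tf tg fg; apply: le_Rintegral => //; [exact: tame_integrable..|].
by move=> s _; rewrite ler_wpM2r // expR_ge0.
Qed.

Lemma wintD f g : tame f -> tame g -> wint (fun s => f s + g s) = wint f + wint g.
Proof.
move=> tf tg; rewrite /wint; under eq_Rintegral do rewrite mulrDl.
by rewrite RintegralD //; exact: tame_integrable.
Qed.

Lemma wintZ k f : tame f -> wint (fun s => k * f s) = k * wint f.
Proof.
move=> tf; rewrite /wint; under eq_Rintegral do rewrite -mulrA.
by rewrite RintegralZl //; exact: tame_integrable.
Qed.

Lemma wint_ge0 f : tame f -> 0 <= wint f.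
Proof. by move=> [_ f0 _]; apply: Rintegral_ge0 => s _; rewrite mulr_ge0 ?expR_ge0. Qed.

Lemma wint_cst k : 0 <= k -> wint (fun=> k) = k.
Proof.
move=> k0; rewrite -[in LHS](mulr1 k) wintZ; last exact: tame_cst.
rewrite /wint; under eq_Rintegral do rewrite mul1r.
by rewrite /Rintegral integral_expR_abs //= divff // mulr1.
Qed.

Lemma wint_expR : wint (fun s => expR `|s|) = 2.
Proof.
rewrite /wint; under eq_Rintegral.
  move=> s _; rewrite -expRD (_ : `|s| - 2 * `|s| = - (1 * `|s|)); last by ring.
  over.
by rewrite /Rintegral integral_expR_abs //= divr1.
Qed.

Lemma integral_shift t g : continuous g -> (forall s, 0 <= g s) ->
  \int[mu]_s (g (s + t)) = \int[mu]_s (g s).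
Proof.
move=> cg g0; rewrite /Rintegral; congr fine.
have D : (fun s : R => s + t)^`()%classic = cst 1.
  by apply/funext => z; rewrite derive1E deriveD // derive_id derive_cst addr0.
rewrite (@increasing_ge0_integration_by_substitutionT _ (fun s => s + t) g) //.
- by apply: eq_integral => s _; rewrite D /= mulr1.
- by move=> x y xy; rewrite ltrD2r.
- by rewrite D; exact: cst_continuous.
- by rewrite D; exact: is_cvg_cst.
- by rewrite D; exact: is_cvg_cst.
- apply/cvgrNyPle => A; near=> x; rewrite -lerBrDr.
  by near: x; apply: nbhs_ninfty_le; exact: num_real.
- apply/cvgryPge => A; near=> x; rewrite -lerBlDr.
  by near: x; apply: nbhs_pinfty_ge; exact: num_real.
Unshelve. all: by end_near. Qed.

Lemma integral_rev g : continuous g -> (forall s, 0 <= g s) ->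
  \int[mu]_s (g (- s)) = \int[mu]_s (g s).
Proof.
move=> cg g0; rewrite /Rintegral; congr fine.
have split_half h : continuous h -> (forall s, 0 <= h s) ->
  (\int[mu]_s (h s)%:E = \int[mu]_(s in `]-oo, (- 0)%R]) (h s)%:E +
     \int[mu]_(s in `[0%R, +oo[) (h s)%:E)%E.
  move=> ch h0.
  have mh : measurable_fun [set: R] (EFin \o h).
    by apply/measurable_EFinP; exact: continuous_measurable_fun.
  rewrite -(setUv `[0, +oo[%classic) ge0_integral_setU //=; last 4 first.
  - exact: measurableC.
  - by rewrite setUv.
  - by move=> x _; rewrite lee_fin.
  - exact/disj_setPCl.
  rewrite addeC setCitvr; congr (_ + _)%E.
  by rewrite oppr0 integral_itv_bndo_bndc //; exact: measurable_funTS.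
have cg' : continuous (fun s => g (- s)).
  by move=> s; apply: (@continuous_comp _ _ _ -%R g); [exact: opp_continuous|exact: cg].
rewrite split_half // [RHS]split_half // addeC; congr (_ + _)%E.
  rewrite ge0_integration_by_substitutionNy //.
  exact: continuous_subspaceT.
rewrite [RHS](_ : _ = \int[mu]_(x in `[0%R, +oo[) (((fun s => g (- s)) \o -%R) x)%:E)%E.
  rewrite ge0_integration_by_substitutionNy //.
  exact: continuous_subspaceT.
by apply: eq_integral => x _ /=; rewrite opprK.
Qed.

Lemma wint_rev f : tame f -> wint (fun s => f (- s)) = wint f.
Proof.
move=> [cf f0 _]; rewrite /wint.
rewrite -(@integral_rev (fun s => f s * expR (- (2 * `|s|)))).
- by apply: eq_Rintegral => s _; rewrite normrN.
- exact: continuous_weighted.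
- by move=> s; rewrite mulr_ge0 ?expR_ge0.
Qed.

(** Translation invariance, with the ratio of the two weights moved onto the function. The estimates
    for shifts reduce to bounding this ratio. *)
Lemma wint_shift t f : tame f ->
  wint (fun s => f (s + t) * expR (2 * `|s| - 2 * `|s + t|)) = wint f.
Proof.
move=> [cf f0 _]; rewrite /wint.
rewrite -(@integral_shift t (fun s => f s * expR (- (2 * `|s|)))).
- by apply: eq_Rintegral => s _; rewrite -mulrA -expRD; congr (_ * expR _); ring.
- exact: continuous_weighted.
- by move=> s; rewrite mulr_ge0 ?expR_ge0.
Qed.

Lemma tame_shift_weight t f : tame f ->
  tame (fun s => f (s + t) * expR (2 * `|s| - 2 * `|s + t|)).
Proof.
move=> tf; have [cf f0 [A A0 fA]] := tame_shift t tf; split.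
- have -> : (fun s => f (s + t) * expR (2 * `|s| - 2 * `|s + t|)) =
    (fun s => f (s + t) * (expR (- (- 2 * `|s|)) * expR (- (2 * `|s + t|)))).
    by apply/funext => s; rewrite -expRD mulNr opprK.
  move=> s; apply: cvgM; first exact: cf.
  apply: cvgM; first exact: continuous_expR_abs.
  apply: (@continuous_comp _ _ _ (fun s => s + t) (fun s => expR (- (2 * `|s|)))).
    by apply: continuousD => //; exact: cvg_cst.
  exact: continuous_expR_abs.
- by move=> s; rewrite mulr_ge0 ?expR_ge0.
- exists (A * expR (2 * `|t|)); first by rewrite mulr_ge0 ?expR_ge0.
  move=> s; rewrite mulrAC; apply: ler_pM; rewrite ?expR_ge0 //.
  rewrite ler_expR; have := ler_normB (s + t) t; rewrite addrK; lra.
Qed.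

Lemma wint_shift_le t f : tame f ->
  wint (fun s => f (s + t)) <= expR (2 * `|t|) * wint f.
Proof.
move=> tf; rewrite -(wint_shift t tf) -wintZ; last exact: tame_shift_weight.
apply: wint_le; first exact: tame_shift.
  by apply: tameZ; [exact: expR_ge0|exact: tame_shift_weight].
move=> s; rewrite mulrCA ler_peMr //; first by case: tf.
rewrite -expRD -[leLHS]expR0 ler_expR; have := ler_normD s t; lra.
Qed.

(** The line is cut at [s = - t]. Before it, the ratio of weights in [wint_shift] is exactly
    [expR (2 t)], which gives the first term. After it, [f (s + t)] is at most
    [K expR (- t) expR |s|], and [expR |s|] has weighted integral 2. *)
Lemma wint_contract t f K : tame f -> 0 <= t -> 0 <= K ->
  (forall u, 0 <= u -> f u <= K * expR (- u)) ->
  wint (fun s => f (s + t)) <= expR (- (2 * t)) * wint f + 2 * K * expR (- t).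
Proof.
move=> tf t0 K0 fK.
pose g s := expR (- (2 * t)) * (f (s + t) * expR (2 * `|s| - 2 * `|s + t|)).
pose h s := K * expR (- t) * expR `|s|.
have tg : tame g by apply: tameZ; [exact: expR_ge0|exact: tame_shift_weight].
have K1 : 0 <= K * expR (- t) by rewrite mulr_ge0 ?expR_ge0.
have th : tame h by apply: tameZ => //; exact: tame_expR.
have -> : expR (- (2 * t)) * wint f + 2 * K * expR (- t) = wint (fun s => g s + h s).
  rewrite wintD // wintZ; last exact: tame_shift_weight.
  rewrite wint_shift // /h wintZ; last exact: tame_expR.
  by rewrite wint_expR; ring.
have f0 s : 0 <= f s by case: tf.
apply: wint_le; [exact: tame_shift|exact: tameD|] => s.
have [st|st] := leP 0 (s + t).
  apply: le_trans (fK _ st) _.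
  apply: ler_wpDl; first by rewrite mulr_ge0 ?expR_ge0 // mulr_ge0 ?expR_ge0.
  rewrite /h -mulrA ler_wpM2l // -expRD ler_expR.
  by have := ler_norm (- s); rewrite normrN; lra.
apply: ler_wpDr; first by rewrite mulr_ge0 ?expR_ge0.
rewrite /g mulrCA ler_peMr // -expRD -[leLHS]expR0 ler_expR.
rewrite (ltr0_norm st) ltr0_norm; lra.
Qed.

Lemma wint_small f theta T : tame f -> 0 <= theta ->
  (forall s, f s <= theta + 2 * expR (- T) * expR `|s|) ->
  wint f <= theta + 4 * expR (- T).
Proof.
move=> tf th0 H.
have T0 : 0 <= 2 * expR (- T) by rewrite mulr_ge0 ?expR_ge0.
have -> : theta + 4 * expR (- T) =
    wint (fun s => theta + 2 * expR (- T) * expR `|s|).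
  rewrite wintD; [|exact: tame_cst|by apply: tameZ => //; exact: tame_expR].
  by rewrite wint_cst // wintZ ?wint_expR; [ring|exact: tame_expR].
apply: wint_le => //; apply: tameD; first exact: tame_cst.
by apply: tameZ => //; exact: tame_expR.
Qed.

(** The weight is a symmetric probability density, so integrating the midpoint inequality gives the
    claim. *)
Lemma wint_jensen f : tame f -> (forall s, f 0 <= (f s + f (- s)) / 2) ->
  f 0 <= wint f.
Proof.
move=> tf H; have f0 : 0 <= f 0 by case: tf.
have tr := tame_rev tf.
have -> : wint f = wint (fun s => 2^-1 * (f s + f (- s))).
  by rewrite wintZ ?wintD ?wint_rev //; [field|exact: tameD].
rewrite -[leLHS](wint_cst f0); apply: wint_le; first exact: tame_cst.
  by apply: tameZ => //; exact: tameD.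
by move=> s; rewrite mulrC.
Qed.

End WeightedIntegral.

(** * Distances of lines: pointwise bounds, shifts and contraction *)

Section GeodesicDist.
Context (R : realType) (X : metricType R).
Hypothesis catX : CAT_m1 X.
Implicit Types (c l w : R -> X) (s t T theta : R).

Lemma continuous_line_dist c c' : line c -> line c' ->
  continuous (fun s => mdist (c s) (c' s)).
Proof.
move=> cl cl' s; apply/(@cvgrPdist_le _ R^o) => e e0; near=> t.
have st : `|s - t| <= e / 2.
  near: t; apply: (@cvgr_dist_le _ _ _ _ _ (fun t : R => t)); last exact: divr_gt0.
  exact: cvg_id.
have h1 := metric_triangle (c s) (c t) (c' s).
have h2 := metric_triangle (c t) (c' t) (c' s).
have h3 := metric_triangle (c t) (c s) (c' t).
have h4 := metric_triangle (c s) (c' s) (c' t).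
have e1 : mdist (c' t) (c' s) = `|s - t| by rewrite cl' distrC.
have e2 : mdist (c t) (c s) = `|s - t| by rewrite cl distrC.
rewrite cl in h1; rewrite e1 in h2; rewrite e2 in h3; rewrite cl' in h4.
rewrite ler_norml; apply/andP; split; lra.
Unshelve. all: by end_near. Qed.

Lemma line_dist_le s t c c' : line c -> line c' ->
  mdist (c s) (c' s) <= mdist (c t) (c' t) + 2 * `|s - t|.
Proof.
move=> cl cl'.
have := metric_triangle (c s) (c t) (c' s).
have := metric_triangle (c t) (c' t) (c' s).
by rewrite cl cl' [`|t - s|]distrC; lra.
Qed.

Lemma tame_dist c c' : line c -> line c' -> tame (fun s => mdist (c s) (c' s)).
Proof.
move=> cl cl'; split.
- exact: continuous_line_dist.
- by move=> s; exact: mdist_ge0.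
- exists (mdist (c 0) (c' 0) + 2); first by rewrite addr_ge0 ?mdist_ge0.
  move=> s; apply: le_trans (line_dist_le s 0 cl cl') _.
  rewrite subr0 [leRHS]mulrDl lerD //.
    by rewrite ler_peMr ?mdist_ge0 // -[leLHS]expR0 ler_expR.
  rewrite ler_wpM2l //; apply: le_trans (expR_ge1Dx _); lra.
Qed.

Lemma geodesic_distE c c' : geodesic_dist c c' = wint (fun s => mdist (c s) (c' s)).
Proof. by []. Qed.

Lemma geodesic_dist_ge0 c c' : line c -> line c' -> 0 <= geodesic_dist c c'.
Proof. by move=> cl cl'; apply: wint_ge0; exact: tame_dist. Qed.

Lemma geodesic_distC c c' : geodesic_dist c c' = geodesic_dist c' c.
Proof. by apply: eq_Rintegral => s _; rewrite metric_sym. Qed.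

Lemma geodesic_distxx c : geodesic_dist c c = 0.
Proof.
rewrite geodesic_distE (_ : (fun s => mdist (c s) (c s)) = fun=> 0); first exact: wint_cst.
by apply/funext => s; exact: mdistxx.
Qed.

Lemma geodesic_dist_triangle c' c c'' : line c -> line c' -> line c'' ->
  geodesic_dist c c'' <= geodesic_dist c c' + geodesic_dist c' c''.
Proof.
move=> cl cl' cl''; rewrite !geodesic_distE -wintD; [|exact: tame_dist..].
apply: wint_le; [exact: tame_dist|apply: tameD; exact: tame_dist|].
by move=> s; exact: metric_triangle.
Qed.

Lemma dist0_le_geodesic_dist c c' : line c -> line c' ->
  mdist (c 0) (c' 0) <= geodesic_dist c c'.
Proof.
move=> cl cl'; apply: (wint_jensen (tame_dist cl cl')) => s.
by have := dist_convex catX s 0 cl cl'; rewrite add0r sub0r.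
Qed.

Lemma geodesic_dist_shift_le t c c' : line c -> line c' ->
  geodesic_dist (shift t c) (shift t c') <= expR (2 * `|t|) * geodesic_dist c c'.
Proof. by move=> cl cl'; exact: (wint_shift_le t (tame_dist cl cl')). Qed.

Lemma dist_le_geodesic_dist s c c' : line c -> line c' ->
  mdist (c s) (c' s) <= expR (2 * `|s|) * geodesic_dist c c'.
Proof.
move=> cl cl'; apply: le_trans (geodesic_dist_shift_le s cl cl').
have := dist0_le_geodesic_dist (line_shift s cl) (line_shift s cl').
by rewrite /shift add0r.
Qed.

Lemma geodesic_dist_eq0 c c' : line c -> line c' -> geodesic_dist c c' = 0 -> c = c'.
Proof.
move=> cl cl' E; apply/funext => s; apply: mdist_positivity; apply/le_anti.
by rewrite mdist_ge0 andbT; have := dist_le_geodesic_dist s cl cl'; rewrite E mulr0.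
Qed.

Lemma geodesic_dist_shift t c : line c -> geodesic_dist c (shift t c) = `|t|.
Proof.
move=> cl; rewrite geodesic_distE -[RHS](wint_cst (normr_ge0 t)).
congr wint; apply/funext => s; rewrite /shift cl -normrN; congr (`|_|); ring.
Qed.

Lemma geodesic_dist_rev c c' : line c -> line c' ->
  geodesic_dist (fun s => c (- s)) (fun s => c' (- s)) = geodesic_dist c c'.
Proof. by move=> cl cl'; exact: (wint_rev (tame_dist cl cl')). Qed.

(** Outside [[- T, T]] the 2-Lipschitz bound from the nearest end gives [theta + 2 (|s| - T)], at
    most [theta + 2 expR (|s| - T)]; the weighted integral of the excess is [4 expR (- T)]. *)
Lemma geodesic_dist_small T theta c c' : line c -> line c' -> 0 <= T -> 0 <= theta ->
  (forall s, `|s| <= T -> mdist (c s) (c' s) <= theta) ->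
  geodesic_dist c c' <= theta + 4 * expR (- T).
Proof.
move=> cl cl' T0 th0 H; apply: wint_small => //; first exact: tame_dist.
move=> s; have [sT|sT] := leP `|s| T.
  by rewrite (le_trans (H _ sT)) // lerDl mulr_ge0 ?expR_ge0 // mulr_ge0 ?expR_ge0.
have [T' TT HT] : exists2 T', `|s - T'| <= `|s| - T & `|T'| <= T.
  have [s0|s0] := leP 0 s.
    rewrite (ger0_norm s0) in sT *.
    by exists T; rewrite ?(ger0_norm T0) // ger0_norm ?lexx // subr_ge0 ltW.
  rewrite (ltr0_norm s0) in sT *; exists (- T); last by rewrite normrN ger0_norm.
  by rewrite opprK ler0_norm; lra.
apply: le_trans (line_dist_le s T' cl cl') _; rewrite lerD ?H // -mulrA ler_wpM2l //.
apply: le_trans TT _; rewrite -expRD addrC.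
by apply: le_trans (expR_ge1Dx _); rewrite lerDr.
Qed.

(** The constant depends on the pair through its distance at time 0, and becomes uniform once the
    lines are close. *)
Lemma geodesic_dist_contract t c c' : line c -> line c' ->
  strongly_asymptotic c c' -> 0 <= t ->
  geodesic_dist (shift t c) (shift t c') <=
  (1 + 2 * expR (mdist (c 0) (c' 0))) * expR (- t) * geodesic_dist c c'.
Proof.
move=> cl cl' ss t0; set f0 := mdist (c 0) (c' 0).
have f00 : 0 <= f0 by exact: mdist_ge0.
pose K := f0 * expR f0.
have K0 : 0 <= K by rewrite mulr_ge0 ?expR_ge0.
have := wint_contract (tame_dist cl cl') t0 K0 => H.
have {H} H : geodesic_dist (shift t c) (shift t c') <=
    expR (- (2 * t)) * geodesic_dist c c' + 2 * K * expR (- t).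
  apply: H => u u0; have := strongly_asymptotic_decay catX cl cl' ss u0.
  by have -> : K * expR (- u) = expR (- u) * f0 * expR f0 by rewrite /K; ring.
apply: le_trans H _.
have g0 := geodesic_dist_ge0 cl cl'.
have f0g : f0 <= geodesic_dist c c' by exact: dist0_le_geodesic_dist.
have h1 : expR (- (2 * t)) * geodesic_dist c c' <= expR (- t) * geodesic_dist c c'.
  by rewrite ler_wpM2r // ler_expR; lra.
have h2 : 2 * K * expR (- t) <= 2 * expR f0 * expR (- t) * geodesic_dist c c'.
  have -> : 2 * K * expR (- t) = 2 * expR f0 * expR (- t) * f0 by rewrite /K; ring.
  by rewrite ler_wpM2l // !mulr_ge0 ?expR_ge0.
by rewrite [leRHS](_ : _ = expR (- t) * geodesic_dist c c' +
  2 * expR f0 * expR (- t) * geodesic_dist c c'); [exact: lerD|ring].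
Qed.

End GeodesicDist.
(** * Brackets of lines *)

Section UltrafilterLimits.

Lemma filter_exI3 (I : Type) (F : set_system I) (A B D : set I) : ProperFilter F ->
  F A -> F B -> F D -> exists i, [/\ A i, B i & D i].
Proof.
move=> PF FA FB FD; have /filter_ex[i [[Ai Bi] Di]] : F (A `&` B `&` D).
  exact: filterI (filterI FA FB) FD.
by exists i.
Qed.

Lemma filter_exI (I : Type) (F : set_system I) (A B : set I) : ProperFilter F ->
  F A -> F B -> exists i, A i /\ B i.
Proof. by move=> PF FA FB; have [i []] := filter_exI3 PF FA FB FB; exists i. Qed.

Lemma ultra_compact_lim (I : Type) (F : set_system I) (T : topologicalType)
    (h : I -> T) (K : set T) : UltraFilter F -> compact K -> F (h @^-1` K) ->
  exists2 p, K p & forall U, nbhs p U -> F (h @^-1` U).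
Proof.
move=> UF cK FK; have [] := cK (h @ F) _ FK.
move=> p [Kp clp]; exists p => // U pU.
have [//|FC] := in_ultra_setVsetC (h @^-1` U) UF.
have [q [FCq Uq]] := clp (~` U) U FC pU.
by case: FCq.
Qed.

Context (R : realType) (X : metricType R).

Lemma ultra_compact_dist (I : Type) (F : set_system I) (h : I -> X) (K : set X) :
  UltraFilter F -> compact K -> F (h @^-1` K) ->
  exists2 p, K p & forall e, 0 < e -> F [set y | mdist (h y) p < e].
Proof.
move=> UF cK FK; have [p Kp H] := ultra_compact_lim UF cK FK.
exists p => // e e0; have := H _ (nbhsx_ballx p _ e0).
by apply: filterS => y /=; rewrite ballEmdist /= metric_sym.
Qed.

(** Along an ultrafilter all points [m i s] converge at once, without diagonal extraction. The
    isometry condition is only asked eventually for each pair of times, because the [m i] may be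
    segments of growing length. *)
Lemma line_limit (I : Type) (F : set_system I) (m : I -> R -> X) (C : set X)
    (x0 : X) (A : R) : UltraFilter F ->
  (forall r, compact (C `&` [set y | mdist x0 y <= r])) ->
  (forall s, F [set i | C (m i s) /\ mdist x0 (m i s) <= A + `|s|]) ->
  (forall s t, F [set i | mdist (m i s) (m i t) = `|s - t|]) ->
  exists w : R -> X, [/\ line w, forall s, C (w s) &
    forall s e, 0 < e -> F [set i | mdist (m i s) (w s) < e]].
Proof.
move=> UF cK FC Fl.
have /choice[w wP] : forall s, exists p, C p /\
    forall e, 0 < e -> F [set i | mdist (m i s) p < e].
  move=> s; have [p [Cp _] H] := ultra_compact_dist UF (cK (A + `|s|)) (FC s).
  by exists p.
exists w; split; [|by move=> s; have [] := wP s|by move=> s; have [_] := wP s].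
move=> s t; apply/eqP; rewrite -subr_eq0 -normr_eq0; apply/eqP/le_anti.
rewrite normr_ge0 andbT; apply/ler_addgt0Pl => e e0; rewrite addr0.
have [_ /(_ (e / 2)) Hs] := wP s; have [_ /(_ (e / 2)) Ht] := wP t.
have e2 : 0 < e / 2 by exact: divr_gt0.
have [i [/= h1 h2 h3]] := filter_exI3 _ (Hs e2) (Ht e2) (Fl s t).
rewrite -h3.
have a1 := metric_triangle (w s) (m i s) (w t).
have a2 := metric_triangle (m i s) (m i t) (w t).
have a3 := metric_triangle (m i s) (w s) (m i t).
have a4 := metric_triangle (w s) (w t) (m i t).
rewrite [mdist (w s) (m i s)]metric_sym in a1.
rewrite [mdist (w t) (m i t)]metric_sym in a4.
by rewrite ler_norml; apply/andP; split; lra.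
Qed.

End UltrafilterLimits.

Section Brackets.
Context (R : realType) (X : metricType R).
Hypothesis catX : CAT_m1 X.
Implicit Types (c l w u : R -> X) (s t v T theta K : R).

Definition reverse c : R -> X := fun s => c (- s).

(* [w] is the bracket of [c] and [c']: its backward end is that of [c], up to
   the time shift [v], and it is synchronized with the forward end of [c']. *)
Definition bracket_of c c' w v :=
  strongly_asymptotic w c' /\
  strongly_asymptotic (reverse w) (reverse (shift v c)).

Lemma shift_zero c : shift 0 c = c.
Proof. by apply/funext => s; rewrite /shift addr0. Qed.

Lemma shift_shift s t c : shift s (shift t c) = shift (s + t) c.
Proof. by apply/funext => r; rewrite /shift addrA. Qed.

Lemma strongly_asymptotic_refl c : strongly_asymptotic c c.
Proof. by move=> e e0; exists 0 => t _; rewrite mdistxx ltW. Qed.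

Lemma strongly_asymptotic_sym c c' :
  strongly_asymptotic c c' -> strongly_asymptotic c' c.
Proof. by move=> H e /H[T HT]; exists T => t /HT; rewrite metric_sym. Qed.

Lemma strongly_asymptotic_trans c' c c'' : strongly_asymptotic c c' ->
  strongly_asymptotic c' c'' -> strongly_asymptotic c c''.
Proof.
move=> H H' e e0; have e2 : 0 < e / 2 by exact: divr_gt0.
have [T HT] := H _ e2; have [T' HT'] := H' _ e2; exists (Num.max T T') => t.
rewrite ge_max => /andP[/HT h /HT' h'].
by have := metric_triangle (c t) (c' t) (c'' t); lra.
Qed.

Lemma strongly_asymptotic_shift t c c' :
  strongly_asymptotic c c' -> strongly_asymptotic (shift t c) (shift t c').
Proof.
move=> H e /H[T HT]; exists (T - t) => s h; apply: HT; lra.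
Qed.

Lemma reverse_shift t c : reverse (shift t c) = shift (- t) (reverse c).
Proof. by apply/funext => s; rewrite /reverse /shift opprD opprK. Qed.

Lemma strongly_asymptotic_exp B c c' :
  (forall t, 0 <= t -> mdist (c t) (c' t) <= B * expR (- t)) ->
  strongly_asymptotic c c'.
Proof.
move=> H e e0; pose B' := `|B| + 1.
have B0 : 0 < B' by rewrite ltr_wpDl.
have [T T0 HT] := expRN_small (divr_gt0 e0 B0).
exists T => t Tt; apply: le_trans (H _ (le_trans T0 Tt)) _.
apply: le_trans (_ : B' * expR (- t) <= _).
  by rewrite ler_wpM2r ?expR_ge0 // (le_trans (ler_norm B)) // lerDl.
by rewrite mulrC -ler_pdivlMr // HT.
Qed.

(** The shift is read off from lengths: between far times the chord of [w'] is shorter by [a] than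
    that of [w], while their ends become arbitrarily close. Once [a = 0], convexity bounds the
    distance at any time by the average of two small ones. *)
Lemma strongly_asymptotic_both w w' a : line w -> line w' ->
  strongly_asymptotic w w' ->
  strongly_asymptotic (reverse w) (reverse (shift a w')) -> a = 0 /\ w = w'.
Proof.
move=> lw lw' H H'.
have a0 : a = 0.
  apply/eqP; rewrite -normr_eq0; apply/eqP/le_anti; rewrite normr_ge0 andbT.
  apply/ler_addgt0Pl => e e0; rewrite addr0.
  have e2 : 0 < e / 2 by exact: divr_gt0.
  have [T HT] := H _ e2; have [T' HT'] := H' _ e2.
  pose t := Num.max (Num.max T T') `|a|.
  have tT : T <= t by rewrite !le_max lexx.
  have tT' : T' <= t by rewrite !le_max lexx orbT.
  have ta : `|a| <= t by rewrite !le_max lexx orbT.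
  have h1 := HT t tT; have h2 := HT' t tT'.
  rewrite /reverse /shift in h2.
  have q1 := metric_triangle (w (- t)) (w' (- t + a)) (w t).
  have q2 := metric_triangle (w' (- t + a)) (w' t) (w t).
  have q3 := metric_triangle (w' (- t + a)) (w (- t)) (w' t).
  have q4 := metric_triangle (w (- t)) (w t) (w' t).
  rewrite [mdist (w' t) (w t)]metric_sym in q2.
  rewrite [mdist (w' (- t + a)) (w (- t))]metric_sym in q3.
  have E1 : mdist (w (- t)) (w t) = 2 * t.
    by rewrite lw distrC opprK ger0_norm; have := normr_ge0 a; lra.
  have E2 : mdist (w' (- t + a)) (w' t) = 2 * t - a.
    by rewrite lw' distrC ger0_norm; have := ler_norm a; have := normr_ge0 a; lra.
  rewrite ?E1 ?E2 in q1 q2 q3 q4.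
  by rewrite ler_norml; apply/andP; split; lra.
split=> //; rewrite a0 shift_zero in H'.
apply/funext => s; apply: mdist_positivity; apply/le_anti; rewrite mdist_ge0 andbT.
apply/ler_addgt0Pl => e e0; rewrite addr0.
have [T HT] := H _ e0; have [T' HT'] := H' _ e0.
pose r := Num.max (T - s) (T' + s).
have r1 : T - s <= r by rewrite le_max lexx.
have r2 : T' + s <= r by rewrite le_max lexx orbT.
have h1 : mdist (w (s + r)) (w' (s + r)) <= e by apply: HT; lra.
have h2 : mdist (w (s - r)) (w' (s - r)) <= e.
  have := HT' (r - s); rewrite /reverse opprB; apply; lra.
by have := dist_convex catX r s lw lw'; lra.
Qed.

Lemma bracket_of_unique c c' w w' v v' : line w -> line w' ->
  bracket_of c c' w v -> bracket_of c c' w' v' -> w = w' /\ v = v'.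
Proof.
move=> lw lw' [H1 H2] [H1' H2'].
have S1 := strongly_asymptotic_trans H1 (strongly_asymptotic_sym H1').
have S2 : strongly_asymptotic (reverse w) (reverse (shift (v - v') w')).
  apply: strongly_asymptotic_trans H2 _; apply: strongly_asymptotic_sym.
  have := strongly_asymptotic_shift (- (v - v')) H2'.
  by rewrite -!reverse_shift shift_shift subrK.
have [E ->] := strongly_asymptotic_both lw lw' S1 S2; split=> //; lra.
Qed.

Lemma bracket_of_shift t c c' w v :
  bracket_of c c' w v -> bracket_of (shift t c) (shift t c') (shift t w) v.
Proof.
move=> [H1 H2]; split; first exact: strongly_asymptotic_shift.
rewrite shift_shift addrC -shift_shift.
by rewrite !(reverse_shift t); exact: strongly_asymptotic_shift.
Qed.

Lemma bracket_of_self c : bracket_of c c c 0.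
Proof. by rewrite /bracket_of shift_zero; split; exact: strongly_asymptotic_refl. Qed.

(** The identity [br (br x y) z = br x z] on lines: [w] keeps the backward end of [c], so the time
    shifts add up. *)
Lemma bracket_of_left c c' c'' w u v v' :
  bracket_of c c' w v -> bracket_of w c'' u v' -> bracket_of c c'' u (v' + v).
Proof.
move=> [_ H] [K1 K2]; split=> //; apply: strongly_asymptotic_trans K2 _.
by rewrite -shift_shift !(reverse_shift v'); exact: strongly_asymptotic_shift.
Qed.

(** The identity [br x (br y z) = br x z] on lines: [w] keeps the forward end of [c'']. *)
Lemma bracket_of_right c c' c'' w u v v' :
  bracket_of c' c'' w v -> bracket_of c w u v' -> bracket_of c c'' u v'.
Proof. by move=> [H _] [K1 K2]; split=> //; exact: strongly_asymptotic_trans H. Qed.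

(** Gives membership in [Vss] on lines; [bracket_of_uu] does the same for [Vu]. *)
Lemma bracket_of_ss w c' : strongly_asymptotic w c' -> bracket_of w c' w 0.
Proof. by move=> H; split; rewrite ?shift_zero //; exact: strongly_asymptotic_refl. Qed.

Lemma bracket_of_uu c w v : strongly_asymptotic (reverse w) (reverse (shift v c)) ->
  bracket_of c w w v.
Proof. by split=> //; exact: strongly_asymptotic_refl. Qed.

Lemma expR1_gt2 : 2 < expR 1 :> R.
Proof. by have := @expR_gt1Dx R 1; rewrite oner_eq0 => /(_ isT); lra. Qed.

Lemma sh_le_expR (x : R) : sh x <= expR x.
Proof. by rewrite /sh; have := expR_ge0 x; have := expR_ge0 (- x); lra. Qed.

Lemma expR_le_sh (x : R) : 1 <= x -> expR x <= 4 * sh x.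
Proof.
move=> x1; rewrite /sh.
have h1 : 2 < expR x by apply: lt_le_trans expR1_gt2 _; rewrite ler_expR.
have h2 : expR (- x) < 2^-1 by rewrite expRN ltf_pV2 ?posrE ?expR_gt0.
lra.
Qed.

(** Passing from the past of [c] to the future of [c'] loses only a bounded length. Travelling
    together for a unit of time prevents backtracking: seen from [c (- s)], the line [c'] goes from
    at most [s + 1 / 4] at time 0 to at least [s + 3 / 4] at time 1, and Stewart's formula on
    [[0, t]] at time 1 forces the growth to continue. *)
Lemma opposite_ends_dist c c' s t : line c -> line c' ->
  mdist (c 0) (c' 0) <= 1 / 4 -> mdist (c 1) (c' 1) <= 1 / 4 -> 0 <= s -> 1 <= t ->
  expR (s + t) <= 16 * sh 1 * ch (mdist (c (- s)) (c' t)).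
Proof.
move=> lc lc' h0 h1 s0 t1.
have iso := line_iso_on (a := 0) (b := t) lc'.
have t01 : 0 <= (1 : R) <= t by rewrite ler01.
have := stewart_on catX (c (- s)) iso t01; rewrite !subr0.
set D := ch (mdist _ (c' t)) => H.
have a1 : s + 3 / 4 <= mdist (c (- s)) (c' 1).
  have := metric_triangle (c (- s)) (c' 1) (c 1).
  rewrite lc [mdist (c' 1) _]metric_sym ler0_norm; lra.
have a0 : mdist (c (- s)) (c' 0) <= s + 1 / 4.
  apply: le_trans (metric_triangle _ (c 0) _) _.
  by rewrite lc subr0 normrN ger0_norm //; lra.
have b1 : expR s * expR (3 / 4) / 2 <= ch (mdist (c (- s)) (c' 1)).
  apply: le_trans (_ : ch (s + 3 / 4) <= _); last by apply: ler_ch => //; lra.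
  by have := expR_le_ch (s + 3 / 4); rewrite expRD; lra.
have b0 : ch (mdist (c (- s)) (c' 0)) <= expR s * expR (1 / 4).
  apply: le_trans (ch_le_expR (mdist_ge0 _ _)) _.
  by rewrite -expRD ler_expR.
have t0 : 0 <= t - 1 by lra.
have st : sh (t - 1) * expR 1 <= sh t.
  have -> : sh t = sh (t - 1) * ch 1 + ch (t - 1) * sh 1 by rewrite -shD subrK.
  have -> : expR 1 = ch 1 + sh 1 :> R by rewrite /ch /sh; field.
  rewrite mulrDr lerD2l ler_wpM2r ?sh_ge0 //.
  by rewrite /ch /sh; have := expR_ge0 (- (t - 1)); lra.
have st0 : 0 <= sh (t - 1) by exact: sh_ge0.
have stp : 0 <= sh t by rewrite sh_ge0 //; lra.
pose x : R := expR (1 / 4).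
have x0 : 5 / 4 <= x by have := expR_ge1Dx (1 / 4 : R); rewrite -/x; lra.
have xx : expR (3 / 4) * x = expR 1 :> R by rewrite -expRD; congr expR; field.
have y0 : 7 / 4 <= expR (3 / 4) :> R by have := expR_ge1Dx (3 / 4 : R); lra.
have es0 := expR_gt0 s.
have st2 : x * sh (t - 1) * expR (3 / 4) <= sh t.
  have -> : x * sh (t - 1) * expR (3 / 4) = sh (t - 1) * (expR (3 / 4) * x) by ring.
  by rewrite xx.
have H1 : expR s * (expR (3 / 4) / 2) * sh t <= expR s * x * sh (t - 1) + D * sh 1.
  have p1 := ler_wpM2r stp b1; have p2 := ler_wpM2r st0 b0.
  rewrite -/x in p2; lra.
have st3 : x * sh (t - 1) <= sh t * (4 / 7).
  have q : 0 <= x * sh (t - 1) by rewrite mulr_ge0 //; lra.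
  by have := ler_wpM2l q y0; lra.
have st4 := ler_wpM2l (ltW es0) st3.
have st5 : expR s * sh t * (7 / 8) <= expR s * (expR (3 / 4) / 2) * sh t.
  have q : 0 <= expR s * sh t by rewrite mulr_ge0 // ltW.
  have := ler_wpM2l q y0; lra.
(* The surplus [7 / 8 - 4 / 7] exceeds [1 / 4]; with [expR t <= 4 sh t] this produces the constant
   16. *)
have st6 : expR s * sh t * (1 / 4) <= D * sh 1.
  have q : 0 <= expR s * sh t by rewrite mulr_ge0 // ltW.
  lra.
have := ler_wpM2l (ltW es0) (expR_le_sh t1); rewrite -expRD; lra.
Qed.

End Brackets.

(** * Existence of brackets in a proper convex set *)

Section BracketExists.
Context (R : realType) (X : metricType R).
Hypothesis catX : CAT_m1 X.
Variable C : set X.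
Hypothesis convexC : convex_subset C.
Hypothesis properC : forall x r, C x -> compact (C `&` [set y | mdist x y <= r]).

(** Equal to [M + K + 1], where [K = 16 sh 1] controls the length defect of the long segments and
    [M = 8 (K expR (1 / 4) + 1)] their distance to [c' 0]. *)
Definition bracket_bound (R : realType) : R := 8 * (16 * sh 1 * expR (1 / 4) + 1) + 16 * sh 1 + 1.

Lemma bracket_exists c c' : line c -> line c' ->
  (forall s, C (c s)) -> (forall s, C (c' s)) ->
  mdist (c 0) (c' 0) <= 1 / 4 -> mdist (c 1) (c' 1) <= 1 / 4 ->
  exists w v, [/\ line w, forall s, C (w s), bracket_of c c' w v,
    mdist (w 0) (c' 0) <= bracket_bound R & `|v| <= bracket_bound R].
Proof.
move=> lc lc' Cc Cc' h0 h1.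
pose K : R := 16 * sh 1.
have sh1 : 0 < sh 1 :> R by exact: sh_gt0.
have K0 : 0 < K by exact: mulr_gt0.
pose x : R := expR (1 / 4).
have x0 : 0 < x by exact: expR_gt0.
pose L (n : nat) := mdist (c (- n%:R)) (c' n%:R).
have L_exp n : (0 < n)%N -> expR (2 * n%:R - L n) <= K.
  move=> n0; have n1 : 1 <= n%:R :> R by rewrite ler1n.
  have := opposite_ends_dist catX lc lc' h0 h1 (ler0n _ n) n1; rewrite -/(L n) -/K => H.
  have {}H : expR (n%:R + n%:R) <= K * expR (L n).
    apply: le_trans H _; rewrite ler_wpM2l ?(ltW K0) // ch_le_expR //; exact: mdist_ge0.
  rewrite expRD expRN -ler_pdivlMr ?invr_gt0 ?expR_gt0 // invrK.
  by rewrite (_ : 2 * n%:R = n%:R + n%:R) //; ring.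
have L_low n : (0 < n)%N -> 2 * n%:R - K <= L n.
  by move=> /L_exp; have := expR_ge1Dx (2 * n%:R - L n); lra.
have L_up n : L n <= 2 * n%:R + 1 / 4.
  have := metric_triangle (c (- n%:R)) (c 0) (c' n%:R).
  have := metric_triangle (c 0) (c' 0) (c' n%:R).
  by rewrite lc lc' sub0r subr0 !normrN !ger0_norm // /L; lra.
have [geo _] := catX.
have /choice[e eP] : forall n : nat, exists e, geodesic_segment mdist (c (- n%:R)) (c' n%:R) e.
  by move=> n; exact: geo.
(* Parametrized to reach [c' n] at time [n], hence synchronized with [c']. With respect to [c] the
   start is then off by [v n], whose limit is the time shift of the bracket. *)
pose m n t := e n (t + (L n - n%:R)).
pose v n := L n - 2 * n%:R.
pose big n := [/\ (0 < n)%N & K + 1 <= n%:R :> R].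
have big_iso n : big n -> iso_on (n%:R - L n) n%:R (m n).
  move=> [n0 nK] s t /andP[s1 s2] /andP[t1 t2]; rewrite /m.
  case: (eP n) => _ _; rewrite -/(L n) => ->.
  - by congr (`|_|); ring.
  - by apply/andP; split; lra.
  - by apply/andP; split; lra.
have mC n t : n%:R - L n <= t <= n%:R -> C (m n t).
  move=> /andP[t1 t2]; apply: (convexC (Cc (- n%:R)) (Cc' n%:R) (eP n)).
  by rewrite -/(L n); apply/andP; split; lra.
have m_end n : m n n%:R = c' n%:R.
  by rewrite /m subrKC; have [_ + _] := eP n.
have m_start n : m n (n%:R - L n) = c (- n%:R).
  have E : n%:R - L n + (L n - n%:R) = 0 by ring.
  by rewrite /m E; have [] := eP n.
pose M := 8 * (K * x + 1).
(* Both ends are at distance about [n] from [c' 0] while the length is about [2 n], so Stewart's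
   formula at time 0 leaves [ch d] bounded. The factor 8 comes from [expR (L n) <= 4 sh (L n)] and
   [expR d <= 2 ch d]. *)
have m0 n : big n -> mdist (c' 0) (m n 0) <= M.
  move=> bn; have [n0 nK] := bn; have Ll := L_low _ n0.
  have r0 : n%:R - L n <= 0 <= (n%:R : R) by apply/andP; split; lra.
  have := stewart_on catX (c' 0) (big_iso _ bn) r0.
  rewrite m_end m_start lc' sub0r normrN ger0_norm // subr0 subKr sub0r opprB.
  set d := mdist (c' 0) (m n 0) => H.
  have a1 : ch (mdist (c' 0) (c (- n%:R))) <= expR n%:R * x.
    apply: le_trans (ch_le_expR (mdist_ge0 _ _)) _; rewrite -expRD ler_expR.
    apply: le_trans (metric_triangle _ (c 0) _) _.
    by rewrite lc sub0r opprK ger0_norm // metric_sym addrC lerD2l.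
  have sn : 0 <= sh (n%:R : R) <= expR (n%:R : R) by rewrite sh_ge0 ?sh_le_expR.
  have sl : 0 <= sh (L n - n%:R) <= expR (L n - n%:R).
    by rewrite sh_le_expR andbT sh_ge0 //; lra.
  have cn : 0 <= ch (n%:R : R) <= expR (n%:R : R) by rewrite ltW ?ch_gt0 // ch_le_expR.
  have hL : expR (L n) <= 4 * sh (L n) by apply: expR_le_sh; lra.
  have q1 : ch (mdist (c' 0) (c (- n%:R))) * sh n%:R <= expR n%:R * x * expR n%:R.
    by case/andP: sn => ? ?; apply: ler_pM => //; exact: ltW (ch_gt0 _).
  have q2 : ch n%:R * sh (L n - n%:R) <= expR (L n).
    case/andP: sl => ? ?; case/andP: cn => ? ?.
    apply: le_trans (_ : expR n%:R * expR (L n - n%:R) <= _); first exact: ler_pM.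
    by rewrite -expRD subrKC.
  have q3 : expR n%:R * x * expR n%:R <= K * x * expR (L n).
    have := ler_wpM2r (expR_ge0 (L n)) (L_exp _ n0); rewrite -expRD subrK => q.
    rewrite mulrAC -expRD (_ : n%:R + n%:R = 2 * n%:R); last by ring.
    by rewrite [leRHS]mulrAC ler_wpM2r // ltW.
  have chd : ch d <= 4 * (K * x + 1).
    rewrite -(ler_pM2r (expR_gt0 (L n))).
    by have := ler_wpM2l (ltW (ch_gt0 d)) hL; lra.
  have := expR_le_ch d; have := expR_ge1Dx d; rewrite /M; lra.
have M0 : 0 <= M by rewrite mulr_ge0 // addr_ge0 // mulr_ge0 ?(ltW K0) ?(ltW x0).
pose B := M + K + 1.
have BE : bracket_bound R = B by rewrite /bracket_bound /B /M /K /x.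
have vB n : big n -> `|v n| <= K + 1 / 4.
  move=> [n0 _]; have := L_low _ n0; have := L_up n.
  by rewrite /v ler_norml => ? ?; apply/andP; split; lra.
have [F [UF sF]] := @ultraFilterLemma nat \oo _.
have Fbig (N : R) : F [set n | big n /\ N <= n%:R].
  apply: sF; exists (Num.truncn `|Num.max (K + 1) N|).+1 => // n /= n0.
  have nn : Num.max (K + 1) N <= n%:R.
    apply: le_trans (ler_norm _) _; apply/ltW; apply: lt_le_trans (truncnS_gt _) _.
    by rewrite ler_nat.
  move: nn; rewrite ge_max => /andP[n1 n2]; split=> //; split=> //.
  exact: leq_trans n0.
have [v0 v0B Fv] : exists2 v0, `|v0| <= K + 1 / 4 & forall U, nbhs v0 U -> F (v @^-1` U).
  have cv : F (v @^-1` `[- (K + 1/4), K + 1/4]%classic).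
    by apply: filterS (Fbig 0) => n [/vB]; rewrite ler_norml /= in_itv.
  have [p + H] := ultra_compact_lim UF (@segment_compact _ _ _) cv.
  by rewrite /= in_itv /= -ler_norml => ?; exists p.
have [w [lw Cw Fw]] : exists w, [/\ line w, forall s, C (w s) &
    forall s e, 0 < e -> F [set n | mdist (m n s) (w s) < e]].
  apply: (@line_limit _ _ _ F m C (c' 0) M UF).
  - by move=> r; exact: properC.
  - move=> s; apply: filterS (Fbig (`|s| + K + 1)) => n [bn ns]; have [n0 _] := bn.
    have r0 : n%:R - L n <= s <= n%:R.
      have := L_low _ n0; have := ler_norm s; have := ler_norm (- s).
      by rewrite normrN => *; apply/andP; split; lra.
    split; first exact: mC.
    apply: le_trans (metric_triangle _ (m n 0) _) _; apply: lerD; first exact: m0.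
    rewrite (big_iso _ bn) // ?sub0r ?normrN //.
    by have := L_low _ n0; have := normr_ge0 s => *; apply/andP; split; lra.
  - move=> s t; apply: filterS (Fbig (`|s| + `|t| + K + 1)) => n [bn ns] /=; have [n0 _] := bn.
    have := L_low _ n0; have := ler_norm s; have := ler_norm (- s).
    have := ler_norm t; have := ler_norm (- t).
    by rewrite !normrN => *; apply: big_iso => //; apply/andP; split; lra.
have dwc : mdist (w 0) (c' 0) <= M.
  apply/ler_addgt0Pl => r r0.
  have [n [/= n1 [bn _]]] := filter_exI _ (Fw 0 r r0) (Fbig 0).
  have q1 := metric_triangle (w 0) (m n 0) (c' 0); have q2 := m0 _ bn.
  rewrite [mdist (w 0) (m n 0)]metric_sym in q1.
  by rewrite [mdist (c' 0) _]metric_sym in q2; lra.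
exists w, v0; rewrite BE; split=> //; last 2 first.
- by rewrite /B; lra.
- by rewrite /B; lra.
split.
(* The segment and [c'] meet at [c' n], so [isosceles] makes them approach each other at a rate
   independent of [n]. *)
- apply: (@strongly_asymptotic_exp _ _ (M * expR M)) => t t0.
  apply/ler_addgt0Pl => r r0.
  have [n [/= n1 [bn nt]]] := filter_exI _ (Fw t r r0) (Fbig (t + 1)).
  have [n0 nK] := bn; have Ll := L_low _ n0.
  apply: le_trans (metric_triangle _ (m n t) _) _; rewrite metric_sym.
  apply: lerD; first exact: ltW.
  have i1 : iso_on 0 n%:R (m n) by apply: iso_on_sub (big_iso _ bn) => //; lra.
  have i2 : iso_on 0 n%:R c' by exact: line_iso_on.
  have n00 : 0 < n%:R :> R by rewrite ltr0n.
  have tn : 0 <= t <= n%:R by apply/andP; split; lra.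
  have := isosceles catX i1 i2 (m_end n) n00 tn => /ch_decay H.
  have y := m0 _ bn; rewrite metric_sym in y.
  apply: le_trans (H _ (mdist_ge0 _ _) (mdist_ge0 _ _)) _.
    by rewrite expR_ge0 expR_le1 oppr_le0.
  rewrite -mulrA mulrC ler_wpM2r ?expR_ge0 //.
  by apply: ler_pM; rewrite ?mdist_ge0 ?expR_ge0 // ler_expR.
(* Backward the apex is [c (- n)], reached at time [L n - n] by the reversed segment and by [c]
   shifted by [v n]; replacing [v n] by its limit costs [r / 2]. *)
- apply: (@strongly_asymptotic_exp _ _ (B * expR B)) => t t0.
  apply/ler_addgt0Pl => r r0.
  have r2 : 0 < r / 2 by exact: divr_gt0.
  have [n [/= n1 n2 [bn nt]]] :=
    filter_exI3 _ (Fw (- t) _ r2) (Fv _ (nbhsx_ballx v0 _ r2)) (Fbig (t + K + 1)).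
  have [n0 nK] := bn; have Ll := L_low _ n0; have Lu := L_up n.
  rewrite /reverse.
  apply: le_trans (metric_triangle _ (m n (- t)) _) _.
  have n3 : mdist (c (- t + v n)) (shift v0 c (- t)) <= r / 2.
    rewrite /shift lc (_ : _ - _ = v n - v0); last by ring.
    by rewrite distrC ltW.
  suff n4 : mdist (m n (- t)) (c (- t + v n)) <= B * expR B * expR (- t).
    have q := metric_triangle (m n (- t)) (c (- t + v n)) (shift v0 c (- t)).
    by rewrite [mdist (w _) _]metric_sym; lra.
  have i1 : iso_on 0 (L n - n%:R) (fun s => m n (- s)).
    have := iso_on_rev (big_iso _ bn); rewrite opprB.
    by apply: iso_on_sub => //; rewrite oppr_le0.
  have i2 : iso_on 0 (L n - n%:R) (fun s => c (- s + v n)).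
    by apply: line_iso_on => s s'; rewrite lc -normrN; congr (`|_|); ring.
  have E : m n (- (L n - n%:R)) = c (- (L n - n%:R) + v n).
    by rewrite opprB m_start; congr c; rewrite /v; ring.
  have n00 : 0 < L n - n%:R by lra.
  have tn : 0 <= t <= L n - n%:R by apply/andP; split; lra.
  have := isosceles catX i1 i2 E n00 tn => /ch_decay H.
  have y : mdist (m n (- 0)) (c (- 0 + v n)) <= B.
    rewrite oppr0 add0r.
    have q1 := metric_triangle (m n 0) (c' 0) (c (v n)).
    have q2 := metric_triangle (c' 0) (c 0) (c (v n)).
    have q3 := vB _ bn; have q4 := m0 _ bn.
    rewrite lc sub0r normrN [mdist (c' 0) (c 0)]metric_sym in q2.
    by rewrite metric_sym in q4; rewrite /B; lra.
  apply: le_trans (H _ (mdist_ge0 _ _) (mdist_ge0 _ _)) _.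
    by rewrite expR_ge0 expR_le1 oppr_le0.
  rewrite -mulrA mulrC ler_wpM2r ?expR_ge0 //.
  by apply: ler_pM; rewrite ?mdist_ge0 ?expR_ge0 // ler_expR.
Qed.

End BracketExists.

(** * Quantitative continuity of brackets *)

Section BracketContinuity.
Context (R : realType) (X : metricType R).
Hypothesis catX : CAT_m1 X.
Implicit Types (c d l w W : R -> X) (s t v V T theta K eta : R).

(** The a priori bounds that make the convergence of [w] to both of its ends uniform. *)
Definition bracket_within K c c' w v :=
  [/\ bracket_of c c' w v, `|v| <= K, mdist (w 0) (c' 0) <= K & mdist (w 0) (c v) <= K].

Lemma bracket_within_forward K c c' w v s : line c' -> line w ->
  bracket_within K c c' w v -> 0 <= s ->
  mdist (w s) (c' s) <= K * expR K * expR (- s).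
Proof.
move=> lc' lw [[H _] _ wK _] s0.
apply: le_trans (strongly_asymptotic_decay catX lw lc' H s0) _.
rewrite -mulrA mulrC ler_wpM2r ?expR_ge0 //.
by apply: ler_pM; rewrite ?mdist_ge0 ?expR_ge0 // ler_expR.
Qed.

Lemma bracket_within_backward K c c' w v s : line c -> line w ->
  bracket_within K c c' w v -> 0 <= s ->
  mdist (w (- s)) (c (- s + v)) <= K * expR K * expR (- s).
Proof.
move=> lc lw [[_ H] _ _ wK] s0.
have lr := line_rev lw; have lr' := line_rev (line_shift v lc).
apply: le_trans (strongly_asymptotic_decay catX lr lr' H s0) _.
rewrite /reverse /shift oppr0 add0r -mulrA mulrC ler_wpM2r ?expR_ge0 //.
by apply: ler_pM; rewrite ?mdist_ge0 ?expR_ge0 // ler_expR.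
Qed.

(** On the time windows [[t, 3 t]] and [[- 3 t, - t]] each bracket follows its own data, so [w] and
    [W] are close there, up to the shift [v - V] in the past. Comparing chords across the gap bounds
    this shift, and convexity with step [2 t] covers [[- t, t]]. The factor [expR (2 K)] and the
    range [3 t + K] pay for the shifts [v] and [V]. *)
Lemma bracket_near K t theta c c' w v d d' W V :
  line c -> line c' -> line w -> line d -> line d' -> line W ->
  bracket_within K c c' w v -> bracket_within K d d' W V ->
  0 <= theta -> 2 * K <= t ->
  (forall s, `|s| <= 3 * t + K -> mdist (c s) (d s) <= theta) ->
  (forall s, `|s| <= 3 * t + K -> mdist (c' s) (d' s) <= theta) ->
  let E := 2 * K * expR K * expR (2 * K) * expR (- t) + theta in
  `|v - V| <= 2 * E /\ geodesic_dist w W <= 3 * E + 4 * expR (- t).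
Proof.
move=> lc lc' lw ld ld' lW bw bW th0 Kt Hc Hc' E.
have [_ vK _ _] := bw; have [_ VK _ _] := bW.
have K0 : 0 <= K by exact: le_trans (normr_ge0 _) vK.
have t0 : 0 <= t by lra.
pose B := K * expR K.
have B0 : 0 <= B by rewrite mulr_ge0 ?expR_ge0.
have e2K : 1 <= expR (2 * K) by rewrite -[leLHS]expR0 ler_expR; lra.
have BE0 : B * expR (- t) <= B * expR (2 * K) * expR (- t).
  by rewrite ler_wpM2r ?expR_ge0 // ler_peMr.
have BE : E = 2 * (B * expR (2 * K) * expR (- t)) + theta by rewrite /E /B; ring.
have fwd s : t <= s -> s <= 3 * t -> mdist (w s) (W s) <= E.
  move=> ts st; have s0 : 0 <= s by lra.
  have h1 := bracket_within_forward lc' lw bw s0.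
  have h2 := bracket_within_forward ld' lW bW s0.
  have h3 : mdist (c' s) (d' s) <= theta by apply: Hc'; rewrite ger0_norm //; lra.
  have h4 : B * expR (- s) <= B * expR (- t) by rewrite ler_wpM2l // ler_expR lerN2.
  have := metric_triangle (w s) (c' s) (W s).
  have := metric_triangle (c' s) (d' s) (W s).
  rewrite [mdist (d' s) (W s)]metric_sym; rewrite -/B in h1 h2; lra.
have bwd s : t <= s -> s <= 3 * t -> mdist (w (- s)) (W (- s + (v - V))) <= E.
  move=> ts st; have s0 : 0 <= s by lra.
  have v1 : - K <= v /\ v <= K by apply/andP; rewrite -ler_norml.
  have V1 : - K <= V /\ V <= K by apply/andP; rewrite -ler_norml.
  have h1 := bracket_within_backward lc lw bw s0.
  have s'0 : 0 <= s - v + V by lra.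
  have h2 := bracket_within_backward ld lW bW s'0.
  rewrite (_ : - (s - v + V) + V = - s + v) in h2; last by ring.
  rewrite (_ : - (s - v + V) = - s + (v - V)) in h2; last by ring.
  have h3 : mdist (c (- s + v)) (d (- s + v)) <= theta.
    by apply: Hc; rewrite ler_norml; apply/andP; split; lra.
  have h4 : B * expR (- s) <= B * expR (- t) by rewrite ler_wpM2l // ler_expR lerN2.
  have h5 : B * expR (- s + (v - V)) <= B * expR (2 * K) * expR (- t).
    rewrite -mulrA -expRD ler_wpM2l // ler_expR; lra.
  have := metric_triangle (w (- s)) (c (- s + v)) (W (- s + (v - V))).
  have := metric_triangle (c (- s + v)) (d (- s + v)) (W (- s + (v - V))).
  rewrite [mdist (d _) (W _)]metric_sym; rewrite -/B in h1 h2; lra.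
have E0 : 0 <= E by apply: le_trans (mdist_ge0 _ _) (fwd t (lexx _) _); lra.
have vV : `|v - V| <= 2 * E.
  have t3 : t <= 3 * t by lra.
  have h1 := fwd t (lexx _) t3; have h2 := bwd t (lexx _) t3.
  have q1 := metric_triangle (w (- t)) (W (- t + (v - V))) (w t).
  have q2 := metric_triangle (W (- t + (v - V))) (W t) (w t).
  have q3 := metric_triangle (W (- t + (v - V))) (w (- t)) (W t).
  have q4 := metric_triangle (w (- t)) (w t) (W t).
  rewrite [mdist (W t) (w t)]metric_sym in q2.
  rewrite [mdist (W (- t + (v - V))) (w (- t))]metric_sym in q3.
  have E1 : mdist (w (- t)) (w t) = 2 * t.
    by rewrite lw distrC opprK ger0_norm; lra.
  have v1 : - K <= v /\ v <= K by apply/andP; rewrite -ler_norml.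
  have V1 : - K <= V /\ V <= K by apply/andP; rewrite -ler_norml.
  have E2 : mdist (W (- t + (v - V))) (W t) = 2 * t - (v - V).
    by rewrite lW distrC ger0_norm; lra.
  rewrite ?E1 ?E2 in q1 q2 q3 q4.
  by rewrite ler_norml; apply/andP; split; lra.
split=> //; apply: geodesic_dist_small => //; first by rewrite mulr_ge0.
move=> s; rewrite ler_norml => /andP[s1 s2].
have h1 : mdist (w (s + 2 * t)) (W (s + 2 * t)) <= E by apply: fwd; lra.
have h2 : mdist (w (s - 2 * t)) (W (s - 2 * t)) <= 3 * E.
  have := bwd (2 * t - s); rewrite opprB => h.
  have {}h : mdist (w (s - 2 * t)) (W (s - 2 * t + (v - V))) <= E by apply: h; lra.
  have := metric_triangle (w (s - 2 * t)) (W (s - 2 * t + (v - V))) (W (s - 2 * t)).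
  have E' : s - 2 * t + (v - V) - (s - 2 * t) = v - V by ring.
  by rewrite lW E'; lra.
by have := dist_convex catX (2 * t) s lw lW; lra.
Qed.

Lemma bracket_near_eps K eta : 0 <= K -> 0 < eta ->
  exists2 r, 0 < r & forall c c' w v d d' W V,
  line c -> line c' -> line w -> line d -> line d' -> line W ->
  bracket_within K c c' w v -> bracket_within K d d' W V ->
  geodesic_dist c d < r -> geodesic_dist c' d' < r ->
  `|v - V| <= eta /\ geodesic_dist w W <= eta.
Proof.
move=> K0 eta0.
pose B := 2 * K * expR K * expR (2 * K).
have B0 : 0 <= B by rewrite !mulr_ge0 ?expR_ge0.
(* With [theta = eta / 6], the bound [3 E + 4 expR (- t)] is [(3 B + 4) expR (- t) + eta / 2]. *)
have e0 : 0 < eta / (2 * (3 * B + 4)) by rewrite divr_gt0 // mulr_gt0 //; lra.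
have [T0 _ HT] := expRN_small e0.
pose t := Num.max T0 (2 * K).
have tT : T0 <= t by rewrite le_max lexx.
have tK : 2 * K <= t by rewrite le_max lexx orbT.
have et : expR (- t) * (3 * B + 4) <= eta / 2.
  have q : 0 < 3 * B + 4 by lra.
  rewrite -ler_pdivlMr //; apply: le_trans (HT _ tT) _.
  by rewrite invfM mulrA.
exists (eta / 6 * expR (- (2 * (3 * t + K)))).
  by rewrite mulr_gt0 ?expR_gt0 // divr_gt0.
move=> c c' w v d d' W V lc lc' lw ld ld' lW bw bW cd cd'.
have near l l' : line l -> line l' ->
  geodesic_dist l l' < eta / 6 * expR (- (2 * (3 * t + K))) ->
  forall s, `|s| <= 3 * t + K -> mdist (l s) (l' s) <= eta / 6.
  move=> ll ll' ldl s sb; apply: le_trans (dist_le_geodesic_dist catX s ll ll') _.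
  apply: le_trans (ler_wpM2l (expR_ge0 _) (ltW ldl)) _.
  rewrite mulrCA ler_piMr ?divr_ge0 ?(ltW eta0) // -expRD expR_le1; lra.
have eta6 : 0 <= eta / 6 by rewrite divr_ge0 // ltW.
have := bracket_near lc lc' lw ld ld' lW bw bW eta6 tK (near _ _ lc ld cd) (near _ _ lc' ld' cd').
rewrite /= -/B.
have := mulr_ge0 B0 (expR_ge0 (- t)); have := expR_ge0 (- t).
move=> p1 p2 [h1 h2]; split; [apply: le_trans h1 _|apply: le_trans h2 _]; lra.
Qed.

End BracketContinuity.

Section BracketModulus.
Context (R : realType) (X : metricType R).
Hypothesis catX : CAT_m1 X.
Variable C : set X.
Hypothesis convexC : convex_subset C.
Hypothesis properC : forall x r, C x -> compact (C `&` [set y | mdist x y <= r]).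
Implicit Types (c d l w W : R -> X) (v V K eta r : R).

Definition line_in c := line c /\ forall s, C (c s).

Lemma bracket_exists_near : exists K r, [/\ 0 <= K, 0 < r &
  forall c c', line_in c -> line_in c' -> geodesic_dist c c' < r ->
  exists w v, line_in w /\ bracket_within K c c' w v].
Proof.
pose B := bracket_bound R.
have B0 : 0 <= B.
  have s0 : 0 <= sh 1 :> R by exact: sh_ge0.
  have := mulr_ge0 s0 (expR_ge0 (1 / 4)); rewrite /B /bracket_bound; lra.
exists (2 * B + 1), (expR (- 2) / 4); split.
- by lra.
- by rewrite divr_gt0 ?expR_gt0.
move=> c c' [lc Cc] [lc' Cc'] cc'.
have near s : 0 <= s <= 1 -> mdist (c s) (c' s) <= 1 / 4.
  move=> /andP[s0 s1]; apply: le_trans (dist_le_geodesic_dist catX s lc lc') _.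
  apply: le_trans (ler_wpM2l (expR_ge0 _) (ltW cc')) _.
  rewrite mulrA -expRD ler_pM2r // expR_le1 ger0_norm //; lra.
have h0 : mdist (c 0) (c' 0) <= 1 / 4 by apply: near; rewrite lexx ler01.
have h1 : mdist (c 1) (c' 1) <= 1 / 4 by apply: near; rewrite lexx ler01.
have [w [v [lw Cw bw wB vB]]] := bracket_exists catX convexC properC lc lc' Cc Cc' h0 h1.
exists w, v; split=> //; split=> //; rewrite -/B in wB vB; try lra.
have := metric_triangle (w 0) (c' 0) (c v); have := metric_triangle (c' 0) (c 0) (c v).
by rewrite lc sub0r normrN [mdist (c' 0) (c 0)]metric_sym; lra.
Qed.

(** Compare the bracket of [c] and [c'] with that of [c'] and [c'], which is [c'] itself with shift
    0. *)
Lemma bracket_modulus eta : 0 < eta -> exists2 r, 0 < r & forall c c',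
  line_in c -> line_in c' -> geodesic_dist c c' < r ->
  exists w v, [/\ line_in w, bracket_of c c' w v, `|v| <= eta & [/\
    geodesic_dist w c <= eta, geodesic_dist w c' <= eta &
    geodesic_dist w (shift v c) <= eta]].
Proof.
move=> eta0; have [K [r0 [K0 r00 H]]] := bracket_exists_near.
have eta3 : 0 < eta / 3 by exact: divr_gt0.
have [r1 r10 H1] := bracket_near_eps catX K0 eta3.
exists (Num.min (Num.min r0 r1) (eta / 3)); first by rewrite !lt_min r00 r10.
move=> c c' ic ic'; rewrite !lt_min => /andP[/andP[cr0 cr1] cre].
have [w [v [iw bw]]] := H _ _ ic ic' cr0.
have [[[lc _] [lc' _]] [lw _]] := (ic, ic', iw).
have bc' : bracket_within K c' c' c' 0.
  by split; [exact: bracket_of_self|rewrite normr0|rewrite mdistxx|rewrite mdistxx].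
have c'r : geodesic_dist c' c' < r1 by rewrite geodesic_distxx.
have [h1 h2] := H1 _ _ _ _ _ _ _ _ lc lc' lw lc' lc' lc' bw bc' cr1 c'r.
rewrite subr0 in h1.
have h3 : geodesic_dist w c <= eta / 3 + eta / 3.
  have := geodesic_dist_triangle lw lc' lc; rewrite [geodesic_dist c' c]geodesic_distC; lra.
have h4 : geodesic_dist w (shift v c) <= eta.
  have := geodesic_dist_triangle lw lc (line_shift v lc).
  by rewrite geodesic_dist_shift //; lra.
by exists w, v; split; [|case: bw|lra|split; lra].
Qed.

(** By uniqueness, arbitrary brackets of pairs closer than [r0] are those of [bracket_exists_near],
    hence share one bound [K]. That [r0] does not depend on [eta] allows a single bracket domain. *)
Lemma bracket_continuous : exists2 r0, 0 < r0 & forall eta, 0 < eta ->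
  exists2 r, 0 < r & forall c c' w v d d' W V,
  line_in c -> line_in c' -> line_in d -> line_in d' -> line w -> line W ->
  bracket_of c c' w v -> bracket_of d d' W V ->
  geodesic_dist c c' < r0 -> geodesic_dist d d' < r0 ->
  geodesic_dist c d < r -> geodesic_dist c' d' < r ->
  `|v - V| <= eta /\ geodesic_dist w W <= eta.
Proof.
have [K [r0 [K0 r00 H]]] := bracket_exists_near.
exists r0 => // eta eta0; have [r r_gt0 Hr] := bracket_near_eps catX K0 eta0.
exists r => // c c' w v d d' W V ic ic' id id' lw lW bw bW cc' dd' cd cd'.
have [w1 [v1 [[lw1 _] bw1]]] := H _ _ ic ic' cc'.
have [W1 [V1 [[lW1 _] bW1]]] := H _ _ id id' dd'.
have [bw1' _ _ _] := bw1; have [bW1' _ _ _] := bW1.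
have [ew ev] := bracket_of_unique catX lw lw1 bw bw1'.
have [eW eV] := bracket_of_unique catX lW lW1 bW bW1'.
case: ic ic' id id' => lc _ [lc' _] [ld _] [ld' _].
by apply: (Hr c c' w v d d' W V) => //; rewrite ?ew ?ev ?eW ?eV.
Qed.

End BracketModulus.
(** * Cocompact actions *)

Section Cocompact.
Context (R : realType) (G : groupType) (X : metricType R).
Variable a : isometric_action G X.
Implicit Types (x y z : X) (g h : G) (r e : R).

Lemma act_inv g x : a g^-1%g (a g x) = x.
Proof. by rewrite -actM mulVg act1. Qed.

Lemma act_dist_inv g x y : mdist (a g x) y = mdist x (a g^-1%g y).
Proof. by rewrite -(act_isometry a g^-1%g) act_inv. Qed.

Lemma projP x y : proj a x = proj a y <-> exists g, a g x = y.
Proof.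
split; first by move=> /eqmodP/asboolP.
by move=> H; apply/eqmodP/asboolP.
Qed.

Lemma proj_act g x : proj a (a g x) = proj a x.
Proof. by apply/esym/projP; exists g. Qed.

Lemma proj_surj (p : orbit_space a) : exists x, proj a x = p.
Proof. by exists (repr (p : {eq_quot (orbit_equiv a)})); exact: reprK. Qed.

Lemma nbhs_ball_dist x r : 0 < r -> nbhs x [set y | mdist x y < r].
Proof. by move=> r0; rewrite -ballEmdist; exact: nbhsx_ballx. Qed.

(** Balls project to neighbourhoods, so a limit in the quotient topology lifts, up to the group, to
    a limit for the metric. This is how compactness of [C / G] is exploited. *)
Lemma proj_ball_nbhs x r : 0 < r ->
  nbhs (proj a x) [set p | exists2 y, proj a y = p & mdist x y < r].
Proof.
move=> r0; set U := [set p | _].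
have oU : open (proj a @^-1` U).
  rewrite openE => y [z /projP[g <-] xz] /=; rewrite /interior /=.
  have d0 : 0 < r - mdist x z by rewrite subr_gt0.
  apply: filterS (nbhs_ball_dist (a g z) d0) => t /= zt.
  exists (a g^-1%g t); first exact: proj_act.
  by apply: le_lt_trans (metric_triangle _ z _) _; rewrite addrC -ltrBrDr -act_dist_inv.
by apply: (@open_nbhs_nbhs (orbit_space a)); split; [exact: oU|exists x; rewrite ?mdistxx].
Qed.

Lemma compact_metric (A : set X) :
  (forall F : set_system X, UltraFilter F -> F A ->
     exists2 p, A p & forall e, 0 < e -> F [set z | mdist z p < e]) -> compact A.
Proof.
move=> H; rewrite compact_ultra => F UF FA; have [p Ap Fp] := H F UF FA.
exists p; split=> // U /nbhs_ballP[e /= e0 eU]; apply: filterS (Fp e e0) => z /= h.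
by apply: eU; rewrite ballEmdist /= metric_sym.
Qed.

(** A convergent sequence with its limit: the compact set to which [orbit_discrete] applies proper
    discontinuity. *)
Lemma compact_sequence (u : nat -> X) x : (forall n, mdist x (u n) < n.+1%:R^-1) ->
  compact [set y | y = x \/ exists n, u n = y].
Proof.
move=> H; set K := [set y | _]; move=> F PF FK.
have [cx|ncx] := pselect (cluster F x); first by exists x; split=> //; left.
have [A [B [FA xB AB]]] : exists A B, [/\ F A, nbhs x B & ~ (A `&` B !=set0)].
  apply: contrapT => nH; apply: ncx => A B FA xB; apply: contrapT => nAB.
  by apply: nH; exists A, B.
move: xB => /nbhs_ballP[e /= e0 eB].
have [N Ne] : exists N, forall n, (N <= n)%N -> n.+1%:R^-1 <= e.
  exists (Num.truncn e^-1) => n Nn.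
  rewrite -[e]invrK lef_pV2 ?posrE ?ltr0n ?invr_gt0 //.
  by apply/ltW; apply: lt_le_trans (truncnS_gt _) _; rewrite ler_nat ltnS.
have FI : F (u @` `I_N).
  apply: filterS (filterI FA FK) => y [Ay [yx|[n un]]].
    by exfalso; apply: AB; exists y; split=> //; apply: eB; rewrite yx; exact: ballxx.
  exists n => //=; rewrite ltnNge; apply/negP => Nn.
  apply: AB; exists y; split=> //; apply: eB; rewrite ballEmdist /= -un.
  exact: lt_le_trans (H n) (Ne _ Nn).
have cI : compact (u @` `I_N) by exact/finite_compact/finite_image/finite_II.
have [y [[n _ <-] cy]] := cI F PF FI.
by exists (u n); split=> //; right; exists n.
Qed.

Hypothesis freeG : free_action a.
Hypothesis pdG : properly_discontinuous a.

(** Otherwise some points [a (u n) x] tend to [x]. Together with [x] they form a compact set meeting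
    its image under every [u n], so finitely many elements occur, and freeness gives their
    displacements a positive minimum. *)
Lemma orbit_discrete x : exists2 e, 0 < e & forall g, g <> 1%g -> e <= mdist x (a g x).
Proof.
apply: contrapT => nH.
have /choice[u uP] : forall n : nat, exists g, g <> 1%g /\ mdist x (a g x) < n.+1%:R^-1.
  move=> n; apply: contrapT => nn; apply: nH; exists n.+1%:R^-1 => // g g1.
  by rewrite leNgt; apply/negP => h; apply: nn; exists g.
have cK := @compact_sequence (fun n => a (u n) x) x (fun n => (uP n).2).
have /finite_seqP[s sE] := pdG cK.
have us n : u n \in s.
  have : [set` s] (u n) by rewrite -sE; exists (a (u n) x); split; [exists x => //; left|right; exists n].
  by [].
have [e e0 es] : exists2 e, 0 < e & forall g, g \in s -> g <> 1%g -> e <= mdist x (a g x).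
  elim: s {sE us} => [|g s [e e0 es]]; first by exists 1.
  have [g1|g1] := pselect (g = 1%g).
    by exists e => // h; rewrite inE => /orP[/eqP -> //|hs h1]; exact: es.
  exists (Num.min e (mdist x (a g x))).
    by rewrite lt_min e0 /= mdist_gt0; apply/eqP => h; apply: g1; apply: (freeG (esym h)).
  move=> h; rewrite inE ge_min => /orP[/eqP -> _|hs h1]; first by rewrite lexx orbT.
  by rewrite es.
pose n := Num.truncn e^-1.
have := es _ (us n) (uP n).1; rewrite leNgt => /negP; apply.
apply: lt_trans (uP n).2 _; rewrite -[ltRHS]invrK ltf_pV2 ?posrE ?ltr0n ?invr_gt0 //.
exact: truncnS_gt.
Qed.

Variable C : set X.
Hypothesis convexC : convex_subset C.
Hypothesis invC : forall g x, C x -> C (a g x).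
Hypothesis compactC : compact (proj a @` C).

(** Points with displacement tending to 0 accumulate, modulo [G], at some [y]. Moving them near [y]
    replaces [g] by a conjugate with the same displacement, which contradicts [orbit_discrete] at
    [y]. *)
Lemma displacement_bound :
  exists2 e, 0 < e & forall x g, C x -> g <> 1%g -> e <= mdist x (a g x).
Proof.
apply: contrapT => nH.
have /choice[u uP] : forall n : nat, exists p : X * G,
    [/\ C p.1, p.2 <> 1%g & mdist p.1 (a p.2 p.1) < n.+1%:R^-1].
  move=> n; apply: contrapT => nn; apply: nH; exists n.+1%:R^-1 => // x g Cx g1.
  by rewrite leNgt; apply/negP => h; apply: nn; exists (x, g).
have [F [UF sF]] := @ultraFilterLemma nat \oo _.
have FC : F ((fun n => proj a (u n).1) @^-1` (proj a @` C)).
  by apply: filterS filterT => n _ /=; exists (u n).1 => //; have [] := uP n.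
have [_ [y Cy <-] H] := ultra_compact_lim UF compactC FC.
have [e e0 ye] := orbit_discrete y.
have e3 : 0 < e / 3 by exact: divr_gt0.
have Fn : F [set n | n.+1%:R^-1 < e / 3].
  apply: sF; exists (Num.truncn (e / 3)^-1) => // n /= nn.
  rewrite -[ltRHS]invrK ltf_pV2 ?posrE ?ltr0n ?invr_gt0 //.
  by apply: lt_le_trans (truncnS_gt _) _; rewrite ler_nat ltnS.
have [n [/= [z zE yz] ne]] := filter_exI _ (H _ (proj_ball_nbhs y e3)) Fn.
have /projP[h hz] := esym zE.
have [_ g1 dg] := uP n; set g := (u n).2 in g1 dg; set x := (u n).1 in hz dg.
have k1 : (h * g * h^-1)%g <> 1%g.
  move=> E; apply: g1; have : (h^-1 * (h * g * h^-1) * h = h^-1 * 1 * h)%g by rewrite E.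
  by rewrite !mulgA mulVg mul1g -mulgA mulVg mulg1 mulg1 mulVg.
have := ye _ k1; rewrite leNgt => /negP; apply.
have d1 : mdist z (a (h * g * h^-1)%g z) < e / 3.
  rewrite -hz !actM act_inv act_isometry; exact: lt_trans dg ne.
apply: le_lt_trans (metric_triangle _ z _) _.
have := metric_triangle z (a (h * g * h^-1)%g z) (a (h * g * h^-1)%g y).
by rewrite act_isometry [mdist z y]metric_sym; lra.
Qed.

(** In a ball small compared with the displacement bound, only one group element can bring points
    near a given [y]. Convergence of orbits is then convergence of points. *)
Lemma locally_compact_hull :
  exists2 r, 0 < r & forall x, C x -> compact (C `&` [set y | mdist x y <= r]).
Proof.
have [i i0 iC] := displacement_bound.
pose r := i / 8; have r0 : 0 < r by exact: divr_gt0.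
exists r => // x Cx; apply: compact_metric => F UF FB.
have FC : F (proj a @^-1` (proj a @` C)).
  by apply: filterS FB => z [Cz _]; exists z.
have [_ [y Cy <-] H] := ultra_compact_lim UF compactC FC.
have FB' e : 0 < e -> F [set z | exists g, mdist y (a g z) < e].
  move=> e0; apply: filterS (H _ (proj_ball_nbhs y e0)) => z [t /esym/projP[g <-] h].
  by exists g.
have [z1 [[Cz1 /= z1r] [g1 g1y]]] := filter_exI _ FB (FB' _ r0).
have near e : 0 < e -> e <= r -> F [set z | mdist z (a g1^-1%g y) < e].
  move=> e0 er; apply: filterS (filterI FB (FB' _ e0)) => z [[Cz /= zr] [g gy]].
  suff <- : g = g1 by rewrite metric_sym act_dist_inv invgK.
  apply: contrapT => gg1.
  have k1 : (g1 * g^-1)%g <> 1%g.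
    move=> E; apply: gg1; have : (g1 * g^-1 * g = 1 * g)%g by rewrite E.
    by rewrite mul1g -mulgA mulVg mulg1 => ->.
  have := iC _ _ Cy k1; rewrite actM leNgt => /negP; apply.
  have q1 := metric_triangle y (a g1 z1) (a g1 (a g^-1%g y)).
  have q2 := metric_triangle z1 x (a g^-1%g y).
  have q3 := metric_triangle x z (a g^-1%g y).
  rewrite act_isometry in q1; rewrite [mdist z1 x]metric_sym in q2.
  have q4 : mdist z (a g^-1%g y) < e by rewrite -act_dist_inv metric_sym.
  have rE : i = 8 * r by rewrite /r; field.
  lra.
exists (a g1^-1%g y); last first.
  move=> e e0; have [er|re] := leP e r; first exact: near.
  by apply: filterS (near _ r0 (lexx r)) => z /= h; exact: lt_trans re.
split; first exact: invC.
apply/ler_addgt0Pl => e e0.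
have m0 : 0 < Num.min e r by rewrite lt_min e0.
have mr : Num.min e r <= r by rewrite ge_min lexx orbT.
have [z [[Cz /= zr] /= ze]] := filter_exI _ FB (near _ m0 mr).
rewrite lt_min in ze; case/andP: ze => ze _.
by have := metric_triangle x z (a g1^-1%g y); lra.
Qed.

Hypothesis geoX : forall p q : X, exists c, geodesic_segment mdist p q c.

(** A Hopf-Rinow argument. Each point of the ball of radius [(n + 1) b] is within [b] of the ball of
    radius [n b], along a segment that stays in [C]; the limit of these nearby points is the centre
    of a compact ball of radius [r0 = 2 b]. *)
Lemma proper_hull x r : C x -> compact (C `&` [set y | mdist x y <= r]).
Proof.
move=> Cx; have [r0 r00 H] := locally_compact_hull.
pose b := r0 / 2; have b0 : 0 < b by exact: divr_gt0.
suff W n : compact (C `&` [set y | mdist x y <= n%:R * b]).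
  pose n := (Num.truncn (r / b)).+1.
  have rn : r <= n%:R * b by rewrite -ler_pdivrMr // ltW // truncnS_gt.
  apply: compact_metric => F UF FA.
  have FA' : F (id @^-1` (C `&` [set y | mdist x y <= n%:R * b])).
    by apply: filterS FA => z [Cz zr]; split=> //; exact: le_trans rn.
  have [p [Cp _] Fp] := ultra_compact_dist UF (W n) FA'.
  exists p => //; split=> //; apply/ler_addgt0Pl => e e0.
  have [z [[_ /= zr] /= ze]] := filter_exI _ FA (Fp _ e0).
  by have := metric_triangle x z p; lra.
elim: n => [|n IH].
  have -> : C `&` [set y | mdist x y <= 0%:R * b] = [set x].
    apply/seteqP; split=> [y [_ /=]|y ->]; last by rewrite /= mul0r mdistxx.
    rewrite mul0r => h; apply/esym/mdist_positivity/le_anti.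
    by rewrite h mdist_ge0.
  exact: compact_set1.
apply: compact_metric => F UF FA.
have nb : 0 <= n%:R * b by rewrite mulr_ge0 // ltW.
have /choice[f fP] : forall z, exists y, C z /\ mdist x z <= n.+1%:R * b ->
    (C y /\ mdist x y <= n%:R * b) /\ mdist y z <= b.
  move=> z; have [zn|zn] := leP (mdist x z) (n%:R * b).
    by exists z => -[Cz _]; split=> //; rewrite mdistxx; exact: ltW.
  have [c cP] := geoX x z; exists (c (n%:R * b)) => -[Cz zn1].
  have [c0 c1 cd] := cP.
  have m1 : 0 <= n%:R * b <= mdist x z by rewrite nb ltW.
  have m2 : 0 <= mdist x z <= mdist x z by rewrite mdist_ge0 lexx.
  have m3 : 0 <= (0 : R) <= mdist x z by rewrite lexx mdist_ge0.
  have E1 := cd _ _ m3 m1; rewrite c0 sub0r normrN ger0_norm // in E1.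
  have E2 := cd _ _ m1 m2; rewrite c1 ler0_norm ?opprB ?subr_le0 1?ltW // in E2.
  split; first split; first exact: convexC cP m1.
    by rewrite E1.
  by rewrite E2; move: zn1; rewrite -natr1; lra.
have FK : F (f @^-1` (C `&` [set y | mdist x y <= n%:R * b])).
  by apply: filterS FA => z /fP[].
have [y [Cy _] Fy] := ultra_compact_dist UF IH FK.
have FB : F (id @^-1` (C `&` [set z | mdist y z <= r0])).
  apply: filterS (filterI FA (Fy _ b0)) => z [Az /= fz]; split; first by case: Az.
  have [_ h] := fP _ Az; have := metric_triangle y (f z) z.
  by rewrite [mdist y (f z)]metric_sym /b in h fz *; lra.
have [p [Cp _] Fp] := ultra_compact_dist UF (H _ Cy) FB.
exists p => //; split=> //; apply/ler_addgt0Pl => e e0.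
have [z [[_ /= zr] /= ze]] := filter_exI _ FA (Fp _ e0).
by have := metric_triangle x z p; lra.
Qed.

End Cocompact.
(** * Quotient flow spaces *)

(* The two flow spaces of the theorem are presented in the same way: [Y] is the
   set of orbits of lines in an invariant convex set [C], and [P l y] says that
   the line [l] is a lift of [y]. *)
Record flow_quotient (R : realType) (G : groupType) (X : metricType R)
    (a : isometric_action G X) (C : set X) (Y : Type) (P : (R -> X) -> Y -> Prop)
    (dY : Y -> Y -> R) (phi : R -> Y -> Y) : Prop := {
  lift_line : forall l y, P l y -> line_in C l;
  lift_quot : forall l, line_in C l -> exists y, P l y;
  lift_ex : forall y, exists l, P l y;
  lift_fun : forall l y y', P l y -> P l y' -> y = y';
  lift_orbit : forall l l' y, P l y -> P l' y -> exists g, l' = a g \o l;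
  lift_act : forall l y g, P l y -> P (a g \o l) y;
  lift_dist : forall y y', dY y y' = inf [set r | exists l l',
    [/\ P l y, P l' y' & r = geodesic_dist l l']];
  lift_flow : forall l y t, P l y -> P (shift t l) (phi t y) }.

Lemma metric_within_continuous (R : realType) (M : metricType R)
    (N : pseudoMetricType R) (A : set (M * M)) (f : M * M -> N) :
  (forall x y, A (x, y) -> forall eta, 0 < eta -> exists2 r, 0 < r &
    forall x' y', mdist x x' < r -> mdist y y' < r -> ball (f (x, y)) eta (f (x', y'))) ->
  {within A, continuous f}.
Proof.
move=> H; apply/subspace_continuousP => -[x y] Axy; apply/cvg_ballP => eta eta0.
have [r r0 Hr] := H x y Axy _ eta0.
rewrite near_withinE /=; exists (ball x r, ball y r).
  by split; exact: nbhsx_ballx.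
by move=> [x' y'] [/= + +] _; rewrite !ballEmdist /= => xx yy; exact: Hr.
Qed.

(** * Metric, compactness and continuity of the flow on the quotient *)

Section FlowQuotient.
Context (R : realType) (G : groupType) (X : metricType R).
Variable a : isometric_action G X.
Hypothesis catX : CAT_m1 X.
Hypothesis freeG : free_action a.
Hypothesis pdG : properly_discontinuous a.
Variable C : set X.

Hypothesis convexC : convex_subset C.
Hypothesis invC : forall g x, C x -> C (a g x).
Hypothesis compactC : compact (proj a @` C).
Variables (Y : choiceType) (P : (R -> X) -> Y -> Prop).
Variables (dY : Y -> Y -> R) (phi : R -> Y -> Y).
Hypothesis FQ : flow_quotient a C P dY phi.
Implicit Types (c l w : R -> X) (x y z : Y) (g : G) (s t r : R).

Let properC (p : X) r : C p -> compact (C `&` [set q | mdist p q <= r]).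
Proof. by apply: (proper_hull freeG pdG convexC invC compactC); case: catX. Qed.

Let Pl l y : P l y -> line l.
Proof. by case/(lift_line FQ). Qed.

Let Pin l y : P l y -> line_in C l.
Proof. exact: (lift_line FQ). Qed.

Lemma geodesic_dist_act g c c' : geodesic_dist (a g \o c) (a g \o c') = geodesic_dist c c'.
Proof. by apply: eq_Rintegral => s _ /=; rewrite act_isometry. Qed.

Lemma bracket_of_act g c c' w v : bracket_of c c' w v ->
  bracket_of (a g \o c) (a g \o c') (a g \o w) v.
Proof.
move=> [H1 H2]; split=> e e0.
  by have [T HT] := H1 e e0; exists T => t /HT; rewrite /= act_isometry.
by have [T HT] := H2 e e0; exists T => t /HT; rewrite /reverse /shift /= act_isometry.
Qed.

Lemma quotient_dist_le l l' y y' : P l y -> P l' y' -> dY y y' <= geodesic_dist l l'.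
Proof.
move=> Py Py'; rewrite (lift_dist FQ); apply: ge_inf; last by exists l, l'.
by exists 0 => _ [m [m' [Pm Pm' ->]]]; exact: geodesic_dist_ge0 (Pl Pm) (Pl Pm').
Qed.

Lemma quotient_dist_ge0 y y' : 0 <= dY y y'.
Proof.
rewrite (lift_dist FQ); have [l ly] := lift_ex FQ y; have [l' ly'] := lift_ex FQ y'.
apply: lb_le_inf; first by exists (geodesic_dist l l'), l, l'.
by move=> _ [m [m' [Pm Pm' ->]]]; exact: geodesic_dist_ge0 (Pl Pm) (Pl Pm').
Qed.

(** The first lift can be prescribed, since [G] moves pairs of lifts isometrically. *)
Lemma quotient_dist_lt l y y' r : P l y -> dY y y' < r ->
  exists2 l', P l' y' & geodesic_dist l l' < r.
Proof.
move=> Py; rewrite (lift_dist FQ); set S := [set _ | _] => h.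
have iS : has_inf S.
  have [m my] := lift_ex FQ y; have [m' my'] := lift_ex FQ y'.
  split; first by exists (geodesic_dist m m'), m, m'.
  by exists 0 => _ [k [k' [Pk Pk' ->]]]; exact: geodesic_dist_ge0 (Pl Pk) (Pl Pk').
have d0 : 0 < r - inf S by rewrite subr_gt0.
have [_ [m [m' [Pm Pm' ->]]] hm] := inf_adherent d0 iS.
have [g lE] := lift_orbit FQ Pm Py.
exists (a g \o m'); first exact: (lift_act FQ g Pm').
by rewrite lE geodesic_dist_act; move: hm; rewrite subrKC.
Qed.

Lemma quotient_dist_sym y y' : dY y y' = dY y' y.
Proof.
rewrite !(lift_dist FQ); congr inf; apply/seteqP; split=> _ [l [l' [h h' ->]]];
  by exists l', l; split=> //; rewrite geodesic_distC.
Qed.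

Lemma quotient_dist_triangle y x z : dY x z <= dY x y + dY y z.
Proof.
apply/ler_addgt0Pl => e e0; have e2 : 0 < e / 2 by exact: divr_gt0.
have [l ly] := lift_ex FQ y.
have [m Pm hm] : exists2 m, P m x & geodesic_dist l m < dY x y + e / 2.
  by apply: quotient_dist_lt ly _; rewrite quotient_dist_sym ltrDl.
have [k Pk hk] : exists2 k, P k z & geodesic_dist l k < dY y z + e / 2.
  by apply: quotient_dist_lt ly _; rewrite ltrDl.
have := quotient_dist_le Pm Pk; rewrite geodesic_distC in hm.
have := geodesic_dist_triangle (Pl Pm) (Pl ly) (Pl Pk); lra.
Qed.

Section Displacement.
Variable i : R.
Hypothesis i0 : 0 < i.
Hypothesis iC : forall p g, C p -> g <> 1%g -> i <= mdist p (a g p).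

(** Distinct lifts differ by a nontrivial element, which moves [l 0] by at least [i]; the integral
    metric dominates the distance at time 0. *)
Lemma lift_close_eq l l' y : P l y -> P l' y -> geodesic_dist l l' < i -> l = l'.
Proof.
move=> Py Py' h; have [g gE] := lift_orbit FQ Py Py'.
have [g1|g1] := pselect (g = 1%g).
  by rewrite gE g1; apply/funext => s /=; rewrite act1.
have h1 := dist0_le_geodesic_dist catX (Pl Py) (Pl Py').
have [_ Cl] := Pin Py; have h2 := iC (Cl 0) g1.
have h3 : l' 0 = a g (l 0) by rewrite gE.
by exfalso; rewrite h3 in h1; lra.
Qed.

Lemma quotient_dist_eq l l' y y' : P l y -> P l' y' -> geodesic_dist l l' < i / 2 ->
  dY y y' = geodesic_dist l l'.
Proof.
move=> Py Py' h; apply/eqP; rewrite eq_le quotient_dist_le //= leNgt.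
apply/negP => /(quotient_dist_lt Py)[l'' Py'' h''].
have := geodesic_dist_triangle (Pl Py') (Pl Py) (Pl Py'').
rewrite [geodesic_dist l' l]geodesic_distC => h3.
have E : l' = l'' by apply: lift_close_eq Py' Py'' _; lra.
by rewrite -E ltxx in h''.
Qed.

Lemma quotient_is_distance : is_distance dY.
Proof.
split.
- move=> y; have [l ly] := lift_ex FQ y; apply/le_anti.
  by rewrite quotient_dist_ge0 andbT -(geodesic_distxx l) quotient_dist_le.
- move=> x y xy; have [l lx] := lift_ex FQ x.
  have [l' ly h] : exists2 l', P l' y & geodesic_dist l l' < i / 2.
    by apply: quotient_dist_lt lx _; rewrite xy divr_gt0.
  have E := quotient_dist_eq lx ly h; rewrite xy in E.
  have ll := geodesic_dist_eq0 catX (Pl lx) (Pl ly) (esym E).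
  by rewrite -ll in ly; exact: (lift_fun FQ lx ly).
- exact: quotient_dist_sym.
- exact: quotient_dist_triangle.
Qed.

End Displacement.

Lemma quotient_flow0 y : phi 0 y = y.
Proof.
have [l ly] := lift_ex FQ y; have := lift_flow FQ 0 ly; rewrite shift_zero => h.
exact: (lift_fun FQ h ly).
Qed.

Lemma quotient_flowD s t y : phi (s + t) y = phi s (phi t y).
Proof.
have [l ly] := lift_ex FQ y.
have h1 := lift_flow FQ s (lift_flow FQ t ly); rewrite shift_shift in h1.
exact: (lift_fun FQ (lift_flow FQ _ ly) h1).
Qed.

Lemma quotient_flow_dist s t x y :
  dY (phi s x) (phi t y) <= expR (2 * `|s|) * dY x y + `|s - t|.
Proof.
apply/ler_addgt0Pl => e e0.
have e2 : 0 < e / expR (2 * `|s|) by rewrite divr_gt0 // expR_gt0.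
have [l lx] := lift_ex FQ x.
have [l' ly h] : exists2 l', P l' y & geodesic_dist l l' < dY x y + e / expR (2 * `|s|).
  by apply: quotient_dist_lt lx _; rewrite ltrDl.
apply: le_trans (quotient_dist_le (lift_flow FQ s lx) (lift_flow FQ t ly)) _.
have [ll ll'] := (Pl lx, Pl ly).
apply: le_trans (geodesic_dist_triangle (line_shift s ll) (line_shift s ll') (line_shift t ll')) _.
have -> : shift t l' = shift (t - s) (shift s l') by rewrite shift_shift subrK.
rewrite (geodesic_dist_shift (t - s) (line_shift s ll')) distrC [leRHS]addrA lerD2r.
apply: le_trans (geodesic_dist_shift_le s ll ll') _.
apply: le_trans (ler_wpM2l (expR_ge0 _) (ltW h)) _.
by rewrite mulrDr [expR _ * (e / _)]mulrCA divff ?gt_eqF ?expR_gt0 // mulr1 addrC.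
Qed.

(** Lifts are chosen with base point near a limit [x0] of the projected base points. They converge
    pointwise to a line of [C], and by [geodesic_dist_small] uniform closeness on a bounded interval
    suffices. *)
Lemma quotient_compact (dP : is_distance dY) : compact [set: metric_space dP].
Proof.
apply: compact_metric => F UF _.
have FT : F setT by exact: filterT.
have /choice[l lP] : forall y : metric_space dP, exists l, P l y by exact: lift_ex FQ.
have FC : F ((fun y : metric_space dP => proj a (l y 0)) @^-1` (proj a @` C)).
  by apply: filterS FT => y _; exists (l y 0) => //; have [_] := Pin (lP y).
have [_ [x0 Cx0 <-] H] := ultra_compact_lim UF compactC FC.
have /choice[m mP] : forall y : metric_space dP, exists m, P m y /\
    ((exists g, mdist (a g (l y 0)) x0 < 1) -> mdist (m 0) x0 < 1).
  move=> y; have [[g h]|h] := pselect (exists g, mdist (a g (l y 0)) x0 < 1).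
    by exists (a g \o l y); split=> //; exact: (lift_act FQ g (lP y)).
  by exists (l y).
have F1 : F [set y | mdist (m y 0) x0 < 1].
  apply: filterS (H _ (proj_ball_nbhs a x0 ltr01)) => y [z /esym/projP[g <-] h].
  by have [_] := mP y; apply; exists g; rewrite metric_sym.
have [w [lw Cw Fw]] : exists w, [/\ line w, forall s, C (w s) &
    forall s e, 0 < e -> F [set y | mdist (m y s) (w s) < e]].
  apply: (@line_limit _ _ _ F m C x0 1 UF).
  - by move=> r; exact: properC.
  - move=> s; apply: filterS F1 => y /= h.
    have [ml Cm] := Pin (mP y).1; split=> //.
    apply: le_trans (metric_triangle _ (m y 0) _) _.
    by rewrite ml sub0r normrN lerD2r metric_sym ltW.
  - by move=> s t; apply: filterS FT => y _ /=; exact: Pl (mP y).1 _ _.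
have [y0 wy0] := lift_quot FQ (conj lw Cw).
exists y0 => // e e0.
have e8 : 0 < e / 8 by exact: divr_gt0.
have [T T0 HT] := expRN_small e8.
have {}HT := HT T (lexx T).
(* Distances of lines are 2-Lipschitz, so it suffices to control them on a
   finite grid of step [e / 16]. *)
pose h := e / 16; have h0 : 0 < h by exact: divr_gt0.
pose N := (Num.truncn (2 * T / h)).+1.
have Fgrid : F [set y | forall k : 'I_N, mdist (m y (k%:R * h - T)) (w (k%:R * h - T)) < e / 8].
  by apply: filter_forall => k; exact: Fw.
apply: filterS Fgrid => y hy.
have my := (mP y).1; have ml := Pl my.
apply: le_lt_trans (quotient_dist_le my wy0) _.
apply: le_lt_trans (_ : e / 4 + 4 * expR (- T) < _); last by lra.
apply: geodesic_dist_small => //; first by rewrite divr_ge0 // ltW.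
move=> s; rewrite ler_norml => /andP[s1 s2].
have sT : 0 <= (s + T) / h by rewrite divr_ge0 ?(ltW h0) //; lra.
pose k := Num.truncn ((s + T) / h).
have /andP[k1 k2] : k%:R <= (s + T) / h < k.+1%:R by exact: truncn_itv.
have kN : (k < N)%N.
  rewrite /N ltnS; apply: le_truncn; rewrite ler_pM2r ?invr_gt0 //; lra.
have := hy (Ordinal kN); rewrite /=.
have := line_dist_le s (k%:R * h - T) ml lw.
rewrite ler_pdivlMr // in k1; rewrite ltr_pdivrMr // -natr1 mulrDl mul1r in k2.
rewrite ger0_norm; last by lra.
rewrite /h in k1 k2 *; lra.
Qed.

Lemma quotient_continuous_flow (dP : is_distance dY) :
  @continuous_flow R (metric_space dP) phi.
Proof.
split; [exact: quotient_flow0|exact: quotient_flowD|].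
move=> [s x]; apply/cvg_ballP => e e0 /=.
have e2 : 0 < e / 2 by exact: divr_gt0.
pose r := e / 2 / expR (2 * `|s|).
have r0 : 0 < r by rewrite divr_gt0 // expR_gt0.
exists (ball s (e / 2), ball (x : metric_space dP) r).
  by split; exact: nbhsx_ballx.
move=> [t y] [/= st xy]; rewrite ballEmdist in xy; rewrite ballEmdist /=.
apply: le_lt_trans (quotient_flow_dist s t x y) _.
have h1 : `|s - t| < e / 2 by exact: st.
have h2 : expR (2 * `|s|) * dY x y < e / 2.
  by rewrite mulrC -ltr_pdivlMr ?expR_gt0 //; exact: xy.
lra.
Qed.

End FlowQuotient.

(** * Bracket axioms and local product structure on the quotient *)

Section QuotientAnosov.
Context (R : realType) (G : groupType) (X : metricType R).
Variable a : isometric_action G X.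
Hypothesis catX : CAT_m1 X.
Variable C : set X.
Variables (Y : choiceType) (P : (R -> X) -> Y -> Prop).
Variables (dY : Y -> Y -> R) (phi : R -> Y -> Y).
Hypothesis FQ : flow_quotient a C P dY phi.
Implicit Types (c l w : R -> X) (x y z : Y) (g : G) (s t r : R).

Let Pl l y : P l y -> line l.
Proof. by case/(lift_line FQ). Qed.

Let Pin l y : P l y -> line_in C l.
Proof. exact: (lift_line FQ). Qed.

Variable i : R.
Hypothesis iC : forall p g, C p -> g <> 1%g -> i <= mdist p (a g p).

Let close_eq l l' y : P l y -> P l' y -> geodesic_dist l l' < i -> l = l'.
Proof. by move=> h h'; exact: (lift_close_eq catX FQ iC h h'). Qed.

Let dist_eq l l' y y' : P l y -> P l' y' -> geodesic_dist l l' < i / 2 ->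
  dY y y' = geodesic_dist l l'.
Proof. by move=> h h'; exact: (quotient_dist_eq catX FQ iC h h'). Qed.

(* Below [rho], lifts can be chosen consistently and brackets exist and stay
   within [eta0] of the two lines. *)
Variables eta0 rho : R.
Hypothesis eta0_gt0 : 0 < eta0.
Hypothesis iE : i = 16 * eta0.
Hypothesis rho0 : 0 < rho.
Hypothesis rho_eta : rho <= eta0.
Hypothesis rho1 : rho <= 1.
Hypothesis rho_bracket : forall c c', line_in C c -> line_in C c' ->
  geodesic_dist c c' < rho ->
  exists w v, [/\ line_in C w, bracket_of c c' w v, `|v| <= eta0 & [/\
    geodesic_dist w c <= eta0, geodesic_dist w c' <= eta0 &
    geodesic_dist w (shift v c) <= eta0]].

Ltac lra_bounds := have := eta0_gt0; have := iE; have := rho0;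
  have := rho_eta; have := rho1; lra.

Variables (br : Y -> Y -> Y) (vv : Y -> Y -> R).
Hypothesis br_spec : forall x y, dY x y < rho -> exists c c' w,
  [/\ P c x, P c' y & geodesic_dist c c' < rho] /\
  [/\ bracket_of c c' w (vv x y) & P w (br x y)].

(** [br_spec] provides one pair of lifts; any other close pair is its translate by a single [g].
    Indeed, when [g] brings the first lifts together, the second ones are lifts of [y] closer than
    [i], hence equal. *)
Lemma quotient_bracketE c c' w t x y : P c x -> P c' y -> geodesic_dist c c' < rho ->
  line_in C w -> bracket_of c c' w t -> P w (br x y) /\ vv x y = t.
Proof.
move=> cx cy cc' [lw Cw] bw.
have xy : dY x y < rho by apply: le_lt_trans cc'; exact: (quotient_dist_le FQ cx cy).
have [c1 [c1' [w1 [[c1x c1y cc1] [bw1 w1b]]]]] := br_spec xy.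
have [g gE] := lift_orbit FQ c1x cx; have [h hE] := lift_orbit FQ c1y cy.
have E : a g \o c1' = c'.
  apply: (close_eq (lift_act FQ g c1y) cy).
  have h1 : geodesic_dist (a g \o c1) (a g \o c1') < rho by rewrite geodesic_dist_act.
  rewrite -gE in h1.
  have := geodesic_dist_triangle (Pl (lift_act FQ g c1y)) (Pl cx) (Pl cy).
  by rewrite [geodesic_dist (a g \o c1') c]geodesic_distC; lra_bounds.
have := bracket_of_act a g bw1; rewrite -gE E => bw1'.
have wg := lift_act FQ g w1b.
have [-> ->] := bracket_of_unique catX lw (Pl wg) bw bw1'.
by [].
Qed.

Lemma quotient_bracketP c c' x y : P c x -> P c' y -> geodesic_dist c c' < rho ->
  exists w, [/\ line_in C w, bracket_of c c' w (vv x y), P w (br x y) &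
    [/\ `|vv x y| <= eta0, geodesic_dist w c <= eta0 & geodesic_dist w c' <= eta0]].
Proof.
move=> cx cy cc'.
have [w [t [iw bw tE [h1 h2 _]]]] := rho_bracket (Pin cx) (Pin cy) cc'.
have [wb ->] := quotient_bracketE cx cy cc' iw bw.
by exists w.
Qed.

(** The constant of [geodesic_dist_contract] when the distance at time 0 is at most [rho <= 1]. *)
Let C0 : R := 1 + 2 * expR 1.

Lemma contract_bound t c c' : line c -> line c' -> geodesic_dist c c' < rho ->
  strongly_asymptotic c c' -> 0 <= t ->
  geodesic_dist (shift t c) (shift t c') <= C0 * expR (- t) * geodesic_dist c c'.
Proof.
move=> lc lc' cc' ss t0; apply: le_trans (geodesic_dist_contract catX lc lc' ss t0) _.
rewrite ler_wpM2r ?geodesic_dist_ge0 // ler_wpM2r ?expR_ge0 // /C0.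
rewrite lerD2l ler_wpM2l // ler_expR.
by have := dist0_le_geodesic_dist catX lc lc'; lra_bounds.
Qed.

Lemma contract_bound_rev t c c' : line c -> line c' -> geodesic_dist c c' < rho ->
  strongly_asymptotic (reverse c) (reverse c') -> 0 <= t ->
  geodesic_dist (shift (- t) c) (shift (- t) c') <=
  C0 * expR (- t) * geodesic_dist c c'.
Proof.
move=> lc lc' cc' ss t0.
have lr := line_rev lc; have lr' := line_rev lc'.
rewrite -(geodesic_dist_rev (line_shift (- t) lc) (line_shift (- t) lc')).
rewrite -(geodesic_dist_rev lc lc').
have := @contract_bound t _ _ lr lr'; rewrite (geodesic_dist_rev lc lc').
move=> /(_ cc' ss t0); rewrite -/(reverse (shift (- t) c)) -/(reverse (shift (- t) c')).
by rewrite !reverse_shift opprK.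
Qed.

Variable dP : is_distance dY.
Let M := metric_space dP.
Let dM (x y : M) : mdist x y = dY x y. Proof. by []. Qed.

Lemma in_Wss c' w y b : P c' y -> P w b -> strongly_asymptotic w c' ->
  geodesic_dist w c' < rho -> @Wss R M phi br rho C0 1 y b.
Proof.
move=> cy wb ss wc; have lw := Pl wb; have lc := Pl cy.
have [w' _] := quotient_bracketE wb cy wc (Pin wb) (bracket_of_ss ss).
have yb : dY y b = geodesic_dist c' w.
  by apply: dist_eq cy wb _; rewrite geodesic_distC; lra_bounds.
split; first split; first exact: (lift_fun FQ wb w').
  by rewrite dM yb geodesic_distC.
move=> t t0; rewrite !dM mul1r yb.
apply: le_trans (quotient_dist_le FQ (lift_flow FQ t cy) (lift_flow FQ t wb)) _.
apply: contract_bound => //; first by rewrite geodesic_distC.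
exact: strongly_asymptotic_sym.
Qed.

Lemma in_Wuu c w x b : P c x -> P w b ->
  strongly_asymptotic (reverse w) (reverse c) ->
  geodesic_dist w c < rho -> @Wuu R M phi br rho C0 1 x b.
Proof.
move=> cx wb ss wc; have lw := Pl wb; have lc := Pl cx.
have cw : geodesic_dist c w < rho by rewrite geodesic_distC.
have bw : bracket_of c w w 0 by apply: bracket_of_uu; rewrite shift_zero.
have [w' _] := quotient_bracketE cx wb cw (Pin wb) bw.
have xb : dY x b = geodesic_dist c w by apply: dist_eq cx wb _; lra_bounds.
split; first split; first exact: (lift_fun FQ wb w').
  by rewrite dM xb.
move=> t t0; rewrite !dM mul1r xb.
apply: le_trans (quotient_dist_le FQ (lift_flow FQ (- t) cx) (lift_flow FQ (- t) wb)) _.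
by apply: contract_bound_rev => //; exact: strongly_asymptotic_sym.
Qed.

(** Through [z = br z y], the lift of [z] near [c'] is a bracket ending with [c']: both are close
    lifts of the same point. *)
Lemma Wss_lift c' y z : P c' y -> @Wss R M phi br rho C0 1 y z ->
  exists w, [/\ P w z, geodesic_dist w c' < rho & strongly_asymptotic w c'].
Proof.
move=> cy [[zE yz] _]; rewrite dM in yz.
have [w wz cw] := quotient_dist_lt FQ cy yz.
have wc : geodesic_dist w c' < rho by rewrite geodesic_distC.
have [u [iu [ss _] ub [_ uw _]]] := quotient_bracketP wz cy wc.
rewrite -zE in ub; exists w; split=> //.
suff -> : w = u by [].
by apply: close_eq wz ub _; rewrite geodesic_distC; lra_bounds.
Qed.

(** The equation [z = br x z] only says that [w] shares the backward end of [c] up to a shift [t].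
    In the past [w] approaches [shift t c], and by the decay in [Wuu] it also approaches [c]; these
    two lines stay at distance [|t|], so [t = 0]. *)
Lemma Wuu_lift c x z : P c x -> @Wuu R M phi br rho C0 1 x z ->
  exists w, [/\ P w z, geodesic_dist w c < rho &
    strongly_asymptotic (reverse w) (reverse c)].
Proof.
move=> cx [[zE xz] dec]; rewrite dM in xz.
have [w wz cw] := quotient_dist_lt FQ cx xz.
have [u [[lu _] [_ ss] ub [vE _ uw]]] := quotient_bracketP cx wz cw.
rewrite -zE in ub; set t := vv x z in ss vE.
have wu : w = u by apply: close_eq wz ub _; rewrite geodesic_distC; lra_bounds.
rewrite -wu in ss; have lw := Pl wz; have lc := Pl cx.
exists w; rewrite geodesic_distC; split=> //.
suff t0 : t = 0 by rewrite t0 shift_zero in ss.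
apply/eqP; rewrite -normr_eq0; apply/eqP/le_anti; rewrite normr_ge0 andbT.
pose B := (1 + 2 * expR (mdist (reverse w 0) (reverse (shift t c) 0))) *
  geodesic_dist w (shift t c).
have lsc := line_shift t lc.
have B0 : 0 <= B by rewrite mulr_ge0 ?geodesic_dist_ge0 // addr_ge0 // mulr_ge0 ?expR_ge0.
have C00 : 0 <= C0 by rewrite addr_ge0 // mulr_ge0 ?expR_ge0.
have wt s : 0 <= s ->
  geodesic_dist (shift (- s) w) (shift (- s) (shift t c)) <= B * expR (- s).
  move=> s0.
  rewrite -(geodesic_dist_rev (line_shift (- s) lw) (line_shift (- s) lsc)).
  have := geodesic_dist_contract catX (line_rev lw) (line_rev lsc) ss s0.
  rewrite (geodesic_dist_rev lw lsc).
  rewrite -/(reverse (shift (- s) w)) -/(reverse (shift (- s) (shift t c))).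
  rewrite (reverse_shift (- s) w) (reverse_shift (- s) (shift t c)) opprK => h.
  by apply: le_trans h _; rewrite mulrAC.
apply/ler_addgt0Pl => e e_gt0; rewrite addr0.
pose D := B + C0 * rho + 1.
have D0 : 0 < D by rewrite ltr_wpDl // addr_ge0 // mulr_ge0 // ltW.
(* The bound by [eta0] keeps the lifts within [i / 2] at time [- s], where their distance is the
   quotient distance to which the decay applies; the bound by [e] gives the conclusion. *)
have m0 : 0 < Num.min e eta0 / D by rewrite divr_gt0 // lt_min e_gt0.
have [s s0 /(_ s (lexx s)) sE] := expRN_small m0.
rewrite ler_pdivlMr // le_min in sE; case/andP: sE => sE sE'.
have es0 := expR_ge0 (- s).
have BD : B * expR (- s) <= expR (- s) * D.
  by rewrite mulrC ler_wpM2l // /D; have := mulr_ge0 C00 (ltW rho0); lra_bounds.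
have tE : geodesic_dist (shift (- s) c) (shift (- s) (shift t c)) = `|t|.
  by rewrite shift_shift addrC -shift_shift geodesic_dist_shift //; exact: line_shift.
have q1 := geodesic_dist_triangle (line_shift (- s) lc) (line_shift (- s) lw) (line_shift (- s) lsc).
have q2 := geodesic_dist_triangle (line_shift (- s) lc) (line_shift (- s) lsc) (line_shift (- s) lw).
rewrite [geodesic_dist (shift (- s) (shift t c)) (shift (- s) w)]geodesic_distC in q2.
rewrite tE in q1 q2; have ws := wt s s0.
have dE := dist_eq (lift_flow FQ (- s) cx) (lift_flow FQ (- s) wz).
have {}dE : dY (phi (- s) x) (phi (- s) z) = geodesic_dist (shift (- s) c) (shift (- s) w).
  by apply: dE; lra_bounds.
have := dec s s0; rewrite !dM mul1r dE => q3.
have q4 : C0 * expR (- s) * dY x z <= C0 * expR (- s) * rho.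
  by rewrite ler_wpM2l ?mulr_ge0 // ltW.
rewrite /D in sE; lra_bounds.
Qed.

Lemma quotient_is_bracket r0 : rho <= r0 ->
  (forall eta, 0 < eta -> exists2 r, 0 < r & forall c c' w v d d' W V,
  line_in C c -> line_in C c' -> line_in C d -> line_in C d' -> line w -> line W ->
  bracket_of c c' w v -> bracket_of d d' W V ->
  geodesic_dist c c' < r0 -> geodesic_dist d d' < r0 ->
  geodesic_dist c d < r -> geodesic_dist c' d' < r ->
  `|v - V| <= eta /\ geodesic_dist w W <= eta) ->
  @is_bracket R M phi rho br /\
  {within @near_pairs R M rho, continuous (fun p : M * M => vv p.1 p.2)}.
Proof.
move=> rho_r0 cont.
have ex x y : dY x y < rho -> exists c c',
    [/\ P c x, P c' y & geodesic_dist c c' < rho].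
  by move=> /br_spec[c [c' [_ [h _]]]]; exists c, c'.
have key x y : dY x y < rho -> forall eta, 0 < eta -> exists2 r, 0 < r &
    forall x' y', dY x x' < r -> dY y y' < r ->
    `|vv x y - vv x' y'| < eta /\ dY (br x y) (br x' y') < eta.
  move=> xy eta eta_gt0; have e2 : 0 < eta / 2 by exact: divr_gt0.
  have [r r_gt0 Hr] := cont _ e2.
  have [c [c' [cx cy cc']]] := ex _ _ xy.
  (* Half of the room below [rho] for each perturbed line keeps the perturbed pair below [rho]. *)
  have k0 : 0 < (rho - geodesic_dist c c') / 2 by rewrite divr_gt0 // subr_gt0.
  exists (Num.min r ((rho - geodesic_dist c c') / 2)); first by rewrite lt_min r_gt0.
  move=> x' y' xx yy.
  have [d dx' cd] := quotient_dist_lt FQ cx xx.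
  have [d' dy' cd'] := quotient_dist_lt FQ cy yy.
  rewrite lt_min in cd; case/andP: cd => cd1 cd2.
  rewrite lt_min in cd'; case/andP: cd' => cd1' cd2'.
  have dd' : geodesic_dist d d' < rho.
    have := geodesic_dist_triangle (Pl dx') (Pl cx) (Pl dy').
    have := geodesic_dist_triangle (Pl cx) (Pl cy) (Pl dy').
    by rewrite [geodesic_dist d c]geodesic_distC; lra_bounds.
  have [w [[lw _] bw wb _]] := quotient_bracketP cx cy cc'.
  have [W [[lW _] bW Wb _]] := quotient_bracketP dx' dy' dd'.
  have cr0 : geodesic_dist c c' < r0 by exact: lt_le_trans rho_r0.
  have dr0 : geodesic_dist d d' < r0 by exact: lt_le_trans rho_r0.
  have [h1 h2] := Hr _ _ _ _ _ _ _ _ (Pin cx) (Pin cy) (Pin dx') (Pin dy') lw lW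
    bw bW cr0 dr0 cd1 cd1'.
  by have := quotient_dist_le FQ wb Wb; split; lra_bounds.
split; last first.
  apply: metric_within_continuous => x y xy eta eta_gt0.
  have [r r_gt0 Hr] := key x y xy _ eta_gt0; exists r => // x' y' xx yy.
  by have [] := Hr x' y' xx yy.
split.
- apply: metric_within_continuous => x y xy eta eta_gt0.
  have [r r_gt0 Hr] := key x y xy _ eta_gt0; exists r => // x' y' xx yy.
  by rewrite ballEmdist /=; have [] := Hr x' y' xx yy.
- move=> x; have [c cx] := lift_ex FQ x.
  have cc : geodesic_dist c c < rho by rewrite geodesic_distxx.
  have [cb _] := quotient_bracketE cx cx cc (Pin cx) (bracket_of_self c).
  exact: (lift_fun FQ cb cx).
- move=> x y z; rewrite !dM => xy bz xz.
  have [c [c' [cx cy cc']]] := ex _ _ xy.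
  have [w [iw bw wb [_ wc _]]] := quotient_bracketP cx cy cc'.
  have [c'' cz wc''] := quotient_dist_lt FQ wb bz.
  have [u [iu bu ub _]] := quotient_bracketP wb cz wc''.
  have h : geodesic_dist c c'' < i / 2.
    have := geodesic_dist_triangle (Pl cx) (Pl wb) (Pl cz).
    by rewrite [geodesic_dist c w]geodesic_distC; lra_bounds.
  have cc'' : geodesic_dist c c'' < rho by rewrite -(dist_eq cx cz h).
  have [ub' _] := quotient_bracketE cx cz cc'' iu (bracket_of_left bw bu).
  exact: (lift_fun FQ ub ub').
- move=> x y z; rewrite !dM => yz xb xz.
  have [c' [c'' [cy cz cc']]] := ex _ _ yz.
  have [w [iw bw wb [_ _ wc]]] := quotient_bracketP cy cz cc'.
  have [c cx cw] : exists2 c, P c x & geodesic_dist w c < rho.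
    apply: (quotient_dist_lt FQ wb).
    by rewrite -[dY _ _]/(mdist (br y z : M) (x : M)) metric_sym.
  rewrite geodesic_distC in cw.
  have [u [iu bu ub _]] := quotient_bracketP cx wb cw.
  have h : geodesic_dist c c'' < i / 2.
    by have := geodesic_dist_triangle (Pl cx) (Pl wb) (Pl cz); lra_bounds.
  have cc'' : geodesic_dist c c'' < rho by rewrite -(dist_eq cx cz h).
  have [ub' _] := quotient_bracketE cx cz cc'' iu (bracket_of_right bw bu).
  exact: (lift_fun FQ ub ub').
- move=> x y t t0 H.
  have xy : dY x y < rho.
    have := H 0; rewrite lexx t0 !dM => /(_ isT).
    by rewrite !(quotient_flow0 FQ).
  have [c [c' [cx cy cc']]] := ex _ _ xy.
  have [lc lc'] := (Pl cx, Pl cy).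
  have lip s u : geodesic_dist (shift s c) (shift s c') <=
      geodesic_dist (shift u c) (shift u c') + 2 * `|s - u|.
    have e1 l : line l -> geodesic_dist (shift u l) (shift s l) = `|s - u|.
      move=> ll; have := geodesic_dist_shift (s - u) (line_shift u ll).
      by rewrite shift_shift subrK.
    have := geodesic_dist_triangle (line_shift s lc) (line_shift u lc) (line_shift s lc').
    have := geodesic_dist_triangle (line_shift u lc) (line_shift u lc') (line_shift s lc').
    by rewrite [geodesic_dist (shift s c) (shift u c)]geodesic_distC !e1 //; lra_bounds.
  (* [H] bounds quotient distances, which other lifts might realize later on. By continuity the
     distance of the given lifts is at most [rho < i / 2] at a first failing time, hence equal to
     the quotient distance there, which is below [rho]. *)
  have close s : 0 <= s -> s <= t -> geodesic_dist (shift s c) (shift s c') < rho.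
    move: s; apply: real_induction.
    - by rewrite !shift_zero.
    - move=> s s0 Hs; have [st|ts] := leP s t; last first.
        by exists 1 => // u /andP[su _]; rewrite leNgt (lt_le_trans ts su).
      have {}Hs := Hs st.
      exists ((rho - geodesic_dist (shift s c) (shift s c')) / 2).
        by rewrite divr_gt0 // subr_gt0.
      move=> u /andP[su us] _; have := lip u s; rewrite ger0_norm; lra_bounds.
    - move=> s s0 Hs st.
      have le_rho : geodesic_dist (shift s c) (shift s c') <= rho.
        apply/ler_addgt0Pl => e e0.
        pose u := Num.max 0 (s - e / 2).
        have u1 : s - e / 2 <= u by rewrite le_max lexx orbT.
        have u2 : u < s by rewrite gt_max s0 /=; lra_bounds.
        have u3 : 0 <= u by rewrite le_max lexx.
        have := Hs u; rewrite u3 u2 => /(_ isT) => h.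
        have {}h : geodesic_dist (shift u c) (shift u c') < rho by apply: h; lra_bounds.
        by have := lip s u; rewrite ger0_norm; lra_bounds.
      have h : geodesic_dist (shift s c) (shift s c') < i / 2 by lra_bounds.
      rewrite -(dist_eq (lift_flow FQ s cx) (lift_flow FQ s cy) h) -dM.
      by apply: H; rewrite st ltW.
  have [w [iw bw wb _]] := quotient_bracketP cx cy cc'.
  have wt := lift_flow FQ t wb.
  have [wt' _] := quotient_bracketE (lift_flow FQ t cx) (lift_flow FQ t cy)
    (close t t0 (lexx t)) (Pin wt) (bracket_of_shift t bw).
  exact: (lift_fun FQ wt wt').
Qed.

(** Brackets within [rho / 2] of both lines fall inside the local sets of radius [rho]. Conversely,
    a common point lifts near [shift s c] and near [c']; the two lifts are closer than [i], hence
    equal, and form a bracket with shift [s], so [bracket_of_unique] applies. *)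
Lemma quotient_product_structure e : e <= rho ->
  (forall c c', line_in C c -> line_in C c' -> geodesic_dist c c' < e ->
  exists w v, [/\ line_in C w, bracket_of c c' w v, `|v| <= rho / 2 & [/\
    geodesic_dist w c <= rho / 2, geodesic_dist w c' <= rho / 2 &
    geodesic_dist w (shift v c) <= rho / 2]]) ->
  forall x y : M, mdist x y < e ->
  [/\ @Wuu R M phi br rho C0 1 (phi (vv x y) x)
        `&` @Wss R M phi br rho C0 1 y = [set br x y],
      `|vv x y| < eta0 &
      forall t, `|t| < eta0 ->
        @Wuu R M phi br rho C0 1 (phi t x)
          `&` @Wss R M phi br rho C0 1 y !=set0 -> t = vv x y].
Proof.
move=> e_rho He x y; rewrite dM => xy.
have [c cx] := lift_ex FQ x.
have [c' cy cc'] := quotient_dist_lt FQ cx xy.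
have ccr : geodesic_dist c c' < rho by exact: lt_le_trans e_rho.
have [w [t [iw bw tE [_ wc' wc]]]] := He _ _ (Pin cx) (Pin cy) cc'.
have [wb vE] := quotient_bracketE cx cy ccr iw bw.
have rho2 : rho / 2 < rho by rewrite ltr_pdivrMr // ltr_pMr // ltr1n.
have uniq s z : `|s| < eta0 -> @Wuu R M phi br rho C0 1 (phi s x) z ->
    @Wss R M phi br rho C0 1 y z -> s = t /\ z = br x y.
  move=> sE zu zs.
  have [w1 [w1z w1c ss]] := Wss_lift cy zs.
  have [w2 [w2z w2c uu]] := Wuu_lift (lift_flow FQ s cx) zu.
  have lc := Pl cx; have lc' := Pl cy; have l1 := Pl w1z; have l2 := Pl w2z.
  have E : w1 = w2.
    apply: close_eq w1z w2z _.
    have := geodesic_dist_triangle l1 lc' l2; have := geodesic_dist_triangle lc' lc l2.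
    have := geodesic_dist_triangle lc (line_shift s lc) l2.
    rewrite geodesic_dist_shift // [geodesic_dist c' c]geodesic_distC.
    by rewrite [geodesic_dist (shift s c) w2]geodesic_distC; lra_bounds.
  rewrite -E in uu.
  have [ww ts] := bracket_of_unique catX l1 (Pl wb) (conj ss uu) bw.
  by split=> //; rewrite ww in w1z; exact: (lift_fun FQ w1z wb).
have [ss uu] := bw.
rewrite vE; split.
- apply/seteqP; split=> [z [zu zs]|z ->].
    by have [|_ ->] := uniq t z _ zu zs; first lra_bounds.
  split; first by apply: (in_Wuu (lift_flow FQ t cx) wb) => //; exact: le_lt_trans rho2.
  by apply: (in_Wss cy wb) => //; exact: le_lt_trans rho2.
- by lra_bounds.
- by move=> s sE [z [zu zs]]; have [] := uniq s z sE zu zs.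
Qed.

End QuotientAnosov.

Theorem flow_quotient_anosov (R : realType) (G : groupType) (X : metricType R)
    (a : isometric_action G X) (C : set X) (Y : choiceType)
    (P : (R -> X) -> Y -> Prop) (dY : Y -> Y -> R) (phi : R -> Y -> Y) :
  CAT_m1 X -> free_action a -> properly_discontinuous a ->
  convex_subset C -> (forall g x, C x -> C (a g x)) -> compact (proj a @` C) ->
  flow_quotient a C P dY phi -> metric_anosov_flow dY phi.
Proof.
move=> catX freeG pdG convexC invC compactC FQ.
have [i i0 iC] := displacement_bound freeG pdG compactC.
have properC (p : X) r : C p -> compact (C `&` [set q | mdist p q <= r]).
  by apply: (proper_hull freeG pdG convexC invC compactC); case: catX.
have dP := quotient_is_distance catX FQ i0 iC.
exists dP; split; first exact: (quotient_compact catX freeG pdG convexC invC compactC FQ).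
  exact: (quotient_continuous_flow FQ).
have eta_gt0 : 0 < i / 16 by exact: divr_gt0.
have iE : i = 16 * (i / 16) by field.
have [r1 r10 H1] := bracket_modulus catX convexC properC eta_gt0.
have [r0 r00 cont] := bracket_continuous catX convexC properC.
(* [r1] gives existence of brackets, [r0] their continuity, [i / 16] a consistent choice of lifts,
   and 1 the contraction constant. *)
pose rho := Num.min (Num.min r1 r0) (Num.min (i / 16) 1).
have rho0 : 0 < rho by rewrite !lt_min r10 r00 eta_gt0 ltr01.
have rho_r1 : rho <= r1 by rewrite !ge_min lexx.
have rho_r0 : rho <= r0 by rewrite !ge_min lexx !orbT.
have rho_eta : rho <= i / 16 by rewrite !ge_min lexx !orbT.
have rho_1 : rho <= 1 by rewrite !ge_min lexx !orbT.
have Hrho c c' : line_in C c -> line_in C c' -> geodesic_dist c c' < rho ->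
  exists w v, [/\ line_in C w, bracket_of c c' w v, `|v| <= i / 16 & [/\
    geodesic_dist w c <= i / 16, geodesic_dist w c' <= i / 16 &
    geodesic_dist w (shift v c) <= i / 16]].
  by move=> ic ic' h; apply: H1 => //; exact: lt_le_trans rho_r1.
have rho2 : 0 < rho / 2 by exact: divr_gt0.
have [r2 r20 H2] := bracket_modulus catX convexC properC rho2.
pose e := Num.min r2 rho.
have e0 : 0 < e by rewrite lt_min r20.
have e_rho : e <= rho by rewrite ge_min lexx orbT.
have He c c' : line_in C c -> line_in C c' -> geodesic_dist c c' < e ->
  exists w v, [/\ line_in C w, bracket_of c c' w v, `|v| <= rho / 2 & [/\
    geodesic_dist w c <= rho / 2, geodesic_dist w c' <= rho / 2 &
    geodesic_dist w (shift v c) <= rho / 2]].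
  by move=> ic ic' h; apply: H2 => //; apply: lt_le_trans h _; rewrite ge_min lexx.
have /choice[q qP] : forall p : Y * Y, exists b : Y * R, dY p.1 p.2 < rho ->
  exists c c' w, [/\ P c p.1, P c' p.2 & geodesic_dist c c' < rho] /\
  [/\ bracket_of c c' w b.2 & P w b.1].
  (* Pairs that are not close receive the arbitrary value [(x, 0)]. *)
  move=> [x y] /=; have [xy|xy] := pselect (dY x y < rho); last by exists (x, 0).
  have [c cx] := lift_ex FQ x.
  have [c' cy cc'] := quotient_dist_lt FQ cx xy.
  have [w [v [iw bw _ _]]] := Hrho _ _ (lift_line FQ cx) (lift_line FQ cy) cc'.
  have [b wb] := lift_quot FQ iw.
  by exists (b, v) => _; exists c, c', w.
pose br x y := (q (x, y)).1; pose vv x y := (q (x, y)).2.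
have br_spec x y : dY x y < rho -> exists c c' w,
  [/\ P c x, P c' y & geodesic_dist c c' < rho] /\
  [/\ bracket_of c c' w (vv x y) & P w (br x y)] by exact: qP (x, y).
have [brP vvP] := quotient_is_bracket catX FQ iC eta_gt0 iE rho0 rho_eta rho_1 Hrho br_spec dP
  rho_r0 cont.
exists e, rho, br, (1 + 2 * expR 1), 1, rho, vv, (i / 16); split.
- by split=> //; rewrite ltr_wpDr // mulr_ge0 ?expR_ge0.
- by split.
- apply: continuous_subspaceW vvP => p /= h; exact: lt_le_trans e_rho.
- exact: (quotient_product_structure catX FQ iC eta_gt0 iE rho0 rho_eta rho_1 Hrho br_spec
  e_rho He).
Qed.
(** * The spaces of geodesics of the theorem *)

Section ConvexHull.
Context (R : realType) (G : groupType) (X : metricType R).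
Variable a : isometric_action G X.

Lemma geodesic_segment_act g p q c : geodesic_segment mdist p q c ->
  geodesic_segment mdist (a g p) (a g q) (a g \o c).
Proof.
move=> [c0 c1 cd]; split; rewrite /= ?act_isometry ?c0 ?c1 // => s t hs ht.
by rewrite act_isometry cd.
Qed.

Lemma geodesic_act g c : geodesic mdist c -> geodesic mdist (a g \o c).
Proof.
move=> gc t; have [e e0 ce] := gc t; exists e => // s s' hs hs'.
by rewrite /= act_isometry ce.
Qed.

(** The witness ray is translated along with its base point, so each orbit element [h] is replaced
    by its conjugate by [g]. *)
Lemma limit_set_act g c : limit_set a (endpoint c) -> limit_set a (endpoint (a g \o c)).
Proof.
move=> [r [rr E H]]; have [_ [M rM]] : endpoint c r.
  by rewrite E; split=> //; exists 0 => t _; rewrite mdistxx.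
exists (a g \o r); split.
- by move=> s t s0 t0; rewrite /= act_isometry rr.
- apply/seteqP; split=> q [qr [N qN]]; split=> //; exists (N + M) => t t0.
    apply: le_trans (metric_triangle _ ((a g \o c) t) _) _; apply: lerD; first exact: qN.
    by rewrite /= act_isometry metric_sym; exact: rM.
  apply: le_trans (metric_triangle _ ((a g \o r) t) _) _; apply: lerD; first exact: qN.
  by rewrite /= act_isometry; exact: rM.
- move=> T e T0 e0; have [h [k [h1 h2 h3]]] := H T e T0 e0.
  have E' : a (g * h * g^-1)%g (a g (r 0)) = a g (a h (r 0)).
    by rewrite !actM act_inv.
  exists (g * h * g^-1)%g, (a g \o k); rewrite /= E' !act_isometry; split=> //.
  exact: geodesic_segment_act.
Qed.

Lemma convex_convex_hull : convex_subset (convex_hull a).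
Proof.
move=> p q c t Cp Cq gc tc D DP; have [_ cD _] := DP.
exact: cD (Cp D DP) (Cq D DP) gc tc.
Qed.

Lemma act_continuous g : continuous (a g).
Proof.
move=> x; apply/cvg_ballP => e e0; apply: filterS (nbhsx_ballx x _ e0) => y.
by rewrite !ballEmdist /= act_isometry.
Qed.

(** The family of sets intersected in [convex_hull] is stable under preimage by [a g]. *)
Lemma convex_hull_act g x : convex_hull a x -> convex_hull a (a g x).
Proof.
move=> Cx D [clD cvD geoD].
apply: (Cx (a g @^-1` D)); split.
- by apply: preimage_closed clD => y _; exact: act_continuous.
- move=> p q c t Dp Dq gc; rewrite -(act_isometry a g) => tc.
  exact: cvD Dp Dq (geodesic_segment_act g gc) tc.
- move=> c gc e1 e2 _ [s _ <-]; apply: (geoD (a g \o c)); last by exists s.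
  + exact: geodesic_act.
  + exact: limit_set_act.
  + exact: (limit_set_act g e2).
Qed.

Lemma hatGX_flow_quotient : CAT_m1 X -> flow_quotient a (convex_hull a)
  (fun l y => exists lh : hatGXt a, val lh = l /\ hatGX_proj lh = y)
  (@hatGX_dist R G X a) (@hatGX_flow R G X a).
Proof.
move=> catX.
have projE (l l' : hatGXt a) : hatGX_proj l = hatGX_proj l' <->
    exists g, a g \o val l = val l'.
  split; first by move=> /eqmodP/asboolP.
  by move=> H; apply/eqmodP/asboolP.
have lift l : line_in (convex_hull a) l -> exists lh : hatGXt a, val lh = l.
  move=> [ll Cl]; have lh : l \in hatGXt a.
    apply/mem_set; split; first exact: line_geodesic.
    by move=> _ [s _ <-].
  by exists (SigSub lh).
have line_val (lh : hatGXt a) : line_in (convex_hull a) (val lh).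
  have [lg lC] := set_mem (valP lh).
  by split; [exact: geodesic_line|move=> s; apply: lC; exists s].
split.
- by move=> l y [lh [<- _]].
- by move=> l /lift[lh E]; exists (hatGX_proj lh), lh.
- move=> y; pose lh : hatGXt a := repr (y : {eq_quot (hatGXt_equiv a)}).
  exists (val lh), lh; split=> //; exact: (reprK (y : {eq_quot (hatGXt_equiv a)})).
- by move=> l y y' [lh [<- <-]] [lh' [/val_inj -> <-]].
- move=> l l' y [lh [<- <-]] [lh' [<- /esym/projE[g gE]]].
  by exists g; rewrite gE.
- move=> l y g [lh [<- <-]].
  have [lh' E] : exists lh' : hatGXt a, val lh' = a g \o val lh.
    apply: lift; have [ll Cl] := line_val lh; split=> [s t|s].
      by rewrite /comp act_isometry ll.
    by rewrite /comp; apply: convex_hull_act; exact: Cl.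
  exists lh'; split=> //; apply/esym/projE.
  by exists g.
- move=> y y'; rewrite /hatGX_dist; congr inf; apply/seteqP; split.
    by move=> _ [l [l' [ly ly' ->]]]; exists (val l), (val l'); split=> //; [exists l|exists l'].
  by move=> _ [_ [_ [[l [<- ly]] [l' [<- ly']] ->]]]; exists l, l'.
- move=> l y t [lh [<- <-]]; exists (hatGXt_flow t lh); split=> //.
  by rewrite hatGX_flow_proj.
Qed.

End ConvexHull.

(** * Lifting local geodesics of the orbit space *)

Section OrbitSpace.
Context (R : realType) (G : groupType) (X : metricType R).
Variable a : isometric_action G X.
Implicit Types (x y : X) (p q : orbit_space a).

Let orbit_dists p q := [set r | exists x y, [/\ proj a x = p, proj a y = q & r = mdist x y]].

Let orbit_dists_inf p q : has_inf (orbit_dists p q).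
Proof.
have [x <-] := proj_surj p; have [y <-] := proj_surj q.
split; first by exists (mdist x y), x, y.
by exists 0 => _ [? [? [_ _ ->]]]; exact: mdist_ge0.
Qed.

Lemma orbit_dist_le x y : orbit_dist (proj a x) (proj a y) <= mdist x y.
Proof.
apply: ge_inf; last by exists x, y.
by case: (orbit_dists_inf (proj a x) (proj a y)).
Qed.

Lemma orbit_dist_lt x q r : orbit_dist (proj a x) q < r ->
  exists2 y, proj a y = q & mdist x y < r.
Proof.
move=> h; have d0 : 0 < r - orbit_dist (proj a x) q by rewrite subr_gt0.
have [_ [x' [y [/esym/projP[g <-] <- ->]]] hy] :=
  inf_adherent d0 (orbit_dists_inf (proj a x) q).
exists (a g^-1%g y); first exact: proj_act.
by rewrite -act_dist_inv; move: hy; rewrite -/(orbit_dist _ _) subrKC.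
Qed.

Lemma orbit_dist_triangle q p r : orbit_dist p r <= orbit_dist p q + orbit_dist q r.
Proof.
have [x <-] := proj_surj p.
apply/ler_addgt0Pl => e e0; have e2 : 0 < e / 2 by exact: divr_gt0.
have [y yq xy] : exists2 y, proj a y = q & mdist x y < orbit_dist (proj a x) q + e / 2.
  by apply: orbit_dist_lt; rewrite ltrDl.
rewrite -yq in xy *.
have [z zr yz] : exists2 z, proj a z = r & mdist y z < orbit_dist (proj a y) r + e / 2.
  by apply: orbit_dist_lt; rewrite ltrDl.
rewrite -zr in yz *.
have := orbit_dist_le x z; have := metric_triangle x y z; lra.
Qed.

Variable i : R.
Hypothesis i0 : 0 < i.
Hypothesis iX : forall x g, g <> 1%g -> i <= mdist x (a g x).

Lemma proj_close_eq x y : proj a x = proj a y -> mdist x y < i -> x = y.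
Proof.
move=> /projP[g <-]; have [->|g1] := pselect (g = 1%g); first by rewrite act1.
by rewrite ltNge iX.
Qed.

Lemma orbit_dist_eq x y : mdist x y < i / 2 -> orbit_dist (proj a x) (proj a y) = mdist x y.
Proof.
move=> h; apply/eqP; rewrite eq_le orbit_dist_le /= leNgt.
apply/negP => /orbit_dist_lt[z zy xz].
have := metric_triangle z x y; rewrite [mdist z x]metric_sym => h'.
have E : z = y by apply: proj_close_eq => //; lra.
by rewrite E ltxx in xz.
Qed.

Lemma proj_line l : line l -> geodesic (@orbit_dist R G X a) (proj a \o l).
Proof.
move=> ll t; exists (i / 4); first exact: divr_gt0.
move=> s s'; rewrite !ltr_norml => /andP[s1 s2] /andP[s1' s2'].
by rewrite /= orbit_dist_eq ll // ltr_norml; apply/andP; split; lra.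
Qed.

(** Equality propagates in steps of [i / 4]: lines that agree at one time are at most [i / 2] apart
    one step away, and distinct points of an orbit are at least [i] apart. *)
Lemma line_lift_unique l l' : line l -> line l' -> proj a \o l = proj a \o l' ->
  l 0 = l' 0 -> l = l'.
Proof.
move=> ll ll' E l0.
have i4 : 0 < i / 4 by exact: divr_gt0.
have step s u : l s = l' s -> `|u - s| <= i / 4 -> l u = l' u.
  move=> ls us; apply: proj_close_eq; first by have := congr1 (@^~ u) E.
  apply: le_lt_trans (line_dist_le u s ll ll') _.
  by rewrite ls mdistxx; lra.
have H n s : `|s| <= n%:R * (i / 4) -> l s = l' s.
  elim: n s => [|n IH] s sn.
    by have -> : s = 0 by apply/eqP; rewrite -normr_le0; rewrite mul0r in sn.
  have n0 : 0 < n.+1%:R :> R by rewrite ltr0n.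
  have nn : n.+1%:R != 0 :> R by rewrite gt_eqF.
  (* This previous point is on the same side of 0 as [s], so both signs are treated at once. *)
  apply: (step (n%:R / n.+1%:R * s)).
    apply: IH; rewrite normrM ger0_norm ?divr_ge0 //.
    apply: le_trans (ler_wpM2l _ sn) _; first by rewrite divr_ge0.
    have -> : n%:R / n.+1%:R * (n.+1%:R * (i / 4)) = n%:R / n.+1%:R * n.+1%:R * (i / 4).
      exact: mulrA.
    by rewrite divfK.
  have -> : s - n%:R / n.+1%:R * s = s / n.+1%:R.
    by apply: (mulIf nn); rewrite divfK // mulrBl mulrAC divfK // -natr1; ring.
  by rewrite normrM normfV normr_nat ler_pdivrMr // mulrC.
apply/funext => s; apply: (H (Num.truncn (`|s| / (i / 4))).+1).
by rewrite -ler_pdivrMr // ltW // truncnS_gt.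
Qed.

Section Lifting.
Variable c : R -> orbit_space a.
Hypothesis gc : geodesic (@orbit_dist R G X a) c.

(** A local geodesic of the quotient need not be minimizing, so only the upper bound holds
    globally. *)
Lemma geodesic_lipschitz s t : s <= t -> orbit_dist (c s) (c t) <= t - s.
Proof.
move: t; apply: real_induction.
- have [e e0 ce] := gc s.
  by rewrite ce ?subrr ?normr0.
- move=> t st H; have [e e0 ce] := gc t; exists e => // u /andP[tu ue].
  have := orbit_dist_triangle (c t) (c s) (c u).
  rewrite (ce t u) ?subrr ?normr0 //; last by rewrite ger0_norm; lra.
  by rewrite distrC ger0_norm; lra.
- move=> t st H; have [e e0 ce] := gc t.
  pose u := Num.max s (t - e / 2).
  have u1 : s <= u by rewrite le_max lexx.
  have u2 : t - e / 2 <= u by rewrite le_max lexx orbT.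
  have u3 : u < t by rewrite gt_max st /=; lra.
  have := orbit_dist_triangle (c u) (c s) (c t).
  have := H u; rewrite u1 u3 => /(_ isT).
  rewrite (ce u t) ?subrr ?normr0 //; last by rewrite distrC ger0_norm; lra.
  by rewrite distrC ger0_norm; lra.
Qed.

(** The points [c (n b)] with [b = i / 8] are lifted one after the other to [U n], and each [c s] is
    lifted next to the last grid point before it. *)
Lemma forward_lift x0 : proj a x0 = c 0 -> exists F : R -> X, [/\ F 0 = x0,
  forall s, 0 <= s -> proj a (F s) = c s &
  forall s t, 0 <= s -> s <= t -> t - s <= i / 8 -> mdist (F s) (F t) <= t - s].
Proof.
move=> x0E; pose b := i / 8; have b0 : 0 < b by exact: divr_gt0.
have iE : i = 8 * b by rewrite /b; field.
have /choice[near nearP] : forall xq : X * orbit_space a, exists y,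
    orbit_dist (proj a xq.1) xq.2 < i / 4 ->
    proj a y = xq.2 /\ mdist xq.1 y = orbit_dist (proj a xq.1) xq.2.
  move=> [x q] /=; have [h|h] := pselect (orbit_dist (proj a x) q < i / 4); last by exists x.
  have [y yq xy] := orbit_dist_lt h; exists y => _; split=> //.
  by rewrite -yq orbit_dist_eq //; lra.
pose U := fix U n := if n is m.+1 then near (U m, c (m.+1%:R * b)) else x0.
have near_lift x s t : proj a x = c s -> s <= t -> t - s <= b ->
    proj a (near (x, c t)) = c t /\ mdist x (near (x, c t)) <= t - s.
  move=> xs st tb; have lip := geodesic_lipschitz st.
  have [|h1 h2] := nearP (x, c t); first by rewrite /= xs; lra.
  by split=> //; rewrite h2 /= xs.
have nS n : n.+1%:R * b = n%:R * b + b by rewrite -natr1; ring.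
have UP n : proj a (U n) = c (n%:R * b).
  elim: n => [|n IH]; first by rewrite mul0r.
  by have [] := near_lift _ _ (n.+1%:R * b) IH; rewrite // nS; lra.
have US n : mdist (U n) (U n.+1) <= b.
  have [||_ h] := near_lift _ _ (n.+1%:R * b) (UP n); [by rewrite nS; lra..|].
  by apply: le_trans h _; rewrite nS; lra.
pose k s := Num.truncn (s / b).
have kP s : 0 <= s -> (k s)%:R * b <= s /\ s < (k s)%:R * b + b.
  move=> s0; have sb : 0 <= s / b by rewrite divr_ge0 // ltW.
  have /andP[] := truncn_itv sb; rewrite -/(k s) -natr1 ler_pdivlMr // ltr_pdivrMr //.
  by rewrite mulrDl mul1r.
pose F s := near (U (k s), c s).
have FP s : 0 <= s -> proj a (F s) = c s /\ mdist (U (k s)) (F s) <= s - (k s)%:R * b.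
  by move=> s0; have [k1 k2] := kP s s0; apply: near_lift (UP _) _ _ => //; lra.
exists F; split; [|by move=> s /FP[]|].
- have [F1 F2] := FP 0 (lexx 0); apply/esym/proj_close_eq; first by rewrite x0E F1.
  have k0 : k 0 = 0%N by rewrite /k mul0r truncn0.
  by rewrite k0 /= mul0r subrr in F2; lra.
- move=> s t s0 st tb; have t0 := le_trans s0 st.
  have [F1 F2] := FP s s0; have [F3 F4] := FP t t0.
  have [k1 k2] := kP s s0; have [k3 k4] := kP t t0.
  have lip := geodesic_lipschitz st.
  have d1 : mdist (U (k s)) (U (k t)) <= b.
    have kk : (k s <= k t)%N by apply: le_truncn; rewrite ler_pM2r // invr_gt0.
    have kk' : (k t <= (k s).+1)%N.
      rewrite -ltnS -(ltr_nat R) -!natr1 -(ltr_pM2r b0) !mulrDl !mul1r.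
      by rewrite -/b in tb; lra.
    have [->|kn] := eqVneq (k s) (k t); first by rewrite mdistxx ltW.
    have -> : k t = (k s).+1 by apply/eqP; rewrite eqn_leq kk' ltn_neqAle kn.
    exact: US.
  have q1 := metric_triangle (F s) (U (k s)) (F t).
  have q2 := metric_triangle (U (k s)) (U (k t)) (F t).
  rewrite [mdist (F s) (U (k s))]metric_sym in q1.
  (* The crude bound [3 b] is below [i / 2]; then the distance equals the orbit distance, and
     [geodesic_lipschitz] gives the sharp bound. *)
  have : mdist (F s) (F t) < i / 2 by lra.
  by move=> /orbit_dist_eq <-; rewrite F1 F3.
Qed.

End Lifting.

Lemma geodesic_reverse c : geodesic (@orbit_dist R G X a) c ->
  geodesic (@orbit_dist R G X a) (fun s => c (- s)).
Proof.
move=> gc t; have [e e0 ce] := gc (- t); exists e => // s s' hs hs'.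
rewrite ce; first by rewrite -normrN; congr (`|_|); ring.
  by rewrite -normrN opprB opprK addrC.
by rewrite -normrN opprB opprK addrC.
Qed.

(** Lifts of the two half-lines are glued at a common point over [c 0]. The result is locally
    1-Lipschitz, so at small scale its distances are orbit distances, and it inherits the local
    isometry from [c]. *)
Lemma geodesic_lift c : geodesic (@orbit_dist R G X a) c ->
  exists2 l, geodesic mdist l & proj a \o l = c.
Proof.
move=> gc; have [x0 x0E] := proj_surj (c 0).
have [F [F0 FP FL]] := forward_lift gc x0E.
have x0E' : proj a x0 = c (- 0) by rewrite oppr0.
have [B [B0 BP BL]] := forward_lift (geodesic_reverse gc) x0E'.
pose l s := if 0 <= s then F s else B (- s).
have lP s : proj a (l s) = c s.
  rewrite /l; have [s0|s0] := leP 0 s; first exact: FP.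
  by rewrite BP ?opprK // oppr_ge0 ltW.
have lL s t : s <= t -> t - s <= i / 8 -> mdist (l s) (l t) <= t - s.
  move=> st ti; rewrite /l; have [s0|s0] := leP 0 s.
    by rewrite (le_trans s0 st); exact: FL.
  have s0' : 0 <= - s by lra.
  have [t0|t0] := leP 0 t.
    have h1 : mdist (B 0) (B (- s)) <= - s - 0 by apply: BL => //; lra.
    have h2 : mdist (F 0) (F t) <= t - 0 by apply: FL => //; lra.
    have := metric_triangle (B (- s)) x0 (F t).
    by rewrite [mdist (B _) x0]metric_sym -{1}B0 -F0; lra.
  have := BL (- t) (- s); rewrite metric_sym => h.
  by apply: le_trans (h _ _ _) _; lra.
exists l; last exact/funext.
have lE s t : s <= t -> t - s <= i / 8 -> mdist (l s) (l t) = orbit_dist (c s) (c t).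
  move=> st ti; rewrite -!lP orbit_dist_eq //.
  by apply: le_lt_trans (lL _ _ st ti) _; have := i0; lra.
move=> t; have [e e0 ce] := gc t.
have i16 : 0 < i / 16 by exact: divr_gt0.
exists (Num.min e (i / 16)); first by rewrite lt_min e0.
move=> s s'; rewrite !lt_min => /andP[s1 s2] /andP[s1' s2'].
rewrite -ce //; move: s2 s2'; rewrite !ltr_norml => /andP[? ?] /andP[? ?].
have [ss|ss] := leP s s'; first by rewrite lE //; lra.
have h : s - s' <= i / 8 by lra.
by rewrite metric_sym (lE _ _ (ltW ss) h) !ce // distrC.
Qed.

End OrbitSpace.

Section GXFlow.
Context (R : realType) (G : groupType) (X : metricType R).
Variable a : isometric_action G X.

(** Geodesics of the quotient are exactly the projections of lines. Two lifts differ by the element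
    that matches them at time 0, by [line_lift_unique]. *)
Lemma GX_flow_quotient (i : R) : CAT_m1 X -> 0 < i ->
  (forall x g, g <> 1%g -> i <= mdist x (a g x)) ->
  flow_quotient a setT
    (fun l (y : @GX R G X a) => geodesic mdist l /\ proj a \o l = val y)
    (@GX_dist R G X a) (@GX_flow R G X a).
Proof.
move=> catX i0 iX; split.
- by move=> l y [gl _]; split=> //; exact: geodesic_line.
- move=> l [ll _]; have ly : (proj a \o l) \in @GX R G X a.
    by apply/mem_set; exact: (proj_line i0 iX ll).
  by exists (SigSub ly); split=> //; exact: line_geodesic.
- move=> y; have [l gl ly] := geodesic_lift i0 iX (set_mem (valP y)).
  by exists l.
- by move=> l y y' [_ E] [_ E']; apply: val_inj; rewrite -E.
- move=> l l' y [gl ly] [gl' ly'].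
  have E : proj a \o l = proj a \o l' by rewrite ly.
  have /projP[g gE] := congr1 (@^~ 0) E.
  exists g; apply/esym.
  apply: (line_lift_unique i0 iX) => //.
  + by apply: geodesic_line => //; exact: geodesic_act.
  + exact: geodesic_line.
  + by rewrite -E; apply/funext => s /=; exact: proj_act.
- move=> l y g [gl ly]; split; first exact: geodesic_act.
  by rewrite -ly; apply/funext => s /=; exact: proj_act.
- by [].
- move=> l y t [gl ly]; split; first exact: geodesic_shift.
  by rewrite /= -ly.
Qed.

End GXFlow.

Theorem theorem3p4 (R : realType) (X : metricType R) (G : groupType)
    (a : isometric_action G X) :
  CAT_m1 X -> free_action a -> properly_discontinuous a -> non_elementary G ->
  (compact [set: orbit_space a] ->
     metric_anosov_flow (@GX_dist R G X a) (@GX_flow R G X a)) /\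
  (convex_cocompact a ->
     metric_anosov_flow (@hatGX_dist R G X a) (@hatGX_flow R G X a)).
Proof.
move=> catX freeG pdG _; split=> [cQ|cH]; last first.
  apply: (flow_quotient_anosov catX freeG pdG _ _ cH (hatGX_flow_quotient a catX)).
    exact: convex_convex_hull.
  by move=> g x; exact: convex_hull_act.
have cX : compact (proj a @` [set: X]).
  suff -> : proj a @` [set: X] = [set: orbit_space a] by [].
  by apply/seteqP; split=> // p _; have [x <-] := proj_surj p; exists x.
have [i i0 iX] := displacement_bound freeG pdG cX.
have iX' x g : g <> 1%g -> i <= mdist x (a g x) by exact: iX.
by apply: (flow_quotient_anosov catX freeG pdG _ _ cX (GX_flow_quotient catX i0 iX')).
Qed.
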